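(* Let $0<a\le\infty$, let $k(t)$ be in $\mathcal{K}_a$ and let $k(z)$ be its complex extension. Let $\rho_0$ be the distance from the origin of the singularity of $k(z)$ nearest to the origin. Then $$\int_0^a\frac{k(t)\ln^n t}{t^{\nu}(\omega+t)}\,dt=\sum_{j=0}^{\infty}(-1)^j\omega^j\;\mathrm{f.p.}\!\int_0^a\frac{k(t)\ln^n t}{t^{j+\nu+1}}\,dt+k(-\omega)\,\Delta_n(\nu,\omega)$$ for all $\omega$ satisfying $|\omega|<\min(\rho_0,a)$ and $|\operatorname{Arg}\omega|<\pi$, for all non-negative integers $n$, and for $0<\operatorname{Re}(\nu)<1$, where $$\Delta_n(\nu,\omega)=\frac{\pi}{\omega^{\nu}}\sum_{l=0}^n(-1)^l\binom{n}{l}(\operatorname{Log}\omega)^{n-l}D_l(\nu),$$ $$D_l(\nu)=(-1)^{[l/2]}\pi^l\csc(\pi\nu)\sum_{k=0}^{n}\frac{1}{2^k}\sum_{m=0}^k(-1)^m\binom{k}{m}(2m+1)^l\sum_{p=0}^{[(k-\gamma)/2]}(-1)^p\binom{k}{2p+\gamma}\cot^{2p+\gamma}(\pi\nu),\qquad \gamma=\frac{1-(-1)^l}{2}.$$ If the Stieltjes integral exists as $a\to\infty$, then the equality also holds for $a=\infty$, for all $|\omega|<\rho_0$ when $k(z)$ has at least one singularity, or for all $|\omega|<\infty$ when $k(z)$ is entire (with $|\operatorname{Arg}\omega|<\pi$ in both cases). Moreover, $$\int_0^a\frac{k(t)\ln^n t}{t^{\nu}(\omega+t)}\,dt\sim k(0)\,\Delta_n(\nu,\omega),\qquad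 \omega\to0 .$$
   Context: Class $\mathcal{K}_a$ ($0<a\le\infty$): functions $k(t)$ of a real variable such that (1) $k(0)\ne 0$; (2) $k(t)$ is the restriction to $[0,a)$ of a complex function $k(z)$ (the complex extension) that is analytic at every point of $[0,a)$; (3) the Mellin transform $\int_0^a k(t)t^{-\lambda}\,dt$ exists for $d<\operatorname{Re}(\lambda)<1$ for some $d<1$ ($d=-\infty$ if $a<\infty$, while $d$ may be finite or $-\infty$ if $a=\infty$). $k(-\omega)$ is the value of the complex extension, which is analytic in $|z|<\rho_0$; $\rho_0=\infty$ if $k(z)$ is entire. Finite-part integral: for finite $a$ write, for small $\epsilon>0$, $\int_\epsilon^a k(t)\ln^n t\;t^{-\lambda}\,dt=C_\epsilon+D_\epsilon$, where $C_\epsilon$ is the group of terms that converge as $\epsilon\to0^+$ and $D_\epsilon$ is the group of terms that have no finite limit, consisting only of such terms in powers of $\epsilon$ (possibly with complex exponents) and $\ln\epsilon$, with no constant term. Then $\mathrm{f.p.}\!\int_0^a k(t)\ln^n t\;t^{-\lambda}\,dt=\lim_{\epsilon\to0}C_\epsilon$. For $a=\infty$, $\mathrm{f.p.}\!\int_0^\infty=\lim_{a\to\infty}\mathrm{f.p.}\!\int_0^a$. $\operatorname{Log}\omega=\ln|\omega|+i\operatorname{Arg}\omega$, $-\pi<\operatorname{Arg}\omega\le\pi$, is the principal logarithm and $\omega^{\nu}=e^{\nu\operatorname{Log}\omega}$ takes its principal value. $[x]$ is the integer part (floor) of $x$; empty sums are $0$. The summation index $k$ in $D_l(\nu)$ is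 unrelated to the function $k$. *)

(* Defs.v *)
From Stdlib Require Import Reals ZArith.
From Coquelicot Require Import Coquelicot.
Open Scope R_scope.

Definition Cexp (z : C) : C :=
  (exp (Re z) * cos (Im z), exp (Re z) * sin (Im z)).

(* Principal argument, with values in (-PI, PI]; the value at z = 0 is
   meaningless. *)
Definition Arg (z : C) : R :=
  if Rle_dec 0 (Im z) then acos (Re z / Cmod z) else - acos (Re z / Cmod z).

Definition Log (z : C) : C := (ln (Cmod z), Arg z).

(* Principal value of z^mu; Coquelicot's own [^] on C has exponents in nat. *)
Definition Cpowc (z mu : C) : C := Cexp (mu * Log z)%C.

Definition Ccos (z : C) : C := ((Cexp (Ci * z) + Cexp (- (Ci * z))) / 2)%C.
Definition Csin (z : C) : C := ((Cexp (Ci * z) - Cexp (- (Ci * z))) / (2 * Ci))%C.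
Definition Ccsc (z : C) : C := (1 / Csin z)%C.
Definition Ccot (z : C) : C := (Ccos z / Csin z)%C.

Definition upto (a : Rbar) : (R -> Prop) -> Prop :=
  match a with
  | Finite b => at_left b
  | _ => Rbar_locally a
  end.

(* The integrands below are in general singular at 0 and possibly at a, so
   integrals are improper (and possibly only conditionally convergent) at both
   ends. *)
Definition ex_int0 (a : Rbar) (f : R -> C) : Prop :=
  ex_RInt_gen (V := C_R_NormedModule) f (at_right 0) (upto a).

Definition int0 (a : Rbar) (f : R -> C) : C :=
  RInt_gen (V := C_R_CompleteNormedModule) f (at_right 0) (upto a).

Definition analytic_at (f : C -> C) (z0 : C) : Prop :=
  exists (c : nat -> C) (r : R), 0 < r /\
    forall z : C, Cmod (z - z0) < r ->
      is_pseries (K := C_AbsRing) (V := C_NormedModule) c (z - z0)%C (f z).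

Definition complex_extension (a : Rbar) (k : R -> C) (kz : C -> C) : Prop :=
  forall t : R, 0 <= t -> Rbar_lt t a ->
    kz (RtoC t) = k t /\ analytic_at kz (RtoC t).

(* The values of k outside [0, a) are irrelevant. *)
Definition class_K (a : Rbar) (k : R -> C) : Prop :=
  k 0 <> RtoC 0 /\
  (exists kz : C -> C, complex_extension a k kz) /\
  (exists d : Rbar, Rbar_lt d 1 /\ (is_finite a -> d = m_infty) /\
     forall lambda : C, Rbar_lt d (Re lambda) -> Re lambda < 1 ->
       ex_int0 a (fun t => k t * Cpowc (RtoC t) (- lambda))%C).

(* Distance from 0 to the nearest singularity. The infimum is attained when
   there is a singularity, since the set of singular points is closed; it is
   p_infty exactly when kz is entire. *)
Definition singularity_distance (kz : C -> C) : Rbar :=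
  Glb_Rbar (fun r => exists z : C, r = Cmod z /\ ~ analytic_at kz z).

Definition fp_term (mu : C) (m : nat) (eps : R) : C :=
  (Cpowc (RtoC eps) mu * RtoC (ln eps) ^ m)%C.

(* Finite linear combinations of terms eps^mu ln^m eps none of which has a
   finite limit as eps -> 0+; this excludes in particular the constant term
   (mu = 0, m = 0). *)
Inductive divergent_group : (R -> C) -> Prop :=
| divergent_nil : divergent_group (fun _ => RtoC 0)
| divergent_cons (c mu : C) (m : nat) (D : R -> C) :
    ~ (exists l : C,
         filterlim (fp_term mu m) (at_right 0) (@locally C_UniformSpace l)) ->
    divergent_group D ->
    divergent_group (fun eps => c * fp_term mu m eps + D eps)%C.

(* v is the finite part of the integral of f over (0, b), b finite. *)
Definition is_fp_finite (f : R -> C) (b : R) (v : C) : Prop :=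
  exists Ce De : R -> C,
    at_right 0 (fun eps =>
      is_RInt_gen (V := C_R_NormedModule) f (at_point eps) (at_left b)
        (Ce eps + De eps)%C) /\
    divergent_group De /\
    filterlim Ce (at_right 0) (@locally C_UniformSpace v).

Definition is_fp (f : R -> C) (a : Rbar) (v : C) : Prop :=
  match a with
  | Finite b => is_fp_finite f b v
  | _ => exists F : R -> C,
      Rbar_locally a (fun b => is_fp_finite f b (F b)) /\
      filterlim F (Rbar_locally a) (@locally C_UniformSpace v)
  end.

(* The index gamma = (1 - (-1)^l) / 2. *)
Definition parity (l : nat) : nat := if Nat.odd l then 1%nat else 0%nat.

(* Sum of f p for 0 <= p <= N, empty when N < 0. *)
Definition Zsum (f : nat -> C) (N : Z) : C :=
  if (N <? 0)%Z then RtoC 0 else sum_n f (Z.to_nat N).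

(* [Z.div] rounds towards -oo, so for k = 0 and l odd the bound is -1 and the
   sum over p is empty. [Binomial.C] is only the binomial coefficient for a
   lower index not exceeding the upper one, which all the bounds guarantee. *)
Definition D_l (n l : nat) (nu : C) : C :=
  ((-1) ^ (l / 2)%nat * RtoC PI ^ l * Ccsc (RtoC PI * nu) *
   sum_n (fun k : nat =>
     / (2 ^ k) *
     sum_n (fun m : nat =>
       (-1) ^ m * RtoC (Binomial.C k m) * RtoC (INR (2 * m + 1)) ^ l) k *
     Zsum (fun p : nat =>
       (-1) ^ p * RtoC (Binomial.C k (2 * p + parity l)) *
       Ccot (RtoC PI * nu) ^ (2 * p + parity l))
       ((Z.of_nat k - Z.of_nat (parity l)) / 2)%Z) n)%C.

Definition Delta_n (n : nat) (nu w : C) : C :=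
  (RtoC PI / Cpowc w nu *
   sum_n (fun l : nat =>
     (-1) ^ l * RtoC (Binomial.C n l) * Log w ^ (n - l) * D_l n l nu) n)%C.

Definition stieltjes_integrand (k : R -> C) (n : nat) (nu w : C) (t : R) : C :=
  (k t * RtoC (ln t) ^ n / (Cpowc (RtoC t) nu * (w + RtoC t)))%C.

Definition moment_integrand (k : R -> C) (n j : nat) (nu : C) (t : R) : C :=
  (k t * RtoC (ln t) ^ n / Cpowc (RtoC t) (RtoC (INR j) + nu + 1))%C.

Definition stieltjes_expansion
    (a : Rbar) (k : R -> C) (kz : C -> C) (n : nat) (nu w : C) : Prop :=
  exists (FP : nat -> C) (S : C),
    (forall j : nat, is_fp (moment_integrand k n j nu) a (FP j)) /\
    is_series (K := C_AbsRing) (V := C_NormedModule)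
      (fun j => (-1) ^ j * w ^ j * FP j)%C S /\
    int0 a (stieltjes_integrand k n nu w) = (S + kz (- w) * Delta_n n nu w)%C.

(* Main.v *)
(* The Stieltjes integral minus the first N terms of the expansion is the finite part of
   (-w)^N k(t) t^(-N-nu) ln^n t / (w+t), because
     1/(w+t) = sum_(j<N) (-w)^j t^(-j-1) + (-w)^N t^(-N)/(w+t).
   Cut at r with |w| < r < rho_0. Beyond r everything carries the factor (|w|/r)^N, by integration by
   parts since k need only be conditionally integrable there. On (0, r) replace k by its Taylor
   polynomial: the remainder is geometrically small, and the monomials reproduce k(-w) times the
   integral of t^(-nu) ln^n t / (w+t) over the whole half-line.

   That integral is Delta_n(nu, w). With t = e^x, moving the line of integration by Log w reduces it
   to the moments J_l at w = 1; letting w = e^(i theta) with theta -> PI from both sides, the jump is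
   a Poisson-type kernel concentrating at t = 1, which gives a recursion for J_l, and the closed form of
   (-1)^l PI D_l satisfies the same recursion.

   Taylor coefficients on the full disc of analyticity come from Cauchy's formula on a circle of
   radius R, proved by differentiating s |-> int f(z + s (zeta - z)) zeta/(zeta - z) dtheta. *)
Require Import Defs.
From Stdlib Require Import Reals ZArith Lra Lia Classical.
From Coquelicot Require Import Coquelicot.
Open Scope R_scope.

(** Near a the function k has only conditionally convergent Mellin integrals, so beyond r no
    absolute estimate is available. Every tail comes from such an integral by Dirichlet's test,
    whose constant is common to all the multipliers t^(-j) and t^(-j)/(w+t); this keeps the tails
    geometric.

    The antiderivative of t^(-i-1-nu) ln^n t used here contains only powers with negative real
    exponent: it is purely divergent at 0 and vanishes at infinity. The finite part of such a
    monomial over (0, r) is therefore minus its integral over (r, oo), and so a half-line integral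
    appears although k lives on [0, a).

    In generating-function form the recursion for the moments says that sin(PI (nu - s)) times the
    integral of t^(s-nu)/(1+t) equals PI. It is triangular with diagonal 1/E - E, E = e^(i PI nu),
    nonzero for 0 < Re nu < 1. The closed form obeys it because its sum over k telescopes and a k-th
    difference kills polynomials of degree below k.

    For w -> 0 the series stays bounded while Delta_n is unbounded, which gives the asymptotics. *)

Notation is_cderive := (is_derive (K := R_AbsRing) (V := C_R_NormedModule)).
Notation is_CInt := (is_RInt (V := C_R_NormedModule)).
Notation ex_CInt := (ex_RInt (V := C_R_NormedModule)).
Notation CInt := (RInt (V := C_R_CompleteNormedModule)).
Notation is_CInt_gen := (is_RInt_gen (V := C_R_NormedModule)).
Notation CInt_gen_Chasles := (is_RInt_gen_Chasles (V := C_R_NormedModule)).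
Notation CInt_gen_at_point := (is_RInt_gen_at_point (V := C_R_NormedModule)).
Notation CInt_gen_value := (is_RInt_gen_unique (V := C_R_CompleteNormedModule)).
Notation CInt_gen_correct := (RInt_gen_correct (V := C_R_CompleteNormedModule)).
Notation CInt_gen := (RInt_gen (V := C_R_CompleteNormedModule)).
Notation CInt_gen_ext := (is_RInt_gen_ext (V := C_R_NormedModule)).
Notation R2_UniformSpace := (prod_UniformSpace R_UniformSpace R_UniformSpace).
Notation Clocally := (@locally C_UniformSpace).
Notation ccontinuous := (continuous (U := C_UniformSpace)).

(** * Continuity and real derivatives of complex-valued functions *)

Lemma norm_C_R (z : C) : norm (K := R_AbsRing) (V := C_R_NormedModule) z = Cmod z.
Proof. symmetry; apply Cmod_norm. Qed.

Lemma continuous_of_derive (f : R -> R) (x : R) : ex_derive f x -> continuous f x.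
Proof. apply (ex_derive_continuous (K := R_AbsRing) (V := R_NormedModule)). Qed.

Lemma is_RInt_continuous (f : R -> R) (a b : R) :
  (forall t, Rmin a b <= t <= Rmax a b -> continuous f t) -> is_RInt f a b (RInt f a b).
Proof. intros H. apply (RInt_correct (V := R_CompleteNormedModule)), (ex_RInt_continuous (V := R_CompleteNormedModule)), H. Qed.

Lemma C_ext (x y : C) : Re x = Re y -> Im x = Im y -> x = y.
Proof. destruct x, y; simpl; intros; congruence. Qed.

Ltac Cext := apply C_ext; simpl;
  match goal with |- @eq _ ?a ?b => change (@eq R a b) end.

Section continuity.
Context {T : UniformSpace}.

Lemma continuous_C (f : T -> C) (x : T) :
  continuous (U := R_UniformSpace) (fun t => Re (f t)) x -> continuous (U := R_UniformSpace) (fun t => Im (f t)) x ->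
  ccontinuous f x.
Proof.
intros H1 H2.
apply filterlim_locally; intros eps.
assert (K1 := proj1 (filterlim_locally (F := locally x) _ _) H1 eps).
assert (K2 := proj1 (filterlim_locally (F := locally x) _ _) H2 eps).
generalize (filter_and _ _ K1 K2); apply filter_imp.
intros y [A B]; split; [exact A|exact B].
Qed.

Lemma continuous_Re (f : T -> C) (x : T) :
  ccontinuous f x -> continuous (U := R_UniformSpace) (fun t => Re (f t)) x.
Proof.
intros H. apply filterlim_locally; intros eps.
generalize (proj1 (filterlim_locally (F := locally x) _ _) H eps).
apply filter_imp. intros y [A _]; exact A.
Qed.

Lemma continuous_Im (f : T -> C) (x : T) :
  ccontinuous f x -> continuous (U := R_UniformSpace) (fun t => Im (f t)) x.
Proof.
intros H. apply filterlim_locally; intros eps.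
generalize (proj1 (filterlim_locally (F := locally x) _ _) H eps).
apply filter_imp. intros y [_ A]; exact A.
Qed.

Lemma continuous_Cconst (c : C) (x : T) : ccontinuous (fun _ : T => c) x.
Proof. apply continuous_const. Qed.

Lemma continuous_Cplus (f g : T -> C) (x : T) :
  ccontinuous f x -> ccontinuous g x -> ccontinuous (fun t => f t + g t)%C x.
Proof.
intros Hf Hg. apply continuous_C.
- apply (continuous_plus (V := R_NormedModule) (fun t => Re (f t)) (fun t => Re (g t)));
   apply continuous_Re; assumption.
- apply (continuous_plus (V := R_NormedModule) (fun t => Im (f t)) (fun t => Im (g t)));
   apply continuous_Im; assumption.
Qed.

Lemma continuous_Copp (f : T -> C) (x : T) :
  ccontinuous f x -> ccontinuous (fun t => - f t)%C x.
Proof.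
intros Hf. apply continuous_C.
- apply (continuous_opp (V := R_NormedModule) (fun t => Re (f t))), continuous_Re; assumption.
- apply (continuous_opp (V := R_NormedModule) (fun t => Im (f t))), continuous_Im; assumption.
Qed.

Lemma continuous_Cmult (f g : T -> C) (x : T) :
  ccontinuous f x -> ccontinuous g x -> ccontinuous (fun t => f t * g t)%C x.
Proof.
intros Hf Hg.
assert (F1 := continuous_Re _ _ Hf). assert (F2 := continuous_Im _ _ Hf).
assert (G1 := continuous_Re _ _ Hg). assert (G2 := continuous_Im _ _ Hg).
apply continuous_C.
- apply (continuous_minus (V := R_NormedModule) (fun t => Re (f t) * Re (g t)) (fun t => Im (f t) * Im (g t)));
    [apply (continuous_mult (K := R_AbsRing) (fun t => Re (f t)) (fun t => Re (g t)))
    |apply (continuous_mult (K := R_AbsRing) (fun t => Im (f t)) (fun t => Im (g t)))]; assumption.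
- apply (continuous_plus (V := R_NormedModule) (fun t => Re (f t) * Im (g t)) (fun t => Im (f t) * Re (g t)));
    [apply (continuous_mult (K := R_AbsRing) (fun t => Re (f t)) (fun t => Im (g t)))
    |apply (continuous_mult (K := R_AbsRing) (fun t => Im (f t)) (fun t => Re (g t)))]; assumption.
Qed.

Lemma continuous_RtoC (f : T -> R) (x : T) :
  continuous (U := R_UniformSpace) f x -> ccontinuous (fun t => RtoC (f t)) x.
Proof. intros H; apply continuous_C; simpl; [exact H|apply continuous_const]. Qed.

Lemma continuous_Cinv (f : T -> C) (x : T) :
  ccontinuous f x -> f x <> 0 -> ccontinuous (fun t => / f t)%C x.
Proof.
intros Hf H0.
assert (Hre := continuous_Re _ _ Hf). assert (Him := continuous_Im _ _ Hf).
assert (Hd : Re (f x) ^ 2 + Im (f x) ^ 2 <> 0).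
{ rewrite <- Cmod2_alt. apply pow_nonzero. apply Cmod_gt_0 in H0. lra. }
assert (Hi : continuous (U := R_UniformSpace) (fun t => / (Re (f t) ^ 2 + Im (f t) ^ 2)) x).
{ apply (continuous_comp (fun t => Re (f t) ^ 2 + Im (f t) ^ 2) (fun y => / y)).
  - apply (continuous_plus (V := R_NormedModule)).
    + apply (continuous_comp (fun t => Re (f t)) (fun y => y ^ 2)); [exact Hre|].
      apply continuous_of_derive. auto_derive. exact I.
    + apply (continuous_comp (fun t => Im (f t)) (fun y => y ^ 2)); [exact Him|].
      apply continuous_of_derive. auto_derive. exact I.
  - apply continuous_of_derive. auto_derive. exact Hd. }
apply continuous_C; simpl; unfold Rdiv.
- apply (continuous_mult (K := R_AbsRing)); [exact Hre| exact Hi].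
- apply (continuous_mult (K := R_AbsRing)); [apply (continuous_opp (V := R_NormedModule)); exact Him| exact Hi].
Qed.

Lemma continuous_Cpow (f : T -> C) (n : nat) (x : T) :
  ccontinuous f x -> ccontinuous (fun t => f t ^ n)%C x.
Proof.
intros Hf; induction n as [|n IH]; simpl.
- apply continuous_Cconst.
- apply continuous_Cmult; assumption.
Qed.

Lemma continuous_Cexp (f : T -> C) (x : T) :
  ccontinuous f x -> ccontinuous (fun t => Cexp (f t)) x.
Proof.
intros Hf.
assert (Hre := continuous_Re _ _ Hf). assert (Him := continuous_Im _ _ Hf).
apply continuous_C; simpl; apply (continuous_mult (K := R_AbsRing)).
1,3: apply (continuous_comp (fun t => Re (f t)) exp); [exact Hre|];
   apply continuous_of_derive; auto_derive; exact I.
- apply (continuous_comp (fun t => Im (f t)) cos); [exact Him|];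
   apply continuous_of_derive; auto_derive; exact I.
- apply (continuous_comp (fun t => Im (f t)) sin); [exact Him|];
   apply continuous_of_derive; auto_derive; exact I.
Qed.

End continuity.

(** Written as f = Re f 1 + Im f i with the constant vectors 1 and i of the real plane, f is a sum
    of real functions times fixed vectors, and the real rules apply. *)
Lemma is_cderive_pair (f : R -> C) (x : R) (d : C) :
  is_derive (fun t => Re (f t)) x (Re d) -> is_derive (fun t => Im (f t)) x (Im d) ->
  is_cderive f x d.
Proof.
intros H1 H2.
apply is_derive_ext with (fun t => plus (G := C_R_NormedModule)
   (scal (V := C_R_NormedModule) (Re (f t)) (RtoC 1)) (scal (V := C_R_NormedModule) (Im (f t)) Ci)).
- intros t. rewrite !scal_R_Cmult. change (RtoC (Re (f t)) * RtoC 1 + RtoC (Im (f t)) * Ci = f t)%C. Cext; ring.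
- replace d with (plus (G := C_R_NormedModule)
   (scal (V := C_R_NormedModule) (Re d) (RtoC 1)) (scal (V := C_R_NormedModule) (Im d) Ci)).
  2:{ rewrite !scal_R_Cmult. change (RtoC (Re d) * RtoC 1 + RtoC (Im d) * Ci = d)%C. Cext; ring. }
  apply (is_derive_plus (V := C_R_NormedModule)).
  + apply (is_derive_scal_l (K := R_AbsRing) (V := C_R_NormedModule)); exact H1.
  + apply (is_derive_scal_l (K := R_AbsRing) (V := C_R_NormedModule)); exact H2.
Qed.

Lemma is_cderive_Re (f : R -> C) (x : R) (d : C) :
  is_cderive f x d -> is_derive (fun t => Re (f t)) x (Re d).
Proof.
intros H.
apply (filterdiff_ext_lin (K := R_AbsRing) (U := R_NormedModule) (V := R_NormedModule) (fun t => Re (f t))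
  (fun y => Re (scal (V := C_R_NormedModule) y d))); [|intros y; reflexivity].
apply (filterdiff_comp' (K := R_AbsRing) (U := R_NormedModule) (V := C_R_NormedModule) (W := R_NormedModule)
  f (fun z : C => Re z) x (fun y => scal (V := C_R_NormedModule) y d) (fun z : C => Re z)); [exact H|].
apply (filterdiff_linear (K := R_AbsRing) (U := C_R_NormedModule) (V := R_NormedModule) (fun z : C => Re z)). apply (is_linear_fst (K := R_AbsRing) (U := R_NormedModule) (V := R_NormedModule)).
Qed.

Lemma is_cderive_Im (f : R -> C) (x : R) (d : C) :
  is_cderive f x d -> is_derive (fun t => Im (f t)) x (Im d).
Proof.
intros H.
apply (filterdiff_ext_lin (K := R_AbsRing) (U := R_NormedModule) (V := R_NormedModule) (fun t => Im (f t))
  (fun y => Im (scal (V := C_R_NormedModule) y d))); [|intros y; reflexivity].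
apply (filterdiff_comp' (K := R_AbsRing) (U := R_NormedModule) (V := C_R_NormedModule) (W := R_NormedModule)
  f (fun z : C => Im z) x (fun y => scal (V := C_R_NormedModule) y d) (fun z : C => Im z)); [exact H|].
apply (filterdiff_linear (K := R_AbsRing) (U := C_R_NormedModule) (V := R_NormedModule) (fun z : C => Im z)). apply (is_linear_snd (K := R_AbsRing) (U := R_NormedModule) (V := R_NormedModule)).
Qed.

Lemma is_cderive_eq (f : R -> C) (x : R) (d d' : C) :
  is_cderive f x d -> d = d' -> is_cderive f x d'.
Proof. intros H <-; exact H. Qed.

Lemma is_cderive_const (c : C) (x : R) : is_cderive (fun _ => c) x (RtoC 0).
Proof. apply (is_derive_const (K := R_AbsRing) (V := C_R_NormedModule)). Qed.

Lemma is_cderive_RtoC (f : R -> R) (x d : R) :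
  is_derive f x d -> is_cderive (fun t => RtoC (f t)) x (RtoC d).
Proof. intros H; apply is_cderive_pair; simpl; [exact H|apply (is_derive_const (V := R_NormedModule))]. Qed.

Lemma is_cderive_plus (f g : R -> C) (x : R) (df dg : C) :
  is_cderive f x df -> is_cderive g x dg -> is_cderive (fun t => f t + g t)%C x (df + dg)%C.
Proof. intros; apply (is_derive_plus (V := C_R_NormedModule)); assumption. Qed.

Lemma is_cderive_opp (f : R -> C) (x : R) (df : C) :
  is_cderive f x df -> is_cderive (fun t => - f t)%C x (- df)%C.
Proof. intros; apply (is_derive_opp (V := C_R_NormedModule)); assumption. Qed.

Lemma is_cderive_mult (f g : R -> C) (x : R) (df dg : C) :
  is_cderive f x df -> is_cderive g x dg ->
  is_cderive (fun t => f t * g t)%C x (df * g x + f x * dg)%C.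
Proof.
intros Hf Hg.
assert (F1 := is_cderive_Re _ _ _ Hf). assert (F2 := is_cderive_Im _ _ _ Hf).
assert (G1 := is_cderive_Re _ _ _ Hg). assert (G2 := is_cderive_Im _ _ _ Hg).
assert (M : forall (a b : R -> R) da db, is_derive a x da -> is_derive b x db ->
   is_derive (fun t => a t * b t) x (da * b x + a x * db)).
{ intros a b da db Ha Hb. apply (is_derive_mult (K := R_AbsRing)); [exact Ha|exact Hb|intros; apply Rmult_comm]. }
apply is_cderive_pair; unfold Cmult; simpl.
- replace (_ + _) with ((Re df * Re (g x) + Re (f x) * Re dg) - (Im df * Im (g x) + Im (f x) * Im dg))
    by (unfold Re, Im; ring).
  apply (is_derive_minus (V := R_NormedModule)); apply M; assumption.
- replace (_ + _) with ((Re df * Im (g x) + Re (f x) * Im dg) + (Im df * Re (g x) + Im (f x) * Re dg))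
    by (unfold Re, Im; ring).
  apply (is_derive_plus (V := R_NormedModule)); apply M; assumption.
Qed.

Lemma is_cderive_inv (f : R -> C) (x : R) (df : C) :
  is_cderive f x df -> f x <> 0 -> is_cderive (fun t => / f t)%C x (- (df / (f x * f x)))%C.
Proof.
intros Hf H0.
assert (F1 := is_cderive_Re _ _ _ Hf). assert (F2 := is_cderive_Im _ _ _ Hf).
assert (Hd : Re (f x) ^ 2 + Im (f x) ^ 2 <> 0).
{ rewrite <- Cmod2_alt. apply pow_nonzero. apply Cmod_gt_0 in H0. lra. }
assert (Hd' : (Re (f x) * Re (f x) - Im (f x) * Im (f x))^2 + (Re (f x) * Im (f x) + Im (f x) * Re (f x))^2 <> 0).
{ replace (_ + _) with ((Re (f x) ^ 2 + Im (f x) ^ 2)^2) by ring. apply pow_nonzero; exact Hd. }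
set (a := fun t => Re (f t)) in *. set (b := fun t => Im (f t)) in *.
assert (Ea : Derive (fun y => a y) x = Re df) by (apply is_derive_unique; exact F1).
assert (Eb : Derive (fun y => b y) x = Im df) by (apply is_derive_unique; exact F2).
assert (exa : ex_derive a x) by (eexists; exact F1).
assert (exb : ex_derive b x) by (eexists; exact F2).
change (Re (f x)) with (a x) in *. change (Im (f x)) with (b x) in *.
apply is_cderive_pair.
- apply is_derive_ext with (fun t => a t / (a t ^ 2 + b t ^ 2)); [intros; reflexivity|].
  auto_derive; [repeat split; try assumption; replace (_ + _) with (a x ^ 2 + b x ^ 2) by ring; assumption|].
  rewrite Ea, Eb. unfold Cdiv, Cmult, Cinv, Copp; simpl. unfold a, b, Re, Im in *. field.
  split; intros H; [apply Hd'|apply Hd]; rewrite <- H; ring.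
- apply is_derive_ext with (fun t => - b t / (a t ^ 2 + b t ^ 2)); [intros; reflexivity|].
  auto_derive; [repeat split; try assumption; replace (_ + _) with (a x ^ 2 + b x ^ 2) by ring; assumption|].
  rewrite Ea, Eb. unfold Cdiv, Cmult, Cinv, Copp; simpl. unfold a, b, Re, Im in *. field.
  split; intros H; [apply Hd'|apply Hd]; rewrite <- H; ring.
Qed.

Lemma is_cderive_exp (f : R -> C) (x : R) (df : C) :
  is_cderive f x df -> is_cderive (fun t => Cexp (f t)) x (Cexp (f x) * df)%C.
Proof.
intros Hf.
assert (F1 := is_cderive_Re _ _ _ Hf). assert (F2 := is_cderive_Im _ _ _ Hf).
set (a := fun t => Re (f t)) in *. set (b := fun t => Im (f t)) in *.
assert (Ea : Derive (fun y => a y) x = Re df) by (apply is_derive_unique; exact F1).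
assert (Eb : Derive (fun y => b y) x = Im df) by (apply is_derive_unique; exact F2).
assert (exa : ex_derive a x) by (eexists; exact F1).
assert (exb : ex_derive b x) by (eexists; exact F2).
apply is_cderive_pair.
- apply is_derive_ext with (fun t => exp (a t) * cos (b t)); [intros; reflexivity|].
  auto_derive; [repeat split; assumption|].
  rewrite Ea, Eb. unfold Cexp, Cmult; simpl. unfold a, b, Re, Im. ring.
- apply is_derive_ext with (fun t => exp (a t) * sin (b t)); [intros; reflexivity|].
  auto_derive; [repeat split; assumption|].
  rewrite Ea, Eb. unfold Cexp, Cmult; simpl. unfold a, b, Re, Im. ring.
Qed.

Lemma is_cderive_pow (f : R -> C) (n : nat) (x : R) (df : C) :
  is_cderive f x df -> is_cderive (fun t => f t ^ n)%C x (RtoC (INR n) * f x ^ pred n * df)%C.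
Proof.
intros Hf; induction n as [|n IH].
- change (is_cderive (fun _ => RtoC 1) x (RtoC 0 * 1 * df)%C).
  replace (RtoC 0 * 1 * df)%C with (RtoC 0) by ring. apply is_cderive_const.
- eapply is_cderive_eq; [apply (is_cderive_mult f (fun t => f t ^ n)%C); eassumption|].
  rewrite S_INR, RtoC_plus. destruct n; simpl pred; [simpl; ring|]. rewrite (Cpow_S (f x) n). ring.
Qed.

(** * Limits and integrals *)

(** Neighbourhoods in [C_UniformSpace] come from the product structure, hence from squares; the
    normed module over R has the same topology and lets limits be tested by the modulus. *)
Lemma filterlim_C {T : Type} (F : (T -> Prop) -> Prop) {FF : Filter F} (f : T -> C) (l : C) :
  filterlim f F (Clocally l) <->
  forall eps, 0 < eps -> F (fun x => Cmod (f x - l) < eps).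
Proof.
split.
- intros H eps He.
  assert (K := proj1 (filterlim_locally_ball_norm (K := R_AbsRing) (U := C_R_NormedModule) f l) H (mkposreal eps He)).
  revert K; apply filter_imp. intros x Hx. unfold ball_norm in Hx.
  rewrite norm_C_R in Hx. exact Hx.
- intros H.
  apply (proj2 (filterlim_locally_ball_norm (K := R_AbsRing) (U := C_R_NormedModule) f l)).
  intros [eps He]. generalize (H eps He). apply filter_imp. intros x Hx.
  unfold ball_norm. rewrite norm_C_R. exact Hx.
Qed.

Lemma filterlim_C_plus {T : Type} (F : (T -> Prop) -> Prop) {FF : Filter F} (f g : T -> C) (l m : C) :
  filterlim f F (Clocally l) -> filterlim g F (Clocally m) ->
  filterlim (fun x => f x + g x)%C F (Clocally (l + m)%C).
Proof.
intros Hf Hg. apply filterlim_C; [exact FF|]. intros eps He.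
assert (A := proj1 (filterlim_C _ _ _) Hf (eps/2) ltac:(lra)).
assert (B := proj1 (filterlim_C _ _ _) Hg (eps/2) ltac:(lra)).
generalize (filter_and _ _ A B); apply filter_imp. intros x [HA HB].
replace (f x + g x - (l + m))%C with ((f x - l) + (g x - m))%C by ring.
eapply Rle_lt_trans; [apply Cmod_triangle|lra].
Qed.

Lemma filterlim_C_mult_const {T : Type} (F : (T -> Prop) -> Prop) {FF : Filter F} (c : C) (f : T -> C) (l : C) :
  filterlim f F (Clocally l) ->
  filterlim (fun x => c * f x)%C F (Clocally (c * l)%C).
Proof.
intros Hf. apply filterlim_C; [exact FF|]. intros eps He.
assert (Hc : 0 < Cmod c + 1) by (generalize (Cmod_ge_0 c); lra).
assert (A := proj1 (filterlim_C _ _ _) Hf (eps/(Cmod c + 1)) ltac:(apply Rdiv_lt_0_compat; lra)).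
revert A; apply filter_imp. intros x HA.
replace (c * f x - c * l)%C with (c * (f x - l))%C by ring. rewrite Cmod_mult.
apply Rle_lt_trans with ((Cmod c + 1) * Cmod (f x - l)).
- apply Rmult_le_compat_r; [apply Cmod_ge_0|lra].
- replace eps with ((Cmod c + 1) * (eps / (Cmod c + 1))) by (field; lra).
  apply Rmult_lt_compat_l; lra.
Qed.

Lemma filterlim_C_const {T : Type} (F : (T -> Prop) -> Prop) {FF : Filter F} (l : C) :
  filterlim (fun _ : T => l) F (Clocally l).
Proof.
apply filterlim_C; [exact FF|]; intros eps He. apply filter_forall. intros _.
replace (l - l)%C with (RtoC 0) by ring. rewrite Cmod_0. exact He.
Qed.

Lemma filterlim_C_unique {T : Type} (F : (T -> Prop) -> Prop) {FF : ProperFilter F} (f : T -> C) (l m : C) :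
  filterlim f F (Clocally l) -> filterlim f F (Clocally m) -> l = m.
Proof.
intros Hf Hg.
apply (filterlim_locally_unique (K := R_AbsRing) (V := C_R_NormedModule) f l m Hf Hg).
Qed.

Lemma filterlim_C_le {T : Type} (F : (T -> Prop) -> Prop) {FF : ProperFilter F} (f : T -> C) (l : C) (B : R) :
  filterlim f F (Clocally l) -> F (fun x => Cmod (f x) <= B) -> Cmod l <= B.
Proof.
intros Hf HB. apply Rnot_lt_le; intros Hlt.
assert (A := proj1 (filterlim_C _ _ _) Hf (Cmod l - B) ltac:(lra)).
destruct (filter_ex _ (filter_and _ _ A HB)) as [x [H1 H2]].
assert (Cmod l <= Cmod (f x) + Cmod (f x - l)).
{ replace l with (f x + (- (f x - l)))%C at 1 by ring.
  eapply Rle_trans; [apply Cmod_triangle|]. rewrite Cmod_opp. lra. }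
lra.
Qed.

Lemma filterlim_C_cauchy {T : Type} (F : (T -> Prop) -> Prop) {FF : ProperFilter F} (f : T -> C) :
  (forall eps, 0 < eps -> exists P : T -> Prop, F P /\ forall u v, P u -> P v -> Cmod (f u - f v) < eps) ->
  exists l, filterlim f F (Clocally l).
Proof.
intros H.
apply (proj1 (filterlim_locally_cauchy (U := C_R_CompleteNormedModule) (F := F) f)).
intros [eps He]. destruct (H eps He) as [P [HP HPP]]. exists P; split; [exact HP|].
intros u v Hu Hv.
apply (norm_compat1 (K := R_AbsRing) (V := C_R_NormedModule)).
rewrite norm_C_R. apply (HPP v u Hv Hu).
Qed.

Lemma is_CInt_Cmult (c : C) (f : R -> C) (a b : R) (l : C) :
  is_CInt f a b l -> is_CInt (fun t => c * f t)%C a b (c * l)%C.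
Proof.
intros H.
assert (H1 := is_RInt_fct_extend_fst (U := R_NormedModule) (V := R_NormedModule) f a b l H).
assert (H2 := is_RInt_fct_extend_snd (U := R_NormedModule) (V := R_NormedModule) f a b l H).
apply (is_RInt_fct_extend_pair (U := R_NormedModule) (V := R_NormedModule)); simpl.
- apply (is_RInt_minus (V := R_NormedModule)); apply (is_RInt_scal (V := R_NormedModule)); assumption.
- apply (is_RInt_plus (V := R_NormedModule)); apply (is_RInt_scal (V := R_NormedModule)); assumption.
Qed.

Lemma is_CInt_plus (f g : R -> C) (a b : R) (l m : C) :
  is_CInt f a b l -> is_CInt g a b m -> is_CInt (fun t => f t + g t)%C a b (l + m)%C.
Proof. intros; apply (is_RInt_plus (V := C_R_NormedModule)); assumption. Qed.

Lemma is_CInt_Cmod_le (f : R -> C) (g : R -> R) (a b : R) (l : C) (m : R) :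
  a <= b -> (forall x, a <= x <= b -> Cmod (f x) <= g x) ->
  is_CInt f a b l -> is_RInt g a b m -> Cmod l <= m.
Proof.
intros Hab H Hf Hg. rewrite <- norm_C_R.
apply (norm_RInt_le (V := C_R_NormedModule) f g a b l m Hab); [|exact Hf|exact Hg].
intros x Hx. rewrite norm_C_R. apply H; exact Hx.
Qed.

Lemma is_CInt_Cmod_le_const (f : R -> C) (B : R) (a b : R) (l : C) :
  a <= b -> (forall x, a <= x <= b -> Cmod (f x) <= B) ->
  is_CInt f a b l -> Cmod l <= (b - a) * B.
Proof.
intros Hab H Hf. apply (is_CInt_Cmod_le f (fun _ => B) a b); try assumption.
apply (is_RInt_const (V := R_NormedModule)).
Qed.

Lemma is_CInt_CInt (f : R -> C) (a b : R) :
  (forall x, Rmin a b <= x <= Rmax a b -> ccontinuous f x) -> is_CInt f a b (CInt f a b).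
Proof.
intros H. apply (RInt_correct (V := C_R_CompleteNormedModule)).
apply (ex_RInt_continuous (V := C_R_CompleteNormedModule)). exact H.
Qed.

Lemma is_CInt_unique (f : R -> C) (a b : R) (l : C) : is_CInt f a b l -> CInt f a b = l.
Proof. apply (is_RInt_unique (V := C_R_CompleteNormedModule)). Qed.

Lemma is_CInt_derive (f df : R -> C) (a b : R) :
  (forall x, Rmin a b <= x <= Rmax a b -> is_cderive f x (df x)) ->
  (forall x, Rmin a b <= x <= Rmax a b -> ccontinuous df x) ->
  is_CInt df a b (f b - f a)%C.
Proof. intros H1 H2. apply (is_RInt_derive (V := C_R_CompleteNormedModule) f df); assumption. Qed.

Lemma is_CInt_ext (f g : R -> C) (a b : R) (l : C) :
  (forall x, Rmin a b < x < Rmax a b -> f x = g x) -> is_CInt f a b l -> is_CInt g a b l.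
Proof. apply (is_RInt_ext (V := C_R_NormedModule)). Qed.

Lemma is_cderive_continuous (f : R -> C) (x : R) (d : C) : is_cderive f x d -> ccontinuous f x.
Proof.
intros H. apply (ex_derive_continuous (K := R_AbsRing) (V := C_R_NormedModule)). exists d; exact H.
Qed.

(** * The complex exponential *)

Lemma Cexp_plus (x y : C) : Cexp (x + y) = (Cexp x * Cexp y)%C.
Proof. apply C_ext; unfold Cexp, Cmult, Cplus, RtoC, Re, Im; simpl; rewrite exp_plus, ?cos_plus, ?sin_plus; ring. Qed.

Lemma Cexp_0 : Cexp 0 = RtoC 1.
Proof. apply C_ext; unfold Cexp, Cmult, Cplus, RtoC, Re, Im; simpl; rewrite exp_0, ?cos_0, ?sin_0; ring. Qed.

Lemma Cmod_Cexp (z : C) : Cmod (Cexp z) = exp (Re z).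
Proof.
assert (H : Cmod (Cexp z) ^ 2 = exp (Re z) ^ 2).
{ rewrite Cmod2_alt. unfold Cexp; simpl.
  generalize (sin2_cos2 (Im z)); unfold Rsqr; intros E. nra. }
generalize (Cmod_ge_0 (Cexp z)), (exp_pos (Re z)). nra.
Qed.

Lemma Cexp_neq_0 (z : C) : Cexp z <> 0.
Proof. apply Cmod_gt_0. rewrite Cmod_Cexp. apply exp_pos. Qed.

Lemma Cexp_opp (z : C) : Cexp (- z) = (/ Cexp z)%C.
Proof.
assert (H : (Cexp (- z) * Cexp z)%C = RtoC 1).
{ rewrite <- Cexp_plus. replace (- z + z)%C with (RtoC 0) by ring. apply Cexp_0. }
assert (Hz := Cexp_neq_0 z).
replace (/ Cexp z)%C with ((Cexp (- z) * Cexp z) * / Cexp z)%C by (rewrite H; ring).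
field. exact Hz.
Qed.

Lemma Cexp_RtoC (x : R) : Cexp (RtoC x) = RtoC (exp x).
Proof. apply C_ext; unfold Cexp, Cmult, Cplus, RtoC, Re, Im; simpl; rewrite ?cos_0, ?sin_0; ring. Qed.

Lemma Cexp_INR_mult (m : nat) (z : C) : Cexp (RtoC (INR m) * z) = (Cexp z ^ m)%C.
Proof.
induction m as [|m IH]; [simpl; rewrite Cmult_0_l; apply Cexp_0|].
rewrite S_INR, RtoC_plus, Cpow_S, <- IH, <- Cexp_plus. f_equal. ring.
Qed.

(** [field] and [ring] select their structure from the syntactic type of the equation, and sums over
    [C_AbelianMonoid] leave a type that is only convertible to [C]. *)
Ltac Cfield := match goal with |- @eq _ ?a ?b => change (@eq C a b) end; field.

Ltac Cring := match goal with |- @eq _ ?a ?b => change (@eq C a b) end; apply Ceq_minus; ring.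

Notation csum := (sum_n (G := C_AbelianMonoid)).

Lemma csum_0 (a : nat -> C) : csum a 0 = a 0%nat.
Proof. apply (sum_O (G := C_AbelianMonoid)). Qed.

Lemma csum_S (a : nat -> C) (n : nat) : csum a (S n) = (csum a n + a (S n))%C.
Proof. apply (sum_Sn (G := C_AbelianMonoid)). Qed.

Lemma csum_ext (a b : nat -> C) (n : nat) :
  (forall m, (m <= n)%nat -> a m = b m) -> csum a n = csum b n.
Proof. apply (sum_n_ext_loc (G := C_AbelianMonoid)). Qed.

Lemma csum_plus (a b : nat -> C) (n : nat) :
  csum (fun m => a m + b m)%C n = (csum a n + csum b n)%C.
Proof. induction n as [|n IH]; [rewrite !csum_0|rewrite !csum_S, IH; Cring]; reflexivity. Qed.

Lemma csum_mult_l (c : C) (a : nat -> C) (n : nat) :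
  csum (fun m => c * a m)%C n = (c * csum a n)%C.
Proof. induction n as [|n IH]; [rewrite !csum_0|rewrite !csum_S, IH; Cring]; reflexivity. Qed.

Lemma csum_shift (a : nat -> C) (n : nat) :
  csum a (S n) = (a 0%nat + csum (fun m => a (S m)) n)%C.
Proof.
induction n as [|n IH]; [rewrite csum_S, !csum_0; reflexivity|].
rewrite csum_S, IH, csum_S. Cring.
Qed.

Lemma csum_Cmod_le (a : nat -> C) (b : nat -> R) (n : nat) :
  (forall m, (m <= n)%nat -> Cmod (a m) <= b m) -> Cmod (csum a n) <= sum_n b n.
Proof.
induction n as [|n IH]; intros H.
- rewrite csum_0, sum_O. apply H; lia.
- rewrite csum_S, sum_Sn. eapply Rle_trans; [apply Cmod_triangle|].
  apply Rplus_le_compat; [apply IH; intros; apply H; lia|apply H; lia].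
Qed.

Lemma sum_n_half_le (B : R) (n : nat) : 0 <= B -> sum_n (fun m => B * (/ 2) ^ m) n <= 2 * B.
Proof.
intros HB.
assert (H : sum_n (fun m => B * (/ 2) ^ m) n = B * (2 - (/ 2) ^ n)).
{ induction n as [|n IH]; [rewrite sum_O; simpl; ring|].
  rewrite sum_Sn, IH. unfold plus; simpl. field. }
rewrite H. assert (0 < (/ 2) ^ n) by (apply pow_lt; lra). nra.
Qed.

Lemma csum_geometric_cvg (a : nat -> C) (B : R) :
  (forall m, Cmod (a m) <= B * (/ 2) ^ m) ->
  exists l, filterlim (csum a) eventually (Clocally l).
Proof.
intros H.
assert (E : ex_series (K := R_AbsRing) (V := C_R_CompleteNormedModule) a).
{ apply (ex_series_le (K := R_AbsRing) (V := C_R_CompleteNormedModule) a (fun m => B * (/ 2) ^ m)).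
  - intros n. rewrite norm_C_R. apply H.
  - apply (ex_series_scal (K := R_AbsRing) (V := R_NormedModule) B).
    apply ex_series_geom. rewrite Rabs_pos_eq; lra. }
exact E.
Qed.

(** * Differentiation of complex functions along real paths *)

(** There is no quotient and no exclusion of y = t, so that the quadratic bounds of [C1_at] can be
    chained with it by the triangle inequality alone. *)
Lemma is_cderive_iff (f : R -> C) (t : R) (d : C) :
  is_cderive f t d <->
  forall eps, 0 < eps -> locally t (fun y => Cmod (f y - f t - RtoC (y - t) * d) <= eps * Rabs (y - t)).
Proof.
split.
- intros [_ H] eps He.
  generalize (H t (fun P HP => HP) (mkposreal eps He)). apply filter_imp. intros y Hy.
  rewrite norm_C_R in Hy. rewrite scal_R_Cmult in Hy. exact Hy.
- intros H; split.
  + apply (is_linear_scal_l (K := R_AbsRing) (V := C_R_NormedModule)).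
  + intros x Hx [eps He].
    apply (is_filter_lim_locally_unique (K := R_AbsRing) (V := R_NormedModule)) in Hx. rewrite <- Hx.
    generalize (H eps He). apply filter_imp. intros y Hy.
    rewrite norm_C_R, scal_R_Cmult. exact Hy.
Qed.

(** First-order expansion with quadratic error, uniform in both points. It packs complex
    differentiability and continuity of the derivative into one inequality, which a power series
    satisfies term by term. *)
Definition C1_at (f g : C -> C) (z0 : C) : Prop :=
  exists rho K, 0 < rho /\ 0 <= K /\ forall u v, Cmod (u - z0) < rho -> Cmod (v - z0) < rho ->
    Cmod (f u - f v - (u - v) * g v) <= K * Cmod (u - v) ^ 2.

Lemma locally_Cmod_lt (z0 : C) (r : R) : 0 < r -> Clocally z0 (fun z => Cmod (z - z0) < r).
Proof.
intros Hr. apply (proj1 (filterlim_C (Clocally z0) (fun z => z) z0)); [|exact Hr].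
apply filterlim_id.
Qed.

(** Adding the inequality for (z, z0) to that for (z0, z) cancels the values of f and leaves |z -
    z0| |g z - g z0| <= 2 K |z - z0|^2. *)
Lemma C1_at_continuous_derivative (f g : C -> C) (z0 : C) :
  C1_at f g z0 -> continuous (T := C_UniformSpace) (U := C_UniformSpace) g z0.
Proof.
intros (rho & K & Hr & HK & H).
apply filterlim_C; [apply locally_filter|]. intros eps He.
assert (Hd : 0 < Rmin rho (eps / (2 * K + 1))).
{ apply Rmin_pos; [exact Hr|apply Rdiv_lt_0_compat; lra]. }
generalize (locally_Cmod_lt z0 _ Hd). apply filter_imp. intros z Hz.
assert (H1 := Rlt_le_trans _ _ _ Hz (Rmin_l _ _)).
assert (H2 := Rlt_le_trans _ _ _ Hz (Rmin_r _ _)).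
destruct (Ceq_dec z z0) as [->|Hne].
{ replace (g z0 - g z0)%C with (RtoC 0) by ring. rewrite Cmod_0; exact He. }
assert (Hz0 : Cmod (z0 - z0) < rho) by (replace (z0 - z0)%C with (RtoC 0) by ring; rewrite Cmod_0; exact Hr).
assert (A := H z z0 H1 Hz0). assert (B := H z0 z Hz0 H1).
assert (Hp : 0 < Cmod (z - z0)).
{ apply Cmod_gt_0. apply Cminus_eq_contra. exact Hne. }
replace (Cmod (z0 - z)) with (Cmod (z - z0)) in B by (rewrite <- Cmod_opp; f_equal; ring).
assert (D : Cmod ((z - z0) * (g z - g z0)) <= 2 * K * Cmod (z - z0) ^ 2).
{ replace ((z - z0) * (g z - g z0))%C with ((f z - f z0 - (z - z0) * g z0) + (f z0 - f z - (z0 - z) * g z))%C by ring.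
  eapply Rle_trans; [apply Cmod_triangle|]. lra. }
rewrite Cmod_mult in D.
assert (D' : Cmod (g z - g z0) <= 2 * K * Cmod (z - z0)).
{ apply Rmult_le_reg_l with (Cmod (z - z0)); [exact Hp|]. eapply Rle_trans; [exact D|]. right; ring. }
apply Rle_lt_trans with (1 := D').
apply Rle_lt_trans with (2 * K * (eps / (2 * K + 1))).
- apply Rmult_le_compat_l; lra.
- assert (0 < eps / (2 * K + 1)) by (apply Rdiv_lt_0_compat; lra).
  replace eps with ((2 * K + 1) * (eps / (2 * K + 1))) at 2 by (field; lra). nra.
Qed.

Lemma C1_at_chain (f g : C -> C) (path : R -> C) (t : R) (d : C) :
  C1_at f g (path t) -> is_cderive path t d -> is_cderive (fun s => f (path s)) t (g (path t) * d)%C.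
Proof.
intros (rho & K & Hr & HK & H) Hp.
apply is_cderive_iff. intros eps He.
assert (Hc := is_cderive_continuous _ _ _ Hp).
(* [L] bounds the difference quotients of the path near t and [G] the outer derivative. The
   quadratic error of f and the linear error of the path each receive eps / 2. *)
set (L := Cmod d + 1). assert (HL : 0 < L) by (unfold L; generalize (Cmod_ge_0 d); lra).
set (G := Cmod (g (path t)) + 1). assert (HG : 0 < G) by (unfold G; generalize (Cmod_ge_0 (g (path t))); lra).
assert (Hd : 0 < Rmin rho (eps / (2 * L * (K + 1)))).
{ apply Rmin_pos; [exact Hr|]. apply Rdiv_lt_0_compat; [lra|]. repeat apply Rmult_lt_0_compat; lra. }
assert (A := proj1 (filterlim_C _ _ _) Hc _ Hd).
assert (He2 : 0 < Rmin 1 (eps / (2 * G))).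
{ apply Rmin_pos; [lra|]. apply Rdiv_lt_0_compat; [lra|]. apply Rmult_lt_0_compat; lra. }
assert (B := proj1 (is_cderive_iff _ _ _) Hp _ He2).
generalize (filter_and _ _ A B). apply filter_imp. intros y [A1 B1].
assert (H1 := Rlt_le_trans _ _ _ A1 (Rmin_l _ _)).
assert (H2 := Rlt_le_trans _ _ _ A1 (Rmin_r _ _)).
assert (Hz0 : Cmod (path t - path t) < rho) by (replace (path t - path t)%C with (RtoC 0) by ring; rewrite Cmod_0; exact Hr).
assert (C1 := H _ _ H1 Hz0).
assert (Hy := Rabs_pos (y - t)).
assert (N : Cmod (path y - path t) <= L * Rabs (y - t)).
{ replace (path y - path t)%C with ((path y - path t - RtoC (y - t) * d) + RtoC (y - t) * d)%C by ring.
  eapply Rle_trans; [apply Cmod_triangle|]. rewrite Cmod_mult, Cmod_R.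
  assert (Rmin 1 (eps / (2 * G)) <= 1) by apply Rmin_l. unfold L. nra. }
replace (f (path y) - f (path t) - RtoC (y - t) * (g (path t) * d))%C with
  ((f (path y) - f (path t) - (path y - path t) * g (path t)) + g (path t) * (path y - path t - RtoC (y - t) * d))%C by ring.
eapply Rle_trans; [apply Cmod_triangle|].
rewrite Cmod_mult.
assert (Hq := Cmod_ge_0 (path y - path t)).
assert (P1 : K * Cmod (path y - path t) ^ 2 <= eps / 2 * Rabs (y - t)).
{ apply Rle_trans with ((K + 1) * (eps / (2 * L * (K + 1))) * (L * Rabs (y - t))).
  - replace (K * Cmod (path y - path t) ^ 2) with (K * Cmod (path y - path t) * Cmod (path y - path t)) by ring.
    apply Rmult_le_compat; try apply Rmult_le_compat; try lra. apply Rmult_le_pos; lra.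
  - right. field. lra. }
assert (P2 : Cmod (g (path t)) * Cmod (path y - path t - RtoC (y - t) * d) <= eps / 2 * Rabs (y - t)).
{ apply Rle_trans with (G * (eps / (2 * G) * Rabs (y - t))).
  - apply Rmult_le_compat; [apply Cmod_ge_0|apply Cmod_ge_0|unfold G; lra|].
    eapply Rle_trans; [exact B1|]. apply Rmult_le_compat_r; [exact Hy|apply Rmin_r].
  - right. field. lra. }
lra.
Qed.

(** The derivative read off along the real direction. A power series only provides a derivative near
    its own centre, whereas Cauchy's formula wants one function on the whole disc; [C1_at_cderiv]
    substitutes this one for all the local ones. *)
Definition cderiv (f : C -> C) (z : C) : C :=
  (Derive (fun t => Re (f (z + RtoC t)%C)) 0, Derive (fun t => Im (f (z + RtoC t)%C)) 0).

Lemma C1_at_cderiv_eq (f g : C -> C) (z : C) : C1_at f g z -> cderiv f z = g z.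
Proof.
intros H.
assert (D : is_cderive (fun t => f (z + RtoC t)%C) 0 (g z)).
{ assert (E : (z + RtoC 0)%C = z) by ring.
  rewrite <- E in H.
  eapply is_cderive_eq.
  - apply (C1_at_chain f g (fun t => z + RtoC t)%C 0 (RtoC 0 + RtoC 1)%C H).
    apply is_cderive_plus; [apply is_cderive_const|apply is_cderive_RtoC; apply (is_derive_id (K := R_AbsRing))].
  - cbv beta. rewrite E. ring. }
apply C_ext; apply is_derive_unique; [apply is_cderive_Re in D|apply is_cderive_Im in D]; exact D.
Qed.

Lemma C1_at_near (f g : C -> C) (z0 : C) :
  C1_at f g z0 -> exists rho, 0 < rho /\ forall z, Cmod (z - z0) < rho -> C1_at f g z.
Proof.
intros (rho & K & Hr & HK & H). exists rho; split; [exact Hr|].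
intros z Hz. exists (rho - Cmod (z - z0)), K; split; [lra|split; [exact HK|]].
intros u v Hu Hv. apply H.
- replace (u - z0)%C with ((u - z) + (z - z0))%C by ring. eapply Rle_lt_trans; [apply Cmod_triangle|lra].
- replace (v - z0)%C with ((v - z) + (z - z0))%C by ring. eapply Rle_lt_trans; [apply Cmod_triangle|lra].
Qed.

Lemma C1_at_cderiv (f g : C -> C) (z0 : C) : C1_at f g z0 -> C1_at f (cderiv f) z0.
Proof.
intros H0. destruct (C1_at_near f g z0 H0) as [r1 [Hr1 Hn]].
destruct H0 as (rho & K & Hr & HK & H).
exists (Rmin rho r1), K; split; [apply Rmin_pos; assumption|split; [exact HK|]].
intros u v Hu Hv.
rewrite (C1_at_cderiv_eq f g v); [apply H|apply Hn]; eapply Rlt_le_trans;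
  first [eassumption | apply Rmin_l | apply Rmin_r].
Qed.

(** * Taylor bounds *)

(** Two radii are kept apart: the Cauchy estimates refer to the larger one, while the points stay
    within the smaller. The remainders are then geometrically small even at |z| = r. *)
Definition taylor_bound (f : C -> C) (c : nat -> C) (r R M : R) : Prop :=
  0 < r < R /\ 0 <= M /\ (forall m, Cmod (c m) * R ^ m <= M) /\
  forall j z, Cmod z <= r ->
    Cmod (f z - csum (fun m => c m * z ^ m) j)%C <= M * (Cmod z / R) ^ S j.

Lemma eventually_bounded (a : nat -> C) (B : R) :
  eventually (fun m => Cmod (a m) <= B) -> exists M, forall m, Cmod (a m) <= M.
Proof.
intros [N H].
assert (G : exists M, forall m, (m < N)%nat -> Cmod (a m) <= M).
{ clear H. induction N as [|N [M HM]]; [exists 0; intros; lia|].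
  exists (Rmax M (Cmod (a N))). intros m Hm.
  destruct (Nat.eq_dec m N) as [->|]; [apply Rmax_r|]. eapply Rle_trans; [apply HM; lia|apply Rmax_l]. }
destruct G as [M HM]. exists (Rmax M B). intros m.
destruct (Nat.lt_ge_cases m N); eapply Rle_trans; [apply HM; assumption|apply Rmax_l|apply H; assumption|apply Rmax_r].
Qed.

Lemma cvg_csum_bounded (a : nat -> C) (l : C) :
  filterlim (csum a) eventually (Clocally l) -> exists M, 0 <= M /\ forall m, Cmod (a m) <= M.
Proof.
intros H.
assert (E : eventually (fun m => Cmod (a m) <= 2)).
{ destruct (proj1 (filterlim_C _ _ _) H 1 Rlt_0_1) as [N HN].
  exists (S N). intros [|m] Hm; [lia|].
  assert (A := HN m ltac:(lia)). assert (B := HN (S m) ltac:(lia)).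
  rewrite csum_S in B.
  replace (a (S m)) with ((csum a m + a (S m) - l) + - (csum a m - l))%C by ring.
  eapply Rle_trans; [apply Cmod_triangle|]. rewrite Cmod_opp. lra. }
destruct (eventually_bounded a 2 E) as [M HM]. exists M; split; [|exact HM].
eapply Rle_trans; [apply Cmod_ge_0|apply (HM 0%nat)].
Qed.

Lemma pow_n_Cpow (z : C) (m : nat) : pow_n (K := C_Ring) z m = (z ^ m)%C.
Proof. induction m as [|m IH]; [reflexivity|simpl; rewrite IH; reflexivity]. Qed.

Lemma is_pseries_csum (c : nat -> C) (z l : C) :
  is_pseries (K := C_AbsRing) (V := C_NormedModule) c z l ->
  filterlim (csum (fun m => c m * z ^ m)%C) eventually (Clocally l).
Proof.
intros H. eapply filterlim_ext; [|exact H].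
intros n. cbv beta. apply sum_n_ext. intros m. change (pow_n (K := C_Ring) z m * c m = c m * z ^ m)%C.
rewrite pow_n_Cpow. ring.
Qed.

Lemma pseries_coef_bound (c : nat -> C) (r : R) :
  0 < r -> (exists l, is_pseries (K := C_AbsRing) (V := C_NormedModule) c (RtoC r) l) ->
  exists M, 0 <= M /\ forall m, Cmod (c m) * r ^ m <= M.
Proof.
intros Hr [l Hl]. apply is_pseries_csum in Hl.
destruct (cvg_csum_bounded _ _ Hl) as [M [HM H]]. exists M; split; [exact HM|].
intros m. specialize (H m). rewrite Cmod_mult, Cmod_pow, Cmod_R, Rabs_pos_eq in H by lra. exact H.
Qed.

(** With q = |z| / R at most 1/2, a geometric tail is at most twice its first term. The induction
    carries the sharper form 2 M (q^(j+1) - q^(j+k+1)), which telescopes. *)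
Lemma csum_remainder_le (c : nat -> C) (R M : R) (z l : C) :
  0 < R -> 0 <= M -> (forall m, Cmod (c m) * R ^ m <= M) -> Cmod z <= R / 2 ->
  filterlim (csum (fun m => c m * z ^ m)%C) eventually (Clocally l) ->
  forall j, Cmod (l - csum (fun m => c m * z ^ m) j)%C <= 2 * M * (Cmod z / R) ^ S j.
Proof.
intros HR HM Hc Hz Hl j.
set (q := Cmod z / R).
assert (Hq0 : 0 <= q) by (apply Rdiv_le_0_compat; [apply Cmod_ge_0|lra]).
assert (Hq : q <= / 2).
{ unfold q, Rdiv. apply Rmult_le_reg_r with R; [lra|]. rewrite Rmult_assoc, Rinv_l by lra. lra. }
assert (T : forall m, Cmod (c m * z ^ m) <= M * q ^ m).
{ intros m. rewrite Cmod_mult, Cmod_pow. unfold q, Rdiv. rewrite Rpow_mult_distr, pow_inv.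
  assert (0 < R ^ m) by (apply pow_lt; lra).
  replace (Cmod (c m) * Cmod z ^ m) with ((Cmod (c m) * R ^ m) * (Cmod z ^ m * / R ^ m)) by (field; lra).
  apply Rmult_le_compat_r; [|apply Hc].
  apply Rmult_le_pos; [apply pow_le, Cmod_ge_0|left; apply Rinv_0_lt_compat; lra]. }
assert (S1 : forall k, Cmod (csum (fun m => c m * z ^ m) (j + k) - csum (fun m => c m * z ^ m) j)%C <= 2 * M * (q ^ S j - q ^ S (j + k))).
{ induction k as [|k IH].
  - rewrite Nat.add_0_r. replace (_ - _)%C with (RtoC 0) by ring. rewrite Cmod_0. lra.
  - rewrite Nat.add_succ_r, csum_S.
    replace (_ - _)%C with ((csum (fun m => c m * z ^ m) (j + k) - csum (fun m => c m * z ^ m) j) + c (S (j + k)) * z ^ S (j + k))%C by ring.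
    eapply Rle_trans; [apply Cmod_triangle|]. eapply Rle_trans; [apply Rplus_le_compat; [exact IH|apply T]|].
    change (q ^ S (S (j + k))) with (q * q ^ S (j + k)).
    assert (0 <= M * q ^ S (j + k)) by (apply Rmult_le_pos; [exact HM|apply pow_le; exact Hq0]). nra. }
apply (filterlim_C_le eventually (fun k => csum (fun m => c m * z ^ m) k - csum (fun m => c m * z ^ m) j)%C).
- apply filterlim_C_plus; [apply eventually_filter|exact Hl|apply filterlim_C_const; apply eventually_filter].
- exists j. intros k Hk. replace k with (j + (k - j))%nat by lia.
  eapply Rle_trans; [apply S1|].
  assert (0 <= q ^ S (j + (k - j))) by (apply pow_le; exact Hq0).
  assert (0 <= M * q ^ S (j + (k - j))) by (apply Rmult_le_pos; assumption). lra.
Qed.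

Lemma analytic_at_taylor (f : C -> C) (z0 : C) :
  analytic_at f z0 -> exists c r R M, taylor_bound (fun h => f (z0 + h)%C) c r R M.
Proof.
intros (c & r & Hr & H).
assert (P : forall h, Cmod h < r -> is_pseries (K := C_AbsRing) (V := C_NormedModule) c h (f (z0 + h)%C)).
{ intros h Hh. replace h with (z0 + h - z0)%C at 1 by ring. apply H. replace (z0 + h - z0)%C with h by ring. exact Hh. }
(* The coefficients are bounded by convergence at the point r / 2; restricting to r / 4 then keeps
   the ratio at most 1/2, as [csum_remainder_le] requires. *)
destruct (pseries_coef_bound c (r / 2)) as [M [HM Hc]]; [lra|eexists; apply P; rewrite Cmod_R, Rabs_pos_eq; lra|].
exists c, (r / 4), (r / 2), (2 * M). split; [lra|split; [lra|split]].
- intros m. specialize (Hc m). lra.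
- intros j z Hz. apply csum_remainder_le; try assumption; try lra.
  apply is_pseries_csum, P. lra.
Qed.

(** The second-order remainder of z^m is about m^2 rho^(m-2) |u - v|^2; the factor rho^2 stands on
    the left so that no exponent m - 2 occurs. The induction rests on the remainder for m + 1 being
    u times the remainder for m plus m v^(m-1) (u - v)^2. *)
Lemma pow_diff_bound (rho : R) (u v : C) (m : nat) :
  0 <= rho -> Cmod u <= rho -> Cmod v <= rho ->
  rho ^ 2 * Cmod (u ^ m - v ^ m - (u - v) * (RtoC (INR m) * v ^ pred m)) <= INR m ^ 2 * rho ^ m * Cmod (u - v) ^ 2.
Proof.
intros Hr Hu Hv. induction m as [|m IH].
- simpl. replace (1 - 1 - (u - v) * (RtoC 0 * 1))%C with (RtoC 0) by ring. rewrite Cmod_0. right; ring.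
- replace (u ^ S m - v ^ S m - (u - v) * (RtoC (INR (S m)) * v ^ pred (S m)))%C with
    (u * (u ^ m - v ^ m - (u - v) * (RtoC (INR m) * v ^ pred m)) + RtoC (INR m) * v ^ pred m * ((u - v) * (u - v)))%C.
  2:{ rewrite S_INR, RtoC_plus. destruct m; simpl pred; [simpl; ring|]. rewrite !Cpow_S. ring. }
  assert (T : rho ^ 2 * Cmod (RtoC (INR m) * v ^ pred m * ((u - v) * (u - v))) <= INR m * rho ^ S m * Cmod (u - v) ^ 2).
  { rewrite !Cmod_mult, Cmod_R, Cmod_pow, (Rabs_pos_eq (INR m)) by apply pos_INR.
    destruct m; [simpl; right; ring|]. simpl pred.
    replace (rho ^ 2 * (INR (S m) * Cmod v ^ m * (Cmod (u - v) * Cmod (u - v)))) with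
      (INR (S m) * Cmod (u - v) ^ 2 * rho ^ 2 * Cmod v ^ m) by ring.
    replace (INR (S m) * rho ^ S (S m) * Cmod (u - v) ^ 2) with (INR (S m) * Cmod (u - v) ^ 2 * rho ^ 2 * rho ^ m) by (simpl; ring).
    apply Rmult_le_compat_l.
    - repeat apply Rmult_le_pos; try apply pos_INR; try apply pow_le; try apply Cmod_ge_0; try lra.
    - apply pow_incr. split; [apply Cmod_ge_0|exact Hv]. }
  apply Rle_trans with (rho * (INR m ^ 2 * rho ^ m * Cmod (u - v) ^ 2) + INR m * rho ^ S m * Cmod (u - v) ^ 2).
  + eapply Rle_trans; [apply Rmult_le_compat_l; [apply pow_le; exact Hr|apply Cmod_triangle]|].
    rewrite Rmult_plus_distr_l. apply Rplus_le_compat; [|exact T].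
    rewrite Cmod_mult.
    set (X := Cmod (u ^ m - v ^ m - (u - v) * (RtoC (INR m) * v ^ pred m))) in *.
    assert (0 <= X) by apply Cmod_ge_0. assert (0 <= rho ^ 2 * X) by (apply Rmult_le_pos; [apply pow_le; lra|assumption]).
    replace (rho ^ 2 * (Cmod u * X)) with (Cmod u * (rho ^ 2 * X)) by ring.
    apply Rmult_le_compat; try assumption. apply Cmod_ge_0.
  + rewrite S_INR. simpl pow.
    assert (0 <= rho ^ m) by (apply pow_le; exact Hr). assert (0 <= INR m) by apply pos_INR.
    assert (0 <= Cmod (u - v) * (Cmod (u - v) * 1)) by (apply Rmult_le_pos; [|rewrite Rmult_1_r]; apply Cmod_ge_0).
    assert (0 <= rho * rho ^ m * (Cmod (u - v) * (Cmod (u - v) * 1))) by (apply Rmult_le_pos; [apply Rmult_le_pos|]; assumption).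
    nra.
Qed.

Lemma INR_sq_le_pow4 (m : nat) : INR m ^ 2 <= 4 ^ m.
Proof.
assert (H : INR m <= 2 ^ m).
{ induction m as [|m IH]; [simpl; lra|]. rewrite S_INR. simpl.
  assert (1 <= 2 ^ m) by (apply pow_R1_Rle; lra). lra. }
replace 4 with (2 ^ 2) by ring. rewrite <- pow_mult, Nat.mul_comm, pow_mult.
apply pow_incr. split; [apply pos_INR|exact H].
Qed.

Lemma taylor_bound_cvg (f : C -> C) (c : nat -> C) (r R M : R) (z : C) :
  taylor_bound f c r R M -> Cmod z <= r ->
  filterlim (csum (fun m => c m * z ^ m)%C) eventually (Clocally (f z)).
Proof.
intros (Hr & HM & Hc & HT) Hz.
apply filterlim_C; [apply eventually_filter|]. intros eps He.
assert (Hq : Rabs (Cmod z / R) < 1).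
{ rewrite Rabs_pos_eq by (apply Rdiv_le_0_compat; [apply Cmod_ge_0|lra]).
  apply Rmult_lt_reg_r with R; [lra|]. unfold Rdiv; rewrite Rmult_assoc, Rinv_l by lra. lra. }
destruct (pow_lt_1_zero _ Hq (eps / (M + 1)) ltac:(apply Rdiv_lt_0_compat; lra)) as [N HN].
exists N. intros n Hn.
replace (csum (fun m => c m * z ^ m) n - f z)%C with (- (f z - csum (fun m => c m * z ^ m) n))%C by ring.
rewrite Cmod_opp. eapply Rle_lt_trans; [apply HT; exact Hz|].
assert (A := HN (S n) ltac:(lia)). rewrite Rabs_pos_eq in A by (apply pow_le, Rdiv_le_0_compat; [apply Cmod_ge_0|lra]).
assert (B : 0 < eps / (M + 1)) by (apply Rdiv_lt_0_compat; lra).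
assert (D : 0 <= (Cmod z / R) ^ S n) by (apply pow_le, Rdiv_le_0_compat; [apply Cmod_ge_0|lra]).
apply Rle_lt_trans with (M * (eps / (M + 1))); [apply Rmult_le_compat_l; lra|].
replace eps with ((M + 1) * (eps / (M + 1))) at 2 by (field; lra). nra.
Qed.

Lemma taylor_bound_C1 (f : C -> C) (c : nat -> C) (r R M : R) :
  taylor_bound f c r R M -> exists g, C1_at f g (RtoC 0).
Proof.
intros HT. assert (HT' := HT). destruct HT' as (Hr & HM & Hc & _).
(* R / 8 pays for the factor m^2 <= 4^m: then m^2 rho^m is at most R^m 2^(-m), so the differentiated
   series and the second-order remainders are dominated by a geometric series of ratio 1/2. *)
set (rho := Rmin r (R / 8)).
assert (Hrho : 0 < rho) by (apply Rmin_pos; lra).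
assert (Hrho1 : rho <= r) by apply Rmin_l. assert (Hrho2 : rho <= R / 8) by apply Rmin_r.
assert (HcR : forall m, Cmod (c m) * (INR m ^ 2 * rho ^ m) <= M * (/ 2) ^ m).
{ intros m. apply Rle_trans with (Cmod (c m) * (4 ^ m * (R / 8) ^ m)).
  - apply Rmult_le_compat_l; [apply Cmod_ge_0|]. apply Rmult_le_compat.
    + apply pow_le, pos_INR. + apply pow_le; lra. + apply INR_sq_le_pow4. + apply pow_incr; lra.
  - rewrite <- Rpow_mult_distr. replace (4 * (R / 8)) with (R * / 2) by field.
    rewrite Rpow_mult_distr, <- Rmult_assoc. apply Rmult_le_compat_r; [apply pow_le; lra|apply Hc]. }
assert (Hder : forall v, Cmod v <= rho -> exists l, filterlim (csum (fun m => c m * (RtoC (INR m) * v ^ pred m))%C) eventually (Clocally l)).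
{ intros v Hv. apply (csum_geometric_cvg _ (M / rho)). intros m.
  rewrite !Cmod_mult, Cmod_R, Cmod_pow, (Rabs_pos_eq (INR m)) by apply pos_INR.
  apply Rmult_le_reg_l with rho; [exact Hrho|].
  replace (rho * (M / rho * (/ 2) ^ m)) with (M * (/ 2) ^ m) by (field; lra).
  eapply Rle_trans; [|apply HcR].
  replace (rho * (Cmod (c m) * (INR m * Cmod v ^ pred m))) with (Cmod (c m) * (INR m * (rho * Cmod v ^ pred m))) by ring.
  apply Rmult_le_compat_l; [apply Cmod_ge_0|].
  destruct m; [simpl; right; ring|]. simpl pred.
  assert (1 <= INR (S m)) by (rewrite S_INR; generalize (pos_INR m); lra).
  assert (rho * Cmod v ^ m <= rho ^ S m).
  { simpl. apply Rmult_le_compat_l; [lra|]. apply pow_incr; split; [apply Cmod_ge_0|exact Hv]. }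
  assert (0 < rho ^ S m) by (apply pow_lt; exact Hrho).
  assert (0 <= rho * Cmod v ^ m) by (apply Rmult_le_pos; [lra|apply pow_le, Cmod_ge_0]).
  set (I := INR (S m)) in *.
  assert (I <= I ^ 2) by nra.
  apply Rmult_le_compat; lra. }
assert (Hg : exists g : C -> C, forall v, Cmod v <= rho -> filterlim (csum (fun m => c m * (RtoC (INR m) * v ^ pred m))%C) eventually (Clocally (g v))).
(* [lim] is a total operation on filters, so the sum of the differentiated series is a function
   without any choice of limits; [Hder] makes it a genuine limit for |v| <= rho. *)
{ exists (fun v => lim (T := C_R_CompleteNormedModule) (filtermap (U := C) (csum (fun m => c m * (RtoC (INR m) * v ^ pred m))%C) eventually)).
  intros v Hv. destruct (Hder v Hv) as [l Hl].
  assert (P : ProperFilter (filtermap (U := C) (csum (fun m => c m * (RtoC (INR m) * v ^ pred m))%C) eventually)) by (apply filtermap_proper_filter, eventually_filter).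
  apply (proj2 (filterlim_locally (U := C_R_CompleteNormedModule) _ _)). intros eps.
  apply (complete_cauchy (T := C_R_CompleteNormedModule) _ P).
  intros e. exists l. apply (proj1 (filterlim_locally (U := C_R_CompleteNormedModule) _ _) Hl e). }
destruct Hg as [g Hg]. exists g.
exists rho, (2 * M / rho ^ 2).
assert (Hr2 : 0 < rho ^ 2) by (apply pow_lt; lra).
split; [exact Hrho|split; [apply Rdiv_le_0_compat; lra|]].
intros u v Hu Hv. replace (u - 0)%C with u in Hu by ring. replace (v - 0)%C with v in Hv by ring.
(* The inequality holds for all partial sums with one constant and passes to the limit. *)
apply (filterlim_C_le eventually (fun j => csum (fun m => c m * u ^ m) j + (- (1)) * csum (fun m => c m * v ^ m) j
   + (- (u - v)) * csum (fun m => c m * (RtoC (INR m) * v ^ pred m)) j)%C).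
- replace (f u - f v - (u - v) * g v)%C with (f u + (- (1)) * f v + (- (u - v)) * g v)%C by ring.
  repeat apply filterlim_C_plus; try apply eventually_filter.
  + apply (taylor_bound_cvg f c r R M); [exact HT|lra].
  + apply filterlim_C_mult_const; [apply eventually_filter|]. apply (taylor_bound_cvg f c r R M); [exact HT|lra].
  + apply filterlim_C_mult_const; [apply eventually_filter|]. apply Hg. lra.
- apply filter_forall. intros j.
  rewrite <- !csum_mult_l, <- !csum_plus.
  eapply Rle_trans.
  { apply (csum_Cmod_le _ (fun m => (M / rho ^ 2 * Cmod (u - v) ^ 2) * (/ 2) ^ m)). intros m _.
    replace (c m * u ^ m + - (1) * (c m * v ^ m) + - (u - v) * (c m * (RtoC (INR m) * v ^ pred m)))%C with
      (c m * (u ^ m - v ^ m - (u - v) * (RtoC (INR m) * v ^ pred m)))%C by ring.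
    rewrite Cmod_mult.
    assert (B := pow_diff_bound rho u v m ltac:(lra) ltac:(lra) ltac:(lra)).
    apply Rmult_le_reg_l with (rho ^ 2); [exact Hr2|].
    replace (rho ^ 2 * (M / rho ^ 2 * Cmod (u - v) ^ 2 * (/ 2) ^ m)) with (M * (/ 2) ^ m * Cmod (u - v) ^ 2) by (field; lra).
    apply Rle_trans with (Cmod (c m) * (INR m ^ 2 * rho ^ m) * Cmod (u - v) ^ 2).
    - rewrite Rmult_assoc, (Rmult_comm (rho ^ 2)), (Rmult_assoc (Cmod (c m))). apply Rmult_le_compat_l; [apply Cmod_ge_0|]. rewrite Rmult_comm. exact B.
    - apply Rmult_le_compat_r; [apply pow_le, Cmod_ge_0|apply HcR]. }
  eapply Rle_trans; [apply sum_n_half_le|right; field; lra].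
  apply Rmult_le_pos; [apply Rdiv_le_0_compat; lra|apply pow_le, Cmod_ge_0].
Qed.

Lemma analytic_at_C1 (f : C -> C) (z0 : C) : analytic_at f z0 -> C1_at f (cderiv f) z0.
Proof.
intros H. destruct (analytic_at_taylor f z0 H) as (c & r & R & M & HT).
destruct (taylor_bound_C1 _ _ _ _ _ HT) as [g (rho & K & Hr & HK & Hg)].
apply C1_at_cderiv with (fun z => g (z - z0)%C).
exists rho, K; split; [exact Hr|split; [exact HK|]]. intros u v Hu Hv.
assert (B := Hg (u - z0)%C (v - z0)%C).
replace (z0 + (u - z0))%C with u in B by ring. replace (z0 + (v - z0))%C with v in B by ring.
replace (u - z0 - (v - z0))%C with (u - v)%C in B by ring.
apply B; [replace (u - z0 - 0)%C with (u - z0)%C by ring|replace (v - z0 - 0)%C with (v - z0)%C by ring]; assumption.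
Qed.

(** * Differentiation under the integral sign and Cauchy's formula *)

Lemma is_CInt_Re (f : R -> C) (a b : R) (l : C) :
  is_CInt f a b l -> is_RInt (fun t => Re (f t)) a b (Re l).
Proof. apply (is_RInt_fct_extend_fst (U := R_NormedModule) (V := R_NormedModule)). Qed.

Lemma is_CInt_Im (f : R -> C) (a b : R) (l : C) :
  is_CInt f a b l -> is_RInt (fun t => Im (f t)) a b (Im l).
Proof. apply (is_RInt_fct_extend_snd (U := R_NormedModule) (V := R_NormedModule)). Qed.

Lemma is_derive_RInt_param_continuous (f df : R -> R -> R) (a b s0 delta : R) :
  0 < delta ->
  (forall s t, Rabs (s - s0) < delta -> is_derive (fun s => f s t) s (df s t)) ->
  (forall t, continuous (T := R2_UniformSpace) (U := R_UniformSpace)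
     (fun p => df (fst p) (snd p)) (s0, t)) ->
  (forall s, Rabs (s - s0) < delta -> ex_RInt (f s) a b) ->
  is_derive (fun s => RInt (f s) a b) s0 (RInt (df s0) a b).
Proof.
intros Hd H1 H2 H3.
assert (Hs0 : Rabs (s0 - s0) < delta) by (rewrite Rminus_diag, Rabs_R0; exact Hd).
rewrite (RInt_ext (df s0) (fun t => Derive (fun u => f u t) s0)).
2:{ intros t _. symmetry. apply is_derive_unique. apply H1. exact Hs0. }
apply (is_derive_RInt_param f).
- exists (mkposreal delta Hd). intros y Hy t _. eexists. apply H1. exact Hy.
- intros t _.
  apply continuity_2d_pt_ext_loc with df.
  + exists (mkposreal delta Hd). intros u v Hu Hv. symmetry. apply is_derive_unique. apply H1. exact Hu.
  + apply continuity_2d_pt_filterlim. apply H2.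
- exists (mkposreal delta Hd). intros y Hy. apply H3. exact Hy.
Qed.

Lemma is_cderive_CInt_param (f df : R -> R -> C) (a b s0 delta : R) :
  0 < delta ->
  (forall s t, Rabs (s - s0) < delta -> is_cderive (fun s => f s t) s (df s t)) ->
  (forall t, continuous (T := R2_UniformSpace) (U := C_UniformSpace)
     (fun p => df (fst p) (snd p)) (s0, t)) ->
  (forall s t, Rabs (s - s0) < delta -> ccontinuous (f s) t) ->
  is_cderive (fun s => CInt (f s) a b) s0 (CInt (df s0) a b).
Proof.
intros Hd H1 H2 H3.
assert (Hs0 : Rabs (s0 - s0) < delta) by (rewrite Rminus_diag, Rabs_R0; exact Hd).
assert (H4 : forall s, Rabs (s - s0) < delta -> is_CInt (f s) a b (CInt (f s) a b)).
{ intros s Hs. apply is_CInt_CInt. intros; apply H3; exact Hs. }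
assert (H5 : is_CInt (df s0) a b (CInt (df s0) a b)).
{ apply is_CInt_CInt. intros t _.
  apply (continuous_comp (fun t : R => (s0, t)) (fun p => df (fst p) (snd p))); [|apply H2].
  apply (continuous_comp_2 (fun _ : R => s0) (fun t : R => t) (fun x y => (x, y)));
    [apply continuous_const|apply continuous_id|].
  apply (continuous_ext (fun p => p)); [intros [? ?]; reflexivity|apply continuous_id]. }
assert (L : locally s0 (fun s => Rabs (s - s0) < delta)).
{ exists (mkposreal delta Hd). intros y Hy; exact Hy. }
apply is_cderive_pair.
- apply is_derive_ext_loc with (fun s => RInt (fun t => Re (f s t)) a b).
  + revert L; apply filter_imp. intros s Hs. apply is_RInt_unique. apply is_CInt_Re. apply H4; exact Hs.
  + rewrite <- (is_RInt_unique _ _ _ _ (is_CInt_Re _ _ _ _ H5)).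
    apply is_derive_RInt_param_continuous with (f := fun s t => Re (f s t)) (df := fun s t => Re (df s t)) (delta := delta).
    * exact Hd.
    * intros s t Hs. apply is_cderive_Re, H1; exact Hs.
    * intros t. apply (continuous_Re (T := R2_UniformSpace) (fun p => df (fst p) (snd p))). apply H2.
    * intros s Hs. eexists. apply is_CInt_Re, H4; exact Hs.
- apply is_derive_ext_loc with (fun s => RInt (fun t => Im (f s t)) a b).
  + revert L; apply filter_imp. intros s Hs. apply is_RInt_unique. apply is_CInt_Im. apply H4; exact Hs.
  + rewrite <- (is_RInt_unique _ _ _ _ (is_CInt_Im _ _ _ _ H5)).
    apply is_derive_RInt_param_continuous with (f := fun s t => Im (f s t)) (df := fun s t => Im (df s t)) (delta := delta).
    * exact Hd.
    * intros s t Hs. apply is_cderive_Im, H1; exact Hs.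
    * intros t. apply (continuous_Im (T := R2_UniformSpace) (fun p => df (fst p) (snd p))). apply H2.
    * intros s Hs. eexists. apply is_CInt_Im, H4; exact Hs.
Qed.

Lemma Ci_mult_Ci : (Ci * Ci = - RtoC 1)%C.
Proof. unfold Ci, Cmult, Copp, RtoC; simpl; f_equal; ring. Qed.

Lemma is_cderive_id (x : R) : is_cderive RtoC x (RtoC 1).
Proof. apply (is_cderive_RtoC (fun t => t)), (is_derive_id (K := R_AbsRing)). Qed.

Definition circle (R theta : R) : C := (RtoC R * Cexp (Ci * RtoC theta))%C.

Lemma Cmod_circle (r t : R) : 0 < r -> Cmod (circle r t) = r.
Proof.
intros Hr. unfold circle. rewrite Cmod_mult, Cmod_R, Cmod_Cexp, Rabs_pos_eq by lra.
replace (Re (Ci * RtoC t)) with 0 by (simpl; ring). rewrite exp_0; ring.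
Qed.

Lemma circle_neq (r t : R) (z : C) : Cmod z < r -> circle r t <> z.
Proof.
intros Hz E. rewrite <- E in Hz. rewrite Cmod_circle in Hz; [lra|].
apply Rle_lt_trans with (1 := Cmod_ge_0 _) in Hz; exact Hz.
Qed.

Lemma circle_period (r : R) : circle r (2 * PI) = circle r 0.
Proof.
unfold circle. f_equal. apply C_ext; unfold Cexp; simpl;
  replace (0 * (2 * PI) - 1 * 0) with 0 by ring; replace (0 * 0 - 1 * 0) with 0 by ring;
  replace (0 * 0 + 1 * (2 * PI)) with (2 * PI) by ring; replace (0 * 0 + 1 * 0) with 0 by ring;
  rewrite ?cos_2PI, ?sin_2PI, ?cos_0, ?sin_0; reflexivity.
Qed.

Lemma is_cderive_circle (r t : R) : is_cderive (circle r) t (Ci * circle r t)%C.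
Proof.
unfold circle. eapply is_cderive_eq.
- apply is_cderive_mult; [apply is_cderive_const|]. apply is_cderive_exp.
  apply is_cderive_mult; [apply is_cderive_const|]. apply is_cderive_id.
- cbv beta; ring.
Qed.

Lemma continuous_circle (r t : R) : ccontinuous (circle r) t.
Proof. eapply is_cderive_continuous, is_cderive_circle. Qed.

(** Since zeta' = i zeta on the circle, the power zeta^(-(m+1)) is a constant multiple of its own
    derivative, and it takes the same value at both ends of the period. *)
Lemma is_CInt_circle_pow (r : R) (m : nat) :
  0 < r -> is_CInt (fun t => / circle r t ^ S m)%C 0 (2 * PI) (RtoC 0).
Proof.
intros Hr.
assert (N : forall t, circle r t <> 0) by (intros t; apply circle_neq; rewrite Cmod_0; exact Hr).
assert (NP : forall t k, (circle r t ^ k)%C <> 0) by (intros; apply Cpow_nz, N).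
assert (NI : RtoC (INR (S m)) <> 0) by (intros E; apply RtoC_inj in E; revert E; apply not_0_INR; lia).
replace (RtoC 0) with ((Ci / RtoC (INR (S m))) * / circle r (2 * PI) ^ S m - (Ci / RtoC (INR (S m))) * / circle r 0 ^ S m)%C
  by (rewrite circle_period; ring).
apply (is_CInt_derive (fun t => (Ci / RtoC (INR (S m))) * / circle r t ^ S m)%C).
- intros t _. eapply is_cderive_eq.
  + apply is_cderive_mult; [apply is_cderive_const|].
    apply (is_cderive_inv (fun t => circle r t ^ S m)%C); [|apply NP].
    apply is_cderive_pow, is_cderive_circle.
  + cbv beta; simpl pred. rewrite (Cpow_S (circle r t) m).
    transitivity (- (Ci * Ci) * (/ (circle r t * circle r t ^ m)))%C.
    * field. repeat split; auto.
    * rewrite Ci_mult_Ci. field. split; auto.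
- intros t _. apply continuous_Cinv; [|apply NP]. apply continuous_Cpow, continuous_circle.
Qed.

Lemma is_CInt_const (c : C) (a b : R) : is_CInt (fun _ => c) a b (RtoC (b - a) * c)%C.
Proof.
rewrite <- scal_R_Cmult. apply (is_RInt_const (V := C_R_NormedModule)).
Qed.

Lemma csum_geometric (q : C) (j : nat) : q <> 1 ->
  (/ (1 - q) - csum (fun m => q ^ m) j = q ^ S j / (1 - q))%C.
Proof.
intros Hq.
assert (D : (1 - q <> 0)%C) by (intros E; apply Hq; symmetry; apply Ceq_minus; exact E).
induction j as [|j IH].
- rewrite csum_0. simpl. field. exact D.
- rewrite csum_S. transitivity ((/ (1 - q) - csum (fun m => q ^ m) j) - q ^ S j)%C; [Cring|].
  rewrite IH. rewrite (Cpow_S q (S j)). field. exact D.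
Qed.

Lemma circle_kernel_expansion (r t : R) (z : C) (j : nat) : Cmod z < r ->
  (circle r t / (circle r t - z) - csum (fun m => z ^ m * / circle r t ^ m) j =
   z ^ S j * / circle r t ^ S j * (circle r t / (circle r t - z)))%C.
Proof.
intros Hz.
assert (N0 : circle r t <> 0) by (apply circle_neq; rewrite Cmod_0; generalize (Cmod_ge_0 z); lra).
assert (N1 : (circle r t - z)%C <> 0) by (apply Cminus_eq_contra, circle_neq; exact Hz).
set (q := (z / circle r t)%C).
assert (Hq : q <> 1).
{ intros E. apply (circle_neq r t z Hz). unfold q in E.
  replace z with (z / circle r t * circle r t)%C by (field; exact N0). rewrite E. ring. }
replace (circle r t / (circle r t - z))%C with (/ (1 - q))%C.
2:{ unfold q. field. split; [exact N1|exact N0]. }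
assert (Hp : forall m, (z ^ m * / circle r t ^ m)%C = (q ^ m)%C).
{ intros m. unfold q, Cdiv. rewrite Cpow_mult_l, Cpow_inv by exact N0. reflexivity. }
rewrite (csum_ext _ (fun m => q ^ m)%C) by (intros; apply Hp).
rewrite csum_geometric by exact Hq. rewrite Hp. reflexivity.
Qed.

Lemma is_CInt_csum (F : nat -> R -> C) (l : nat -> C) (a b : R) (j : nat) :
  (forall m, is_CInt (F m) a b (l m)) -> is_CInt (fun t => csum (fun m => F m t) j) a b (csum l j).
Proof.
intros H. induction j as [|j IH].
- rewrite csum_0. eapply is_CInt_ext; [|apply (H 0%nat)]. intros t _. rewrite csum_0. reflexivity.
- rewrite csum_S. eapply is_CInt_ext; [|apply is_CInt_plus; [apply IH|apply (H (S j))]].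
  intros t _. cbv beta. rewrite csum_S. reflexivity.
Qed.

Lemma continuous_Cmod {T : UniformSpace} (f : T -> C) (x : T) :
  ccontinuous f x -> continuous (U := R_UniformSpace) (fun t => Cmod (f t)) x.
Proof.
intros H. apply (continuous_ext (fun t => norm (K := R_AbsRing) (V := C_R_NormedModule) (f t))).
- intros t; apply norm_C_R.
- apply (continuous_comp f (fun z => norm (K := R_AbsRing) (V := C_R_NormedModule) z)); [exact H|].
  apply (filterlim_norm (K := R_AbsRing) (V := C_R_NormedModule)).
Qed.

(** Expand zeta / (zeta - z) geometrically under the integral. The estimate serves twice: with F = 1
    it evaluates the integral of the kernel, and with F = f on the circle it turns Cauchy's formula
    into a Taylor expansion. *)
Lemma circle_integral_expansion (F : R -> C) (r : R) (z l : C) (c : nat -> C) (B : R) (j : nat) :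
  Cmod z < r ->
  is_CInt (fun t => F t * (circle r t / (circle r t - z)))%C 0 (2 * PI) l ->
  (forall m, is_CInt (fun t => F t * / circle r t ^ m)%C 0 (2 * PI) (c m)) ->
  is_RInt (fun t => Cmod (F t)) 0 (2 * PI) B ->
  Cmod (l - csum (fun m => c m * z ^ m) j)%C <= (r / (r - Cmod z) * B) * (Cmod z / r) ^ S j.
Proof.
intros Hz Hl Hc HB.
assert (Hz0 := Cmod_ge_0 z).
assert (H2 : is_CInt (fun t => csum (fun m => z ^ m * (F t * / circle r t ^ m)) j)%C 0 (2 * PI)
   (csum (fun m => z ^ m * c m)%C j)).
{ apply is_CInt_csum. intros m. apply is_CInt_Cmult, Hc. }
assert (H3 := is_CInt_plus _ _ _ _ _ _ Hl (is_CInt_Cmult (- (1))%C _ _ _ _ H2)).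
replace (l - csum (fun m => c m * z ^ m) j)%C with (l + - (1) * csum (fun m => z ^ m * c m)%C j)%C.
2:{ rewrite (csum_ext (fun m => c m * z ^ m)%C (fun m => z ^ m * c m)%C) by (intros; Cring). Cring. }
replace (r / (r - Cmod z) * B * (Cmod z / r) ^ S j) with ((r / (r - Cmod z) * (Cmod z / r) ^ S j) * B) by ring.
apply (is_CInt_Cmod_le _ (fun t => (r / (r - Cmod z) * (Cmod z / r) ^ S j) * Cmod (F t)) 0 (2 * PI)) with (3 := H3).
- generalize PI_RGT_0; lra.
- intros t _. cbv beta.
  assert (N1 : (circle r t - z)%C <> 0) by (apply Cminus_eq_contra, circle_neq; exact Hz).
  assert (N0 : circle r t <> 0) by (apply circle_neq; rewrite Cmod_0; lra).
  replace (F t * (circle r t / (circle r t - z)) + - (1) * csum (fun m => z ^ m * (F t * / circle r t ^ m)) j)%C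
    with (F t * (circle r t / (circle r t - z) - csum (fun m => z ^ m * / circle r t ^ m) j))%C.
  2:{ rewrite (csum_ext (fun m => z ^ m * (F t * / circle r t ^ m))%C (fun m => F t * (z ^ m * / circle r t ^ m))%C) by (intros; Cring).
      rewrite csum_mult_l. Cring. }
  rewrite circle_kernel_expansion by exact Hz.
  rewrite Rmult_comm, Cmod_mult. apply Rmult_le_compat_l; [apply Cmod_ge_0|].
  rewrite Cmod_mult, Cmod_mult, Cmod_div, Cmod_inv, !Cmod_pow, Cmod_circle by (try apply Cpow_nz; auto; lra).
  assert (Hlow : r - Cmod z <= Cmod (circle r t - z)).
  { assert (T := Cmod_triangle (circle r t - z) z). replace (circle r t - z + z)%C with (circle r t) in T by ring.
    rewrite Cmod_circle in T by lra. lra. }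
  rewrite Rmult_comm. apply Rmult_le_compat.
  + apply Rdiv_le_0_compat; lra.
  + apply Rmult_le_pos; [apply pow_le; lra|left; apply Rinv_0_lt_compat, pow_lt; lra].
  + apply Rmult_le_compat_l; [lra|]. apply Rinv_le_contravar; lra.
  + unfold Rdiv. rewrite Rpow_mult_distr, pow_inv. lra.
- apply (is_RInt_scal (V := R_NormedModule)). exact HB.
Qed.

Lemma pow_filterlim_0 (q K : R) : 0 <= q < 1 -> forall eps, 0 < eps -> eventually (fun j => K * q ^ S j < eps).
Proof.
intros Hq eps He.
assert (Hp : 0 < Rabs K + 1) by (generalize (Rabs_pos K); lra).
destruct (pow_lt_1_zero q ltac:(rewrite Rabs_pos_eq; lra) (eps / (Rabs K + 1)) ltac:(apply Rdiv_lt_0_compat; lra)) as [N HN].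
exists N. intros j Hj. assert (A := HN (S j) ltac:(lia)).
assert (P : 0 <= q ^ S j) by (apply pow_le; lra). rewrite Rabs_pos_eq in A by exact P.
apply Rle_lt_trans with ((Rabs K + 1) * q ^ S j).
- apply Rmult_le_compat_r; [exact P|]. generalize (Rle_abs K); lra.
- replace eps with ((Rabs K + 1) * (eps / (Rabs K + 1))) by (field; lra). apply Rmult_lt_compat_l; lra.
Qed.

(** Only the zeroth coefficient of the expansion survives, so all partial sums equal 2 PI while the
    error tends to 0. *)
Lemma is_CInt_circle_kernel (r : R) (z : C) : Cmod z < r ->
  is_CInt (fun t => circle r t / (circle r t - z))%C 0 (2 * PI) (RtoC (2 * PI)).
Proof.
intros Hz. assert (Hz0 := Cmod_ge_0 z).
assert (I : is_CInt (fun t => circle r t / (circle r t - z))%C 0 (2 * PI) (CInt (fun t => circle r t / (circle r t - z))%C 0 (2 * PI))).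
{ apply is_CInt_CInt. intros t _. apply continuous_Cmult; [apply continuous_circle|].
  apply continuous_Cinv; [apply continuous_Cplus; [apply continuous_circle|apply continuous_Cconst]|].
  apply Cminus_eq_contra, circle_neq, Hz. }
set (l := CInt _ _ _) in *.
set (c := fun m => match m with 0%nat => RtoC (2 * PI) | S _ => RtoC 0 end).
assert (Hc : forall m, is_CInt (fun t => RtoC 1 * / circle r t ^ m)%C 0 (2 * PI) (c m)).
{ intros [|m].
  - eapply is_CInt_ext; [|replace (c 0%nat) with (RtoC (2 * PI - 0) * 1)%C by (unfold c; rewrite Rminus_0_r; ring); apply (is_CInt_const (RtoC 1))].
    intros t _. simpl. rewrite Cmult_1_l. symmetry. apply C_ext; simpl; field.
  - eapply is_CInt_ext; [|apply (is_CInt_circle_pow r m); lra]. intros t _. cbv beta. ring. }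
assert (Hs : forall j, csum (fun m => c m * z ^ m)%C j = RtoC (2 * PI)).
{ induction j as [|j IH]; [rewrite csum_0; simpl; Cring|]. rewrite csum_S, IH. simpl. Cring. }
replace (RtoC (2 * PI)) with l; [exact I|].
apply Ceq_minus. apply Cmod_eq_0.
destruct (Cmod_ge_0 (l - RtoC (2 * PI))) as [Hlt|E]; [exfalso|symmetry; exact E].
assert (Hq : 0 <= Cmod z / r < 1).
{ split; [apply Rdiv_le_0_compat; lra|]. apply Rmult_lt_reg_r with r; [lra|]. unfold Rdiv; rewrite Rmult_assoc, Rinv_l by lra; lra. }
destruct (pow_filterlim_0 _ (r / (r - Cmod z) * (2 * PI)) Hq _ Hlt) as [N HN].
assert (A := HN N ltac:(lia)).
assert (B := circle_integral_expansion (fun _ => RtoC 1) r z l c (2 * PI) N Hz).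
rewrite Hs in B. apply Rlt_not_le in A. apply A. apply B.
- eapply is_CInt_ext; [|exact I]. intros t _. cbv beta. ring.
- exact Hc.
- replace (2 * PI) with (scal (V := R_NormedModule) (2 * PI - 0) (Cmod 1)) at 2 by (rewrite Cmod_1; unfold scal; simpl; unfold mult; simpl; ring).
  apply (is_RInt_const (V := R_NormedModule)).
Qed.

Lemma Cauchy_formula (f g : C -> C) (r r' : R) (z : C) :
  r < r' -> (forall u, Cmod u < r' -> C1_at f g u) -> Cmod z < r ->
  is_CInt (fun t => f (circle r t) * (circle r t / (circle r t - z)))%C 0 (2 * PI) (RtoC (2 * PI) * f z)%C.
Proof.
intros Hrr Hf Hz. assert (Hz0 := Cmod_ge_0 z).
set (p := fun s t => (z + RtoC s * (circle r t - z))%C).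
set (ker := fun t => (circle r t / (circle r t - z))%C).
assert (N1 : forall t, (circle r t - z)%C <> 0) by (intros; apply Cminus_eq_contra, circle_neq; exact Hz).
(* Derivatives in s are two-sided, also at 0 and 1. As |zeta - z| <= 2 r, leaving [0, 1] by less
   than [delta] keeps the path inside the disc of radius r'. *)
set (delta := (r' - r) / (2 * r)).
assert (Hdelta : 0 < delta) by (apply Rdiv_lt_0_compat; lra).
assert (Hp : forall s0 s t, 0 <= s0 <= 1 -> Rabs (s - s0) < delta -> Cmod (p s t) < r').
{ intros s0 s t Hs0 Hs. unfold p.
  replace (z + RtoC s * (circle r t - z))%C with (RtoC (1 - s0) * z + RtoC s0 * circle r t + RtoC (s - s0) * (circle r t - z))%C
    by (rewrite !RtoC_minus; ring).
  eapply Rle_lt_trans; [apply Cmod_triangle|].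
  eapply Rle_lt_trans; [apply Rplus_le_compat_r, Cmod_triangle|].
  rewrite !Cmod_mult, !Cmod_R, Cmod_circle, (Rabs_pos_eq (1 - s0)), (Rabs_pos_eq s0) by lra.
  assert (Cmod (circle r t - z) <= 2 * r).
  { eapply Rle_trans; [apply Cmod_triangle|]. rewrite Cmod_opp, Cmod_circle; lra. }
  assert (Rabs (s - s0) * Cmod (circle r t - z) < r' - r).
  { apply Rle_lt_trans with (Rabs (s - s0) * (2 * r)); [apply Rmult_le_compat_l; [apply Rabs_pos|assumption]|].
    replace (r' - r) with (delta * (2 * r)) by (unfold delta; field; lra). apply Rmult_lt_compat_r; lra. }
  nra. }
assert (dps : forall s t, is_cderive (fun s => p s t) s (circle r t - z)%C).
{ intros s t. unfold p. eapply is_cderive_eq.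
  - apply is_cderive_plus; [apply is_cderive_const|]. apply is_cderive_mult; [|apply is_cderive_const].
    apply is_cderive_id.
  - cbv beta; ring. }
assert (dpt : forall s t, is_cderive (p s) t (RtoC s * (Ci * circle r t))%C).
{ intros s t. unfold p. eapply is_cderive_eq.
  - apply is_cderive_plus; [apply is_cderive_const|]. apply is_cderive_mult; [apply is_cderive_const|].
    apply is_cderive_plus; [apply is_cderive_circle|apply is_cderive_const].
  - cbv beta; ring. }
assert (cker : forall t, ccontinuous ker t).
{ intros t. apply continuous_Cmult; [apply continuous_circle|].
  apply continuous_Cinv; [apply continuous_Cplus; [apply continuous_circle|apply continuous_Cconst]|apply N1]. }
assert (c2 : forall s t, continuous (T := R2_UniformSpace) (U := C_UniformSpace) (fun q => p (fst q) (snd q)) (s, t)).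
{ intros s t. unfold p. apply continuous_Cplus; [apply continuous_Cconst|]. apply continuous_Cmult.
  - apply continuous_RtoC, continuous_fst.
  - apply continuous_Cplus; [|apply continuous_Cconst]. apply (continuous_comp snd (circle r)); [apply continuous_snd|apply continuous_circle]. }
assert (cfp : forall s0 s t, 0 <= s0 <= 1 -> Rabs (s - s0) < delta -> ccontinuous (fun t => f (p s t)) t).
{ intros s0 s t Hs0 Hs. eapply is_cderive_continuous. apply (C1_at_chain f g (p s)); [apply Hf, (Hp s0); assumption|apply dpt]. }
(* The chain rule brings out zeta - z, which cancels the denominator of the kernel; the derivative
   is the integral of g(p) zeta. *)
assert (D : forall s, 0 <= s <= 1 -> is_cderive (fun s => CInt (fun t => f (p s t) * ker t)%C 0 (2 * PI)) s (RtoC 0)).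
{ intros s Hs.
  assert (Hss : Rabs (s - s) < delta) by (rewrite Rminus_diag, Rabs_R0; exact Hdelta).
  eapply is_cderive_eq.
  - apply (is_cderive_CInt_param (fun s t => f (p s t) * ker t)%C (fun s t => g (p s t) * circle r t)%C _ _ _ delta); [exact Hdelta| | |].
    + intros s' t Hs'. eapply is_cderive_eq.
      * apply is_cderive_mult; [|apply is_cderive_const]. apply (C1_at_chain f g (fun s => p s t)); [apply Hf, (Hp s); assumption|apply dps].
      * cbv beta; unfold ker. field. apply N1.
    + intros t. apply continuous_Cmult.
      * apply (continuous_comp (fun q => p (fst q) (snd q)) g); [apply c2|].
        apply (C1_at_continuous_derivative f), Hf. apply (Hp s); assumption.
      * apply (continuous_comp snd (circle r)); [apply continuous_snd|apply continuous_circle].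
    + intros s' t Hs'. apply continuous_Cmult; [apply (cfp s); assumption|apply cker].
  - cbv beta. apply is_CInt_unique.
    (* For s <> 0 the integrand is, up to the factor 1 / (i s), the derivative in theta of f(p),
       which is periodic. At s = 0 that factor is meaningless, but g(p) is then constant and zeta
       itself is the derivative of a periodic function. *)
    destruct (Req_dec s 0) as [->|Hs0].
    + apply is_CInt_ext with (fun t => (- Ci * g z) * (Ci * circle r t))%C.
      { intros t _. unfold p. replace (z + RtoC 0 * (circle r t - z))%C with z by ring.
        transitivity (- (Ci * Ci) * (g z * circle r t))%C; [ring|].
        rewrite Ci_mult_Ci. ring. }
      replace (RtoC 0) with ((- Ci * g z) * (circle r (2 * PI) - circle r 0))%C by (rewrite circle_period; ring).
      apply is_CInt_Cmult. apply is_CInt_derive.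
      * intros; apply is_cderive_circle.
      * intros; apply continuous_Cmult; [apply continuous_Cconst|apply continuous_circle].
    + assert (Hsc : RtoC s <> 0) by (intros E; apply Hs0, RtoC_inj, E).
      apply is_CInt_ext with (fun t => (- Ci / RtoC s) * (g (p s t) * (RtoC s * (Ci * circle r t))))%C.
      { intros t _. transitivity (- (Ci * Ci) * (g (p s t) * circle r t))%C; [field; exact Hsc|].
        rewrite Ci_mult_Ci. ring. }
      replace (RtoC 0) with ((- Ci / RtoC s) * (f (p s (2 * PI)%R) - f (p s 0%R)))%C by (unfold p; rewrite circle_period; ring).
      apply is_CInt_Cmult. apply (is_CInt_derive (fun t => f (p s t))).
      * intros t _. apply C1_at_chain; [apply Hf, (Hp s); assumption|apply dpt].
      * intros t _. apply continuous_Cmult.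
        -- apply (continuous_comp (p s) g); [eapply is_cderive_continuous, dpt|].
           apply (C1_at_continuous_derivative f), Hf. apply (Hp s); assumption.
        -- apply continuous_Cmult; [apply continuous_Cconst|]. apply continuous_Cmult; [apply continuous_Cconst|apply continuous_circle]. }
assert (E := eq_is_derive (V := C_R_NormedModule) (fun s => CInt (fun t => f (p s t) * ker t)%C 0 (2 * PI)) 0 1 D Rlt_0_1).
cbv beta in E.
assert (E0 : CInt (fun t => f (p 0 t) * ker t)%C 0 (2 * PI) = (RtoC (2 * PI) * f z)%C).
{ apply is_CInt_unique. rewrite Cmult_comm. apply is_CInt_ext with (fun t => f z * ker t)%C.
  - intros t _. unfold p. do 2 f_equal. ring.
  - apply is_CInt_Cmult, is_CInt_circle_kernel, Hz. }
rewrite <- E0, E.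
apply is_CInt_ext with (fun t => f (p 1 t) * ker t)%C.
- intros t _. unfold p, ker. do 2 f_equal. ring.
- apply is_CInt_CInt. intros t _. apply continuous_Cmult; [|apply cker].
  apply (cfp 1 1); [lra|]. rewrite Rminus_diag, Rabs_R0; exact Hdelta.
Qed.

Lemma analytic_disc_taylor (f : C -> C) (r R R' : R) :
  0 < r < R -> R < R' -> (forall z, Cmod z < R' -> analytic_at f z) ->
  exists c M, taylor_bound f c r R M.
Proof.
intros Hr HR Hf.
assert (HC : forall z, Cmod z < R' -> C1_at f (cderiv f) z) by (intros; apply analytic_at_C1, Hf; assumption).
assert (cF : forall t, ccontinuous (fun t => f (circle R t)) t).
{ intros t. eapply is_cderive_continuous. apply (C1_at_chain f (cderiv f) (circle R)); [|apply is_cderive_circle].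
  apply HC. rewrite Cmod_circle; lra. }
assert (N0 : forall t, circle R t <> 0) by (intros; apply circle_neq; rewrite Cmod_0; lra).
set (a := fun m => CInt (fun t => f (circle R t) * / circle R t ^ m)%C 0 (2 * PI)).
assert (Ha : forall m, is_CInt (fun t => f (circle R t) * / circle R t ^ m)%C 0 (2 * PI) (a m)).
{ intros m. apply is_CInt_CInt. intros t _. apply continuous_Cmult; [apply cF|].
  apply continuous_Cinv; [apply continuous_Cpow, continuous_circle|apply Cpow_nz, N0]. }
set (B := RInt (fun t => Cmod (f (circle R t))) 0 (2 * PI)).
assert (HB : is_RInt (fun t => Cmod (f (circle R t))) 0 (2 * PI) B).
{ apply is_RInt_continuous. intros t _.
  apply continuous_Cmod, cF. }
assert (HB0 : 0 <= B).
{ apply (is_CInt_Cmod_le (fun _ => RtoC 0) (fun t => Cmod (f (circle R t))) 0 (2 * PI) (RtoC (2 * PI - 0) * 0)%C) in HB.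
  - rewrite Cmult_0_r, Cmod_0 in HB. exact HB.
  - generalize PI_RGT_0; lra.
  - intros t _. rewrite Cmod_0. apply Cmod_ge_0.
  - apply is_CInt_const. }
assert (HP : 0 < 2 * PI) by (generalize PI_RGT_0; lra).
assert (HPC : RtoC (2 * PI) <> 0) by (intros E; apply RtoC_inj in E; lra).
assert (K1 : 1 <= R / (R - r)).
{ apply Rmult_le_reg_r with (R - r); [lra|]. unfold Rdiv. rewrite Rmult_assoc, Rinv_l by lra. lra. }
(* The coefficients alone would be bounded by B / (2 PI). The factor R / (R - r) >= 1 is the maximum
   of |zeta / (zeta - z)| for |z| <= r and lets one constant bound the remainders as well. *)
exists (fun m => a m / RtoC (2 * PI))%C, (R / (R - r) * (B / (2 * PI))).
assert (HB1 : 0 <= B / (2 * PI)) by (apply Rdiv_le_0_compat; lra).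
split; [exact Hr|split; [apply Rmult_le_pos; lra|split]].
- intros m. apply Rle_trans with (B / (2 * PI)); [|nra].
  rewrite Cmod_div, Cmod_R, Rabs_pos_eq by (try lra; assumption).
  replace (Cmod (a m) / (2 * PI) * R ^ m) with ((Cmod (a m) * R ^ m) / (2 * PI)) by (field; lra).
  apply Rmult_le_compat_r; [left; apply Rinv_0_lt_compat; lra|].
  assert (0 < R ^ m) by (apply pow_lt; lra).
  apply Rmult_le_reg_r with (/ R ^ m); [apply Rinv_0_lt_compat; lra|].
  rewrite Rmult_assoc, Rinv_r, Rmult_1_r by lra. rewrite Rmult_comm.
  apply (is_CInt_Cmod_le (fun t => f (circle R t) * / circle R t ^ m)%C (fun t => / R ^ m * Cmod (f (circle R t))) 0 (2 * PI)).
  + lra.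
  + intros t _. rewrite Cmod_mult, Cmod_inv, Cmod_pow, Cmod_circle by (try lra; apply Cpow_nz, N0). lra.
  + apply Ha.
  + apply (is_RInt_scal (V := R_NormedModule)); exact HB.
- intros j z Hz.
  assert (E := circle_integral_expansion (fun t => f (circle R t)) R z (RtoC (2 * PI) * f z)%C a B j ltac:(lra)
     (Cauchy_formula f (cderiv f) R R' z HR HC ltac:(lra)) Ha HB).
  replace (f z - csum (fun m => a m / RtoC (2 * PI) * z ^ m) j)%C with
    (/ RtoC (2 * PI) * (RtoC (2 * PI) * f z - csum (fun m => a m * z ^ m) j))%C.
  2:{ rewrite (csum_ext (fun m => a m / RtoC (2 * PI) * z ^ m)%C (fun m => / RtoC (2 * PI) * (a m * z ^ m))%C) by (intros; unfold Cdiv; Cring).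
      rewrite csum_mult_l. Cfield. exact HPC. }
  rewrite Cmod_mult, Cmod_inv, Cmod_R, Rabs_pos_eq by (try lra; assumption).
  apply Rle_trans with (/ (2 * PI) * (R / (R - r) * B * (Cmod z / R) ^ S j)).
  2:{ right; field; repeat split; try lra. }
  apply Rmult_le_compat_l; [left; apply Rinv_0_lt_compat; lra|].
  eapply Rle_trans; [exact E|]. apply Rmult_le_compat_r; [apply pow_le, Rdiv_le_0_compat; [apply Cmod_ge_0|lra]|].
  apply Rmult_le_compat_r; [exact HB0|]. apply Rmult_le_compat_l; [lra|]. apply Rinv_le_contravar; lra.
Qed.

(** * The coefficients D_l *)

(** Binomial coefficients that vanish above the diagonal, so that Pascal's rule and absorption hold
    for all indices; [Binomial.C] is a quotient of factorials with truncated subtraction and agrees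
    only for m <= n. *)
Fixpoint bin (n m : nat) : nat :=
  match n, m with
  | _, O => 1
  | O, S _ => 0
  | S n', S m' => bin n' m' + bin n' (S m')
  end.

Lemma bin_0 (n : nat) : bin n 0 = 1%nat.
Proof. destruct n; reflexivity. Qed.

Lemma bin_gt (n m : nat) : (n < m)%nat -> bin n m = 0%nat.
Proof.
revert m; induction n as [|n IH]; intros [|m] H; try lia; [reflexivity|].
simpl. rewrite !IH by lia. reflexivity.
Qed.

Lemma bin_diag (n : nat) : bin n n = 1%nat.
Proof. induction n as [|n IH]; [reflexivity|]. simpl. rewrite IH, bin_gt by lia. reflexivity. Qed.

Lemma bin_C (n m : nat) : (m <= n)%nat -> Binomial.C n m = INR (bin n m).
Proof.
revert m; induction n as [|n IH]; intros m H.
- replace m with 0%nat by lia. unfold Binomial.C; simpl; field.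
- destruct m as [|m].
  + rewrite bin_0. unfold Binomial.C. rewrite Nat.sub_0_r. simpl (INR (fact 0)). simpl INR at 3. field. apply INR_fact_neq_0.
  + destruct (Nat.eq_dec m n) as [->|].
    * rewrite bin_diag. unfold Binomial.C. rewrite Nat.sub_diag. simpl (INR (fact 0)). simpl INR at 3. field. apply INR_fact_neq_0.
    * rewrite <- pascal by lia. simpl bin. rewrite plus_INR, !IH by lia. reflexivity.
Qed.

Lemma bin_absorb (n m : nat) : (S m * bin (S n) (S m) = S n * bin n m)%nat.
Proof.
revert m; induction n as [|n IH]; intros m.
- destruct m as [|m]; [reflexivity|]. rewrite !bin_gt by lia. lia.
- destruct m as [|m].
  + assert (A := IH 0%nat). rewrite !bin_0 in *. change (bin (S (S n)) 1) with (bin (S n) 0 + bin (S n) 1)%nat. rewrite bin_0. lia.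
  + assert (A := IH m). assert (B := IH (S m)).
    change (bin (S (S n)) (S (S m))) with (bin (S n) (S m) + bin (S n) (S (S m)))%nat.
    change (bin (S n) (S m)) with (bin n m + bin n (S m))%nat in *. nia.
Qed.

Notation cnat k := (RtoC (INR k)).

Lemma cnat_plus (a b : nat) : cnat (a + b) = (cnat a + cnat b)%C.
Proof. rewrite plus_INR, RtoC_plus; reflexivity. Qed.

Lemma cnat_mult (a b : nat) : cnat (a * b) = (cnat a * cnat b)%C.
Proof. rewrite mult_INR, RtoC_mult; reflexivity. Qed.

(** Pascal's rule summed against an arbitrary weight. The binomial theorem and the difference
    relation [alt_sum_shift] are both instances. *)
Lemma csum_pascal (n : nat) (h : nat -> C) :
  csum (fun l => cnat (bin (S n) l) * h l)%C (S n) =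
  (csum (fun l => cnat (bin n l) * h l) n + csum (fun l => cnat (bin n l) * h (S l)) n)%C.
Proof.
rewrite csum_shift, bin_0.
rewrite (csum_ext (fun m => cnat (bin (S n) (S m)) * h (S m))%C
   (fun m => cnat (bin n m) * h (S m) + cnat (bin n (S m)) * h (S m))%C) by
  (intros m _; simpl bin; rewrite cnat_plus; Cring).
rewrite csum_plus.
assert (E := csum_shift (fun l => cnat (bin n l) * h l)%C n).
rewrite csum_S, (bin_gt n (S n)), bin_0 in E by lia.
simpl (cnat 0) in E. rewrite Cmult_0_l, Cplus_0_r in E. rewrite E. Cring.
Qed.

Lemma Cbinomial (x y : C) (n : nat) :
  ((x + y) ^ n = csum (fun l => cnat (bin n l) * (x ^ l * y ^ (n - l))) n)%C.
Proof.
induction n as [|n IH].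
- rewrite csum_0. simpl. rewrite !Cmult_1_r. reflexivity.
- rewrite csum_pascal, Cpow_S, IH, Cmult_plus_distr_r, <- !csum_mult_l, Cplus_comm.
  f_equal; apply csum_ext; intros m Hm.
  + rewrite (Nat.sub_succ_l m n) by lia. rewrite (Cpow_S y). Cring.
  + simpl Nat.sub. rewrite (Cpow_S x). Cring.
Qed.

(* The alternating sum is (-1)^k times the k-th difference at 0 of m |-> m^N. *)
Definition alt_sum (k N : nat) : C :=
  csum (fun m => cnat (bin k m) * ((-1) ^ m * cnat m ^ N))%C k.

Lemma alt_sum_shift (k N : nat) :
  (csum (fun m => cnat (bin k m) * ((-1) ^ m * cnat (S m) ^ N)) k = alt_sum k N - alt_sum (S k) N)%C.
Proof.
unfold alt_sum. rewrite (csum_pascal k (fun m => (-1) ^ m * cnat m ^ N)%C).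
rewrite (csum_ext (fun l => cnat (bin k l) * ((-1) ^ S l * cnat (S l) ^ N))%C
  (fun l => - (1) * (cnat (bin k l) * ((-1) ^ l * cnat (S l) ^ N)))%C).
- rewrite csum_mult_l. Cring.
- intros m _. rewrite (Cpow_S (-1)). Cring.
Qed.

(** The term m = 0 drops out because of the positive power, and absorption exchanges one factor m +
    1 of the power for k + 1. *)
Lemma alt_sum_rec (k N : nat) : alt_sum (S k) (S N) = (- cnat (S k) * (alt_sum k N - alt_sum (S k) N))%C.
Proof.
rewrite <- alt_sum_shift. unfold alt_sum at 1. rewrite csum_shift.
simpl (cnat 0 ^ S N)%C. rewrite <- csum_mult_l.
rewrite !Cmult_0_l, !Cmult_0_r, Cplus_0_l. apply csum_ext. intros m _.
assert (E : (cnat (S m) * cnat (bin (S k) (S m)) = cnat (S k) * cnat (bin k m))%C).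
{ rewrite <- !cnat_mult, bin_absorb. reflexivity. }
rewrite !Cpow_S.
transitivity (- ((cnat (S m) * cnat (bin (S k) (S m))) * ((-1) ^ m * cnat (S m) ^ N)))%C; [Cring|].
rewrite E. Cring.
Qed.

Lemma alt_sum_0_0 (k : nat) : alt_sum (S k) 0 = RtoC 0.
Proof.
unfold alt_sum. transitivity ((RtoC (-1) + 1) ^ S k)%C.
- rewrite Cbinomial. apply csum_ext. intros m _. rewrite Cpow_1_l. simpl (cnat m ^ 0)%C. reflexivity.
- replace (RtoC (-1) + 1)%C with (RtoC 0) by (rewrite <- RtoC_plus; f_equal; ring). rewrite Cpow_S. Cring.
Qed.

(** A k-th difference annihilates polynomials of degree below k. Hence in [alt_sum_telescope] the
    last term disappears once the sum over k reaches n >= N, and only the value of x^N at 0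
    remains. *)
Lemma alt_sum_vanish (k N : nat) : (N < k)%nat -> alt_sum k N = RtoC 0.
Proof.
revert k; induction N as [|N IH]; intros [|k] H; try lia.
- apply alt_sum_0_0.
- rewrite alt_sum_rec, !IH by lia. Cring.
Qed.

Lemma alt_sum_telescope (q : C) (n N : nat) : (N <= n)%nat ->
  csum (fun k => q ^ k * alt_sum k N - q ^ S k * alt_sum (S k) N)%C n = (RtoC 0 ^ N)%C.
Proof.
intros H.
assert (E : forall j, csum (fun k => q ^ k * alt_sum k N - q ^ S k * alt_sum (S k) N)%C j =
  (RtoC 0 ^ N - q ^ S j * alt_sum (S j) N)%C).
{ induction j as [|j IH].
  - rewrite csum_0. unfold alt_sum at 1. rewrite csum_0. simpl. Cring.
  - rewrite csum_S, IH. Cring. }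
rewrite E, alt_sum_vanish by lia. Cring.
Qed.

Lemma csum_exchange (h : nat -> nat -> C) (n m : nat) :
  csum (fun i => csum (fun j => h i j) m) n = csum (fun j => csum (fun i => h i j) n) m.
Proof. apply (sum_n_switch (G := C_AbelianMonoid)). Qed.

(* The l-th power moment of the odd numbers 2m+1 against the alternating binomial weights; it is
   the inner sum of D_l. *)
Definition odd_moment (k l : nat) : C :=
  csum (fun m => cnat (bin k m) * ((-1) ^ m * cnat (2 * m + 1) ^ l))%C k.

(** To be used with s = 1 and s = -1: shifting the odd numbers 2m + 1 by one gives 2(m + 1) and 2m,
    so that the convolutions become powers of 2 times differences at 0. *)
Lemma odd_moment_binomial (k N : nat) (s p : C) :
  csum (fun l => cnat (bin N l) * (s ^ (N - l) * p ^ N * odd_moment k l))%C N =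
  (p ^ N * csum (fun m => cnat (bin k m) * ((-1) ^ m * (cnat (2 * m + 1) + s) ^ N)) k)%C.
Proof.
rewrite (csum_ext _ (fun l => csum (fun m => p ^ N * (cnat (bin k m) * ((-1) ^ m * (cnat (bin N l) * (cnat (2 * m + 1) ^ l * s ^ (N - l))))))%C k)).
- rewrite csum_exchange, <- csum_mult_l. apply csum_ext. intros m _.
  rewrite !csum_mult_l, <- Cbinomial. reflexivity.
- intros l _. unfold odd_moment. rewrite <- !csum_mult_l. apply csum_ext. intros m _. Cring.
Qed.

Lemma odd_moment_plus (k N : nat) :
  csum (fun m => cnat (bin k m) * ((-1) ^ m * (cnat (2 * m + 1) + 1) ^ N))%C k = (2 ^ N * (alt_sum k N - alt_sum (S k) N))%C.
Proof.
rewrite <- alt_sum_shift, <- csum_mult_l. apply csum_ext. intros m _.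
replace (cnat (2 * m + 1) + 1)%C with (2 * cnat (S m))%C.
- rewrite Cpow_mult_l. Cring.
- rewrite <- RtoC_plus, <- RtoC_mult. f_equal. rewrite S_INR, plus_INR, mult_INR. simpl. ring.
Qed.

Lemma odd_moment_minus (k N : nat) :
  csum (fun m => cnat (bin k m) * ((-1) ^ m * (cnat (2 * m + 1) + - (1)) ^ N))%C k = (2 ^ N * alt_sum k N)%C.
Proof.
unfold alt_sum. rewrite <- csum_mult_l. apply csum_ext. intros m _.
replace (cnat (2 * m + 1) + - (1))%C with (2 * cnat m)%C.
- rewrite Cpow_mult_l. Cring.
- rewrite <- RtoC_opp, <- RtoC_plus, <- RtoC_mult. f_equal. rewrite plus_INR, mult_INR. simpl. ring.
Qed.

Lemma Zsum_parity (h : nat -> C) (k : nat) :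
  Zsum (fun p => h (2 * p)%nat) (Z.of_nat k / 2) = csum (fun q => if Nat.even q then h q else RtoC 0) k /\
  Zsum (fun p => h (2 * p + 1)%nat) ((Z.of_nat k - 1) / 2) = csum (fun q => if Nat.even q then RtoC 0 else h q) k.
Proof.
assert (P : forall f (m : nat), Zsum f (Z.of_nat m) = csum f m).
{ intros f m. unfold Zsum. replace (Z.of_nat m <? 0)%Z with false by (symmetry; apply Z.ltb_ge; lia). rewrite Nat2Z.id. reflexivity. }
assert (M : forall f, Zsum f (-1) = RtoC 0) by reflexivity.
(* The odd sum up to 2j has one term fewer than the even one; adding h(2j+1) makes both run over p
   <= j, and the two parities of k follow from the same induction. *)
assert (Q : forall j, 
  csum (fun q => if Nat.even q then h q else RtoC 0) (2 * j) = csum (fun p => h (2 * p)%nat) j /\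
  (csum (fun q => if Nat.even q then RtoC 0 else h q) (2 * j) + h (2 * j + 1)%nat)%C = csum (fun p => h (2 * p + 1)%nat) j).
{ induction j as [|j [IH1 IH2]].
  - simpl Nat.mul. rewrite !csum_0. simpl. split; [reflexivity|Cring].
  - replace (2 * S j)%nat with (S (S (2 * j))) by lia.
    assert (E1 : Nat.even (S (S (2 * j))) = true) by (apply Nat.even_spec; exists (S j); lia).
    assert (E2 : Nat.even (S (2 * j)) = false) by (rewrite Nat.even_succ, <- Nat.negb_even; apply Bool.negb_false_iff, Nat.even_spec; exists j; lia).
    rewrite !csum_S, E1, E2, IH1. split.
    + replace (2 * S j)%nat with (S (S (2 * j))) by lia. Cring.
    + rewrite <- IH2. replace (2 * S j + 1)%nat with (S (S (2 * j)) + 1)%nat by lia. replace (S (2 * j)) with (2 * j + 1)%nat by lia. Cring. }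
destruct (Nat.Even_or_Odd k) as [[j ->]|[j ->]].
- destruct (Q j) as [Q1 Q2]. split.
  + replace (Z.of_nat (2 * j) / 2)%Z with (Z.of_nat j) by (apply Z.div_unique with 0%Z; lia).
    rewrite P, Q1. reflexivity.
  + destruct j as [|j].
    * simpl (2 * 0)%nat. rewrite csum_0. reflexivity.
    * replace ((Z.of_nat (2 * S j) - 1) / 2)%Z with (Z.of_nat j) by (apply Z.div_unique with 1%Z; lia).
      rewrite P. destruct (Q j) as [_ Q3]. rewrite <- Q3.
      replace (2 * S j)%nat with (S (S (2 * j))) by lia. rewrite !csum_S.
      assert (E1 : Nat.even (S (S (2 * j))) = true) by (apply Nat.even_spec; exists (S j); lia).
      assert (E2 : Nat.even (S (2 * j)) = false) by (rewrite Nat.even_succ, <- Nat.negb_even; apply Bool.negb_false_iff, Nat.even_spec; exists j; lia).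
      rewrite E1, E2. replace (2 * j + 1)%nat with (S (2 * j)) by lia. Cring.
- destruct (Q j) as [Q1 Q2].
  assert (E2 : Nat.even (S (2 * j)) = false) by (rewrite Nat.even_succ, <- Nat.negb_even; apply Bool.negb_false_iff, Nat.even_spec; exists j; lia).
  split.
  + replace (Z.of_nat (2 * j + 1) / 2)%Z with (Z.of_nat j) by (apply Z.div_unique with 1%Z; lia).
    rewrite P, <- Q1. replace (2 * j + 1)%nat with (S (2 * j)) by lia. rewrite csum_S, E2. Cring.
  + replace ((Z.of_nat (2 * j + 1) - 1) / 2)%Z with (Z.of_nat j) by (apply Z.div_unique with 0%Z; lia).
    rewrite P, <- Q2. replace (2 * j + 1)%nat with (S (2 * j)) by lia. rewrite csum_S, E2. reflexivity.
Qed.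

Lemma Ci_pow_even (p : nat) : (Ci ^ (2 * p) = (-1) ^ p)%C.
Proof.
rewrite Cpow_mult_r. f_equal. simpl. rewrite Cmult_1_r, Ci_mult_Ci. rewrite <- RtoC_opp. f_equal.
Qed.

Lemma Cpow_opp_even (x : C) (p : nat) : ((- x) ^ (2 * p) = x ^ (2 * p))%C.
Proof. rewrite !Cpow_mult_r. f_equal. simpl. ring. Qed.

(* With u = 1 + i cot and v = 1 - i cot, the cotangent sum in D_l is the even (odd) part of the
   binomial expansion of u^k; i^(l/2) and the parity combine to the powers of i below. *)
Lemma cot_sum (c : C) (k l : nat) :
  ((-1) ^ (l / 2)%nat * Zsum (fun p => (-1) ^ p * RtoC (Binomial.C k (2 * p + parity l)) * c ^ (2 * p + parity l))
     ((Z.of_nat k - Z.of_nat (parity l)) / 2)%Z =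
   (-1) ^ l * (Ci ^ l * (1 + Ci * c) ^ k + (- Ci) ^ l * (1 + - Ci * c) ^ k) / 2)%C.
Proof.
set (h := fun q => (cnat (bin k q) * c ^ q)%C).
assert (U : ((1 + Ci * c) ^ k = csum (fun q => Ci ^ q * h q) k)%C).
{ rewrite Cplus_comm, Cbinomial. apply csum_ext. intros q _. unfold h. rewrite Cpow_1_l, Cpow_mult_l. Cring. }
assert (V : ((1 + - Ci * c) ^ k = csum (fun q => (- Ci) ^ q * h q) k)%C).
{ rewrite Cplus_comm, Cbinomial. apply csum_ext. intros q _. unfold h. rewrite Cpow_1_l, Cpow_mult_l. Cring. }
assert (B : forall p g, (Z.of_nat p <= (Z.of_nat k - Z.of_nat g) / 2)%Z -> RtoC (Binomial.C k (2 * p + g)) = cnat (bin k (2 * p + g))).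
{ intros p g Hp. rewrite bin_C; [reflexivity|].
  assert (2 * ((Z.of_nat k - Z.of_nat g) / 2) <= Z.of_nat k - Z.of_nat g)%Z by (apply Z.mul_div_le; lia). lia. }
assert (X : forall f g N, (forall p, (Z.of_nat p <= N)%Z -> f p = g p) -> Zsum f N = Zsum g N).
{ intros f g N H. unfold Zsum. destruct (Z.ltb_spec N 0); [reflexivity|]. apply csum_ext. intros m Hm. apply H. lia. }
assert (N2 : RtoC 2 <> 0) by (intros E; apply RtoC_inj in E; lra).
assert (EO : forall q, (Ci ^ S (2 * q))%C = ((-1) ^ q * Ci)%C /\ ((- Ci) ^ S (2 * q))%C = (- ((-1) ^ q * Ci))%C /\
  ((- Ci) ^ (2 * q))%C = ((-1) ^ q)%C).
{ intros q. rewrite !(Cpow_S _ (2 * q)), Cpow_opp_even, Ci_pow_even. repeat split; ring. }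
assert (SQ : forall p, ((-1) ^ p * (-1) ^ p = 1)%C).
{ intros p. rewrite <- Cpow_mult_l. replace (-1 * -1)%C with (RtoC 1) by (rewrite <- RtoC_mult; f_equal; ring). apply Cpow_1_l. }
unfold parity. destruct (Nat.Even_or_Odd l) as [[j Hj]|[j Hj]].
- replace (Nat.odd l) with false by (symmetry; rewrite Hj, <- Nat.negb_even; apply Bool.negb_false_iff, Nat.even_spec; exists j; lia).
  rewrite (X _ (fun p => (fun q => Ci ^ q * h q)%C (2 * p)%nat)).
  2:{ intros p Hp. rewrite B by exact Hp. unfold h. rewrite Nat.add_0_r, Ci_pow_even. Cring. }
  simpl (Z.of_nat 0). rewrite Z.sub_0_r.
  destruct (Zsum_parity (fun q => Ci ^ q * h q)%C k) as [-> _].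
  replace (l / 2)%nat with j by (subst l; symmetry; rewrite Nat.mul_comm; apply Nat.div_mul; lia).
  subst l. destruct (EO j) as (_ & _ & ->). rewrite Ci_pow_even.
  replace ((-1) ^ (2 * j))%C with (RtoC 1) by (rewrite <- (SQ j), <- Cpow_add_r; f_equal; lia).
  transitivity ((-1) ^ j * ((1 + Ci * c) ^ k + (1 + - Ci * c) ^ k) / 2)%C; [|field; exact N2].
  rewrite U, V, <- csum_plus. unfold Cdiv. rewrite <- Cmult_assoc. f_equal. rewrite Cmult_comm, <- csum_mult_l.
  apply csum_ext. intros q _. destruct (Nat.Even_or_Odd q) as [[p ->]|[p ->]].
  + replace (Nat.even (2 * p)) with true by (symmetry; apply Nat.even_spec; exists p; lia).
    destruct (EO p) as (_ & _ & ->). rewrite Ci_pow_even. Cfield.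
  + replace (2 * p + 1)%nat with (S (2 * p)) by lia.
    replace (Nat.even (S (2 * p))) with false by (symmetry; rewrite Nat.even_succ, <- Nat.negb_even; apply Bool.negb_false_iff, Nat.even_spec; exists p; lia).
    destruct (EO p) as (-> & -> & _). Cring.
- replace (Nat.odd l) with true by (symmetry; apply Nat.odd_spec; exists j; exact Hj).
  rewrite (X _ (fun p => (fun q => - Ci * (Ci ^ q * h q))%C (2 * p + 1)%nat)).
  2:{ intros p Hp. rewrite B by exact Hp. unfold h. replace (2 * p + 1)%nat with (S (2 * p)) by lia. destruct (EO p) as (-> & _).
      transitivity (- (Ci * Ci) * ((-1) ^ p * cnat (bin k (S (2 * p))) * c ^ S (2 * p)))%C; [rewrite Ci_mult_Ci; Cring|Cring]. }
  simpl (Z.of_nat 1).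
  destruct (Zsum_parity (fun q => - Ci * (Ci ^ q * h q))%C k) as [_ ->].
  replace (l / 2)%nat with j by (subst l; rewrite Nat.mul_comm, Nat.add_comm; symmetry; rewrite Nat.div_add by lia; reflexivity).
  subst l. replace (2 * j + 1)%nat with (S (2 * j)) by lia. destruct (EO j) as (-> & -> & _).
  replace ((-1) ^ S (2 * j))%C with (- RtoC 1)%C by (rewrite Cpow_S; replace ((-1) ^ (2 * j))%C with (RtoC 1) by (rewrite <- (SQ j), <- Cpow_add_r; f_equal; lia); ring).
  transitivity ((-1) ^ j * (- Ci * ((1 + Ci * c) ^ k + - (1 + - Ci * c) ^ k)) / 2)%C; [|field; exact N2].
  rewrite U, V. replace (- csum (fun q => (- Ci) ^ q * h q) k)%C with (csum (fun q => - (1) * ((- Ci) ^ q * h q)) k)%C by (rewrite csum_mult_l; Cring).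
  rewrite <- csum_plus. unfold Cdiv. rewrite <- Cmult_assoc. f_equal. rewrite Cmult_comm, <- !csum_mult_l.
  apply csum_ext. intros q _. destruct (Nat.Even_or_Odd q) as [[p ->]|[p ->]].
  + replace (Nat.even (2 * p)) with true by (symmetry; apply Nat.even_spec; exists p; lia).
    destruct (EO p) as (_ & _ & ->). rewrite Ci_pow_even. Cring.
  + replace (2 * p + 1)%nat with (S (2 * p)) by lia.
    replace (Nat.even (S (2 * p))) with false by (symmetry; rewrite Nat.even_succ, <- Nat.negb_even; apply Bool.negb_false_iff, Nat.even_spec; exists p; lia).
    destruct (EO p) as (-> & -> & _). Cfield.
Qed.

Lemma RtoC_neq_0 (x : R) : x <> 0 -> RtoC x <> 0.
Proof. intros H E. apply H, RtoC_inj, E. Qed.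

(** The sign (-1)^[l/2], the power of PI and the parity of l merge into the powers of -i PI and i
    PI. Apart from the odd moments, l then occurs only as an exponent, which is the form needed for
    a binomial convolution over l. *)
Lemma D_l_closed (n l : nat) (nu : C) :
  let c := Ccot (RtoC PI * nu) in
  D_l n l nu = (Ccsc (RtoC PI * nu) / 2 * csum (fun k => / (2 ^ k) * odd_moment k l *
     ((- (Ci * RtoC PI)) ^ l * (1 + Ci * c) ^ k + (Ci * RtoC PI) ^ l * (1 + - Ci * c) ^ k)) n)%C.
Proof.
intros c.
assert (N2 : RtoC 2 <> 0) by (apply RtoC_neq_0; lra).
unfold D_l.
transitivity (RtoC PI ^ l * Ccsc (RtoC PI * nu) * csum (fun k => / (2 ^ k) * odd_moment k l *
  ((-1) ^ (l / 2)%nat * Zsum (fun p => (-1) ^ p * RtoC (Binomial.C k (2 * p + parity l)) * c ^ (2 * p + parity l))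
     ((Z.of_nat k - Z.of_nat (parity l)) / 2)%Z)) n)%C.
- rewrite <- !(Cmult_assoc ((-1) ^ (l / 2)%nat)), (Cmult_comm ((-1) ^ (l / 2)%nat)), <- !Cmult_assoc.
  do 2 f_equal. rewrite Cmult_comm, <- csum_mult_l. apply csum_ext. intros k _.
  assert (E : csum (fun m => (-1) ^ m * RtoC (Binomial.C k m) * cnat (2 * m + 1) ^ l)%C k = odd_moment k l).
  { unfold odd_moment. apply csum_ext. intros m Hm. rewrite bin_C by exact Hm. Cring. }
  fold c. rewrite <- E. Cring.
- rewrite <- Cmult_assoc, (Cmult_comm (RtoC PI ^ l)), <- Cmult_assoc. unfold Cdiv. rewrite <- !Cmult_assoc. f_equal.
  rewrite Cmult_comm, <- !csum_mult_l. apply csum_ext. intros k _.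
  rewrite cot_sum.
  replace ((- (Ci * RtoC PI)) ^ l)%C with ((-1) ^ l * Ci ^ l * RtoC PI ^ l)%C.
  2:{ rewrite <- !Cpow_mult_l. f_equal. ring. }
  replace ((Ci * RtoC PI) ^ l)%C with ((-1) ^ l * (- Ci) ^ l * RtoC PI ^ l)%C.
  2:{ rewrite <- !Cpow_mult_l. f_equal. ring. }
  unfold Cdiv. Cring.
Qed.

(* For [log_moment] in place of [(-1)^l PI D_l] this is [jump_PI], with E = e^(i PI nu). *)
Lemma D_l_recursion (n N : nat) (nu E : C) : (N <= n)%nat ->
  E = Cexp (Ci * (RtoC PI * nu)) -> (E - / E)%C <> 0 ->
  csum (fun l => cnat (bin N l) * ((/ E * (Ci * RtoC PI) ^ (N - l) - E * (- (Ci * RtoC PI)) ^ (N - l)) *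
     ((-1) ^ l * RtoC PI * D_l n l nu)))%C N =
  (- (2 * Ci * RtoC PI) * 0 ^ N)%C.
Proof.
intros HN HE HE1.
assert (E0 : E <> 0) by (rewrite HE; apply Cexp_neq_0).
assert (N2 : RtoC 2 <> 0) by (apply RtoC_neq_0; lra).
assert (Nc := Ci_nz).
set (P := (Ci * RtoC PI)%C). set (c := Ccot (RtoC PI * nu)).
assert (HEi : Cexp (- (Ci * (RtoC PI * nu))) = (/ E)%C) by (rewrite Cexp_opp, HE; reflexivity).
assert (Hs : Csin (RtoC PI * nu) = ((E - / E) / (2 * Ci))%C) by (unfold Csin; rewrite HEi, <- HE; reflexivity).
assert (Hco : Ccos (RtoC PI * nu) = ((E + / E) / 2)%C) by (unfold Ccos; rewrite HEi, <- HE; reflexivity).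
assert (HE2 : (E * E - 1)%C <> 0).
{ intros H. apply HE1. replace (E - / E)%C with ((E * E - 1) / E)%C by (field; exact E0). rewrite H. field. exact E0. }
(* q and q' are the ratios that make the sum over k telescope: with a_k = [alt_sum k N], the
   combination (1/E)(a_k - a_(k+1)) - E a_k equals (1/E - E)(a_k - q a_(k+1)), and the combination
   with the two differences exchanged gives q' in the same way. *)
set (q := ((1 + Ci * c) / 2)%C). set (q' := ((1 + - Ci * c) / 2)%C).
assert (Hc : (Ci * c = - ((E + / E) / (E - / E)))%C).
{ unfold c, Ccot. rewrite Hs, Hco. transitivity ((Ci * Ci) * ((E + / E) / (E - / E)))%C; [field; repeat split; auto|].
  rewrite Ci_mult_Ci. ring. }
assert (Hq : q = (- (/ E / (E - / E)))%C).
{ unfold q. rewrite Hc. field. repeat split; auto. }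
assert (Hq' : q' = (E / (E - / E))%C).
{ unfold q'. replace (- Ci * c)%C with (- (Ci * c))%C by ring. rewrite Hc. field. repeat split; auto. }
assert (Hcsc : (Ccsc (RtoC PI * nu) = 2 * Ci / (E - / E))%C).
{ unfold Ccsc. rewrite Hs. field. repeat split; auto. }
set (om := (RtoC PI * (Ccsc (RtoC PI * nu) / 2))%C).
transitivity (csum (fun l => csum (fun k => om * / 2 ^ k *
   ((1 + Ci * c) ^ k * (/ E * (cnat (bin N l) * (1 ^ (N - l) * P ^ N * odd_moment k l)) +
                        - E * (cnat (bin N l) * ((- (1)) ^ (N - l) * P ^ N * odd_moment k l))) +
    (1 + - Ci * c) ^ k * (/ E * (cnat (bin N l) * ((- (1)) ^ (N - l) * (- P) ^ N * odd_moment k l)) +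
                        - E * (cnat (bin N l) * (1 ^ (N - l) * (- P) ^ N * odd_moment k l)))))%C n) N).
- apply csum_ext. intros l Hl. rewrite D_l_closed. fold c. fold P.
  rewrite <- !csum_mult_l. apply csum_ext. intros k _.
  assert (S1 : (P ^ N = P ^ (N - l) * P ^ l)%C) by (rewrite <- Cpow_add_r; f_equal; lia).
  assert (S2 : ((- P) ^ N = (- P) ^ (N - l) * (- P) ^ l)%C) by (rewrite <- Cpow_add_r; f_equal; lia).
  assert (O : forall (x : C) j, ((- x) ^ j = (-1) ^ j * x ^ j)%C) by (intros; rewrite <- Cpow_mult_l; f_equal; ring).
  assert (SQ : forall p, ((-1) ^ p * (-1) ^ p = 1)%C).
  { intros p. rewrite <- Cpow_mult_l. replace (-1 * -1)%C with (RtoC 1) by (rewrite <- RtoC_mult; f_equal; ring). apply Cpow_1_l. }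
  rewrite S1, S2, !O, !Cpow_1_l. unfold om.
  assert (Q1 := SQ l). assert (Q2 := SQ (N - l)%nat).
  set (sl := ((-1) ^ l)%C) in *. set (sn := ((-1) ^ (N - l))%C) in *.
  set (A := ((1 + Ci * c) ^ k)%C). set (B := ((1 + - Ci * c) ^ k)%C).
  set (X := (P ^ (N - l))%C). set (Y := (P ^ l)%C).
  unfold Cdiv.
  transitivity (cnat (bin N l) * ((/ E * X - E * (sn * X)) * RtoC PI * (Ccsc (RtoC PI * nu) * / 2) * (/ 2 ^ k * odd_moment k l * ((sl * sl) * Y * A + sl * Y * B))))%C; [Cring|].
  rewrite Q1.
  transitivity (cnat (bin N l) * (RtoC PI * (Ccsc (RtoC PI * nu) * / 2) * (/ 2 ^ k * odd_moment k l * (A * (/ E * X - E * (sn * X)) * Y + B * (/ E * ((sn * sn) * X) - E * (sn * X)) * (sl * Y)))))%C; [rewrite Q2; Cring|].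
  Cring.
- rewrite csum_exchange.
  transitivity (csum (fun k => om * (/ E - E) * 2 ^ N * (P ^ N * (q ^ k * alt_sum k N - q ^ S k * alt_sum (S k) N) +
      (- P) ^ N * (q' ^ k * alt_sum k N - q' ^ S k * alt_sum (S k) N)))%C n).
  + apply csum_ext. intros k _. rewrite csum_mult_l.
    rewrite csum_plus, !csum_mult_l, !csum_plus, !csum_mult_l, !odd_moment_binomial, !odd_moment_plus, !odd_moment_minus.
    replace ((1 + Ci * c) ^ k)%C with (2 ^ k * q ^ k)%C by (rewrite <- Cpow_mult_l; f_equal; unfold q; field; auto).
    replace ((1 + - Ci * c) ^ k)%C with (2 ^ k * q' ^ k)%C by (rewrite <- Cpow_mult_l; f_equal; unfold q'; field; auto).
    assert (T : (2 ^ k)%C <> 0) by (apply Cpow_nz; exact N2).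
    rewrite !(Cpow_S _ k).
    transitivity (om * 2 ^ N * (P ^ N * q ^ k * (/ E * (alt_sum k N - alt_sum (S k) N) - E * alt_sum k N) +
       (- P) ^ N * q' ^ k * (/ E * alt_sum k N - E * (alt_sum k N - alt_sum (S k) N))))%C.
    { Cfield. repeat split; auto. }
    rewrite <- !(Cmult_assoc om). f_equal. rewrite (Cmult_comm (/ E - E)), <- !Cmult_assoc. f_equal.
    rewrite Cmult_plus_distr_l. f_equal.
    * rewrite Hq at 3. Cfield. auto.
    * rewrite Hq' at 3. Cfield. auto.
  + rewrite csum_mult_l, csum_plus, !csum_mult_l, !alt_sum_telescope by exact HN.
    destruct N as [|N].
    * simpl. unfold om. rewrite Hcsc. Cfield. repeat split; auto.
    * rewrite !(Cpow_S 0). Cring.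
Qed.

(** * Improper integrals *)

Lemma is_CInt_gen_right (F : (R -> Prop) -> Prop) {FF : Filter F} (f : R -> C) (c : R) (l : C) :
  F (fun b => ex_CInt f c b) -> filterlim (fun b => CInt f c b) F (Clocally l) ->
  is_CInt_gen f (at_point c) F l.
Proof.
intros He Hl P HP.
apply (Filter_prod (at_point c) F _ (fun a => a = c) (fun b => ex_CInt f c b /\ P (CInt f c b))).
- reflexivity.
- apply filter_and; [exact He|]. apply Hl, HP.
- intros a b -> [Hb Pb]. exists (CInt f c b). split; [|exact Pb].
  apply (RInt_correct (V := C_R_CompleteNormedModule)). exact Hb.
Qed.

(** Restricts the double limit to a one-parameter family of endpoints, such as e^(-X) and e^X, or
    one fixed and one moving end. *)
Lemma is_CInt_gen_filterlim (Fa Fb F : (R -> Prop) -> Prop) {FF : Filter F} (f : R -> C) (a b : R -> R) (l : C) :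
  is_CInt_gen f Fa Fb l -> filterlim a F Fa -> filterlim b F Fb ->
  F (fun x => ex_CInt f (a x) (b x)) /\
  filterlim (fun x => CInt f (a x) (b x)) F (Clocally l).
Proof.
intros H Ha Hb.
assert (K : forall P, Clocally l P -> F (fun x => exists y, is_CInt f (a x) (b x) y /\ P y)).
{ intros P HP. destruct (H P HP) as [Q Q' HQ HR HQR].
  assert (A := Ha _ HQ). assert (B := Hb _ HR). unfold filtermap in A, B.
  generalize (filter_and _ _ A B). apply filter_imp. intros x [H1 H2]. apply (HQR (a x) (b x) H1 H2). }
split.
- generalize (K (fun _ => True) (filter_true)). apply filter_imp. intros x [y [Hy _]]. exists y; exact Hy.
- intros P HP. generalize (K P HP). unfold filtermap. apply filter_imp. intros x [y [Hy Py]].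
  rewrite (is_CInt_unique _ _ _ _ Hy). exact Py.
Qed.

Lemma is_CInt_gen_Cmult (Fa Fb : (R -> Prop) -> Prop) {FFa : Filter Fa} {FFb : Filter Fb} (c : C) (f : R -> C) (l : C) :
  is_CInt_gen f Fa Fb l -> is_CInt_gen (fun t => c * f t)%C Fa Fb (c * l)%C.
Proof.
intros H P HP.
assert (L := filterlim_C_mult_const (Clocally l) c (fun z => z) l (filterlim_id _ _)).
assert (K := H _ (L P HP)). unfold filtermapi in *. revert K. apply filter_imp.
intros [u v] [y [Hy Py]]. exists (c * y)%C. split; [apply is_CInt_Cmult; exact Hy|exact Py].
Qed.

Lemma is_CInt_gen_plus (Fa Fb : (R -> Prop) -> Prop) {FFa : Filter Fa} {FFb : Filter Fb} (f g : R -> C) (l m : C) :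
  is_CInt_gen f Fa Fb l -> is_CInt_gen g Fa Fb m -> is_CInt_gen (fun t => f t + g t)%C Fa Fb (l + m)%C.
Proof. intros Hf Hg. apply (is_RInt_gen_plus (V := C_R_NormedModule) f g l m Hf Hg). Qed.

Lemma is_CInt_gen_csum (Fa Fb : (R -> Prop) -> Prop) {FFa : Filter Fa} {FFb : Filter Fb} (F : nat -> R -> C) (l : nat -> C) (j : nat) :
  (forall m, (m <= j)%nat -> is_CInt_gen (F m) Fa Fb (l m)) -> is_CInt_gen (fun t => csum (fun m => F m t) j) Fa Fb (csum l j).
Proof.
intros H. induction j as [|j IH].
- rewrite csum_0. eapply (CInt_gen_ext); [|apply (H 0%nat); lia].
  apply filter_forall. intros x t _. rewrite csum_0. reflexivity.
- rewrite csum_S. eapply (CInt_gen_ext); [|apply is_CInt_gen_plus; [exact FFa|exact FFb|apply IH|apply (H (S j)); lia]].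
  + apply filter_forall. intros x t _. cbv beta. rewrite csum_S. reflexivity.
  + intros m Hm. apply H. lia.
Qed.

Lemma CInt_dominated_limit (F : (R -> Prop) -> Prop) {FF : ProperFilter F} (f : R -> C) (G : R -> R) (D : R -> Prop) (c L : R) :
  F D -> D c -> filterlim G F (locally L) ->
  (forall u v, D u -> D v -> exists l : C, is_CInt f u v l /\ Cmod l <= Rabs (G v - G u)) ->
  exists l : C, filterlim (fun b => CInt f c b) F (Clocally l) /\ Cmod l <= Rabs (L - G c).
Proof.
intros HD Dc HG H.
assert (E : exists l : C, filterlim (fun b => CInt f c b) F (Clocally l)).
{ apply filterlim_C_cauchy; [exact FF|]. intros eps He.
  assert (He2 : 0 < eps / 2) by lra.
  assert (HL := HG _ (locally_ball L (mkposreal _ He2))). unfold filtermap in HL.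
  exists (fun b => D b /\ ball L (eps / 2) (G b)). split; [apply filter_and; [exact HD|exact HL]|].
  intros u v [Du Hu] [Dv Hv].
  destruct (H v u Dv Du) as [l [Hl Bl]].
  destruct (H c v Dc Dv) as [l' [Hl' _]].
  assert (S : is_CInt f c u (l' + l)%C) by (apply (is_RInt_Chasles (V := C_R_NormedModule) f c v u); assumption).
  rewrite (is_CInt_unique _ _ _ _ S), (is_CInt_unique _ _ _ _ Hl').
  replace (l' + l - l')%C with l by ring.
  apply Rle_lt_trans with (1 := Bl).
  replace (G u - G v) with ((G u - L) - (G v - L)) by ring.
  eapply Rle_lt_trans; [apply Rabs_triang|]. rewrite Rabs_Ropp.
  change (Rabs (G u - L) < eps / 2) in Hu. change (Rabs (G v - L) < eps / 2) in Hv. lra. }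
destruct E as [l Hl]. exists l; split; [exact Hl|].
apply le_epsilon. intros eps He.
assert (HL := HG _ (locally_ball L (mkposreal _ He))). unfold filtermap in HL.
apply (filterlim_C_le F (fun b => CInt f c b) l _ Hl).
generalize (filter_and _ _ HD HL). apply filter_imp. intros b [Db Hb].
destruct (H c b Dc Db) as [l' [Hl' Bl]]. rewrite (is_CInt_unique _ _ _ _ Hl').
apply Rle_trans with (1 := Bl).
replace (G b - G c) with ((L - G c) + (G b - L)) by ring.
eapply Rle_trans; [apply Rabs_triang|]. change (Rabs (G b - L) < eps) in Hb. lra.
Qed.

Lemma is_CInt_dominated (f : R -> C) (G g : R -> R) (u v : R) : u <= v ->
  (forall t, u <= t <= v -> ccontinuous f t) ->
  (forall t, u <= t <= v -> is_derive G t (g t)) ->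
  (forall t, u <= t <= v -> continuous g t) ->
  (forall t, u <= t <= v -> Cmod (f t) <= g t) ->
  exists l : C, is_CInt f u v l /\ Cmod l <= G v - G u.
Proof.
intros Huv Hf HG Hg Hb.
exists (CInt f u v). split.
- apply is_CInt_CInt. intros t Ht. rewrite Rmin_left, Rmax_right in Ht by lra. apply Hf; exact Ht.
- apply (is_CInt_Cmod_le f g u v); [exact Huv|exact Hb| |].
  + apply is_CInt_CInt. intros t Ht. rewrite Rmin_left, Rmax_right in Ht by lra. apply Hf; exact Ht.
  + apply (is_RInt_derive (V := R_CompleteNormedModule) G g); rewrite Rmin_left, Rmax_right by lra; assumption.
Qed.

(** Comparison test in which the majorant g is given through a primitive G with a finite limit along
    F; the increments of G supply Cauchy's criterion. Absolute values on these increments allow F to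
    approach either end of the interval, hence heads at 0 as well as tails. *)
Lemma CInt_dominated_gen (F : (R -> Prop) -> Prop) {FF : ProperFilter F} (f : R -> C) (G g : R -> R) (D : R -> Prop) (c L : R) :
  F D -> D c -> (forall u v t, D u -> D v -> u <= t <= v -> D t) ->
  filterlim G F (locally L) ->
  (forall t, D t -> ccontinuous f t) -> (forall t, D t -> is_derive G t (g t)) ->
  (forall t, D t -> continuous g t) -> (forall t, D t -> Cmod (f t) <= g t) ->
  exists l : C, F (fun b => ex_CInt f c b) /\ filterlim (fun b => CInt f c b) F (Clocally l) /\ Cmod l <= Rabs (L - G c).
Proof.
intros HD Dc Dconv HG Hf Hd Hg Hb.
assert (K : forall u v, D u -> D v -> exists l : C, is_CInt f u v l /\ Cmod l <= Rabs (G v - G u)).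
{ assert (K : forall u v, D u -> D v -> u <= v -> exists l : C, is_CInt f u v l /\ Cmod l <= Rabs (G v - G u)).
  { intros u v Du Dv Huv. destruct (is_CInt_dominated f G g u v Huv) as [l [H1 H2]];
      try (intros t Ht; first [apply Hf|apply Hd|apply Hg|apply Hb]; apply (Dconv u v); assumption).
    exists l; split; [exact H1|]. eapply Rle_trans; [exact H2|apply Rle_abs]. }
  intros u v Du Dv. destruct (Rle_dec u v) as [Huv|Huv]; [apply K; assumption|].
  destruct (K v u Dv Du ltac:(lra)) as [l [H1 H2]].
  exists (- l)%C. split; [apply (is_RInt_swap (V := C_R_NormedModule)); exact H1|].
  rewrite Cmod_opp, Rabs_minus_sym. exact H2. }
destruct (CInt_dominated_limit F f G D c L HD Dc HG K) as [l [H1 H2]].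
exists l; split; [|split; assumption].
revert HD; apply filter_imp. intros b Db. destruct (K c b Dc Db) as [l' [H' _]]. exists l'; exact H'.
Qed.

Lemma is_derive_Rpower (p t : R) : 0 < t -> is_derive (fun t => Rpower t p) t (p * Rpower t (p - 1)).
Proof.
intros Ht. unfold Rpower. auto_derive; [exact Ht|].
replace ((p - 1) * ln t) with (p * ln t + - ln t) by ring.
rewrite exp_plus, exp_Ropp, exp_ln by exact Ht. field. lra.
Qed.

Lemma continuous_Rpower (p t : R) : 0 < t -> continuous (fun t => Rpower t p) t.
Proof.
intros Ht. apply continuous_of_derive. eexists. apply is_derive_Rpower, Ht.
Qed.

Lemma Rpower_pos (t p : R) : 0 < Rpower t p.
Proof. apply exp_pos. Qed.

Lemma filterlim_Rpower_0 (p : R) : 0 < p -> filterlim (fun t => Rpower t p) (at_right 0) (locally 0).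
Proof.
intros Hp. apply filterlim_locally. intros [eps He].
assert (Hd : 0 < Rpower eps (/ p)) by apply Rpower_pos.
exists (mkposreal _ Hd). intros t Ht Ht0.
change (Rabs (t - 0) < Rpower eps (/ p)) in Ht. rewrite Rminus_0_r, Rabs_pos_eq in Ht by lra.
change (Rabs (Rpower t p - 0) < eps). rewrite Rminus_0_r, Rabs_pos_eq by (left; apply Rpower_pos).
replace eps with (Rpower (Rpower eps (/ p)) p).
- apply Rlt_Rpower_l; [exact Hp|]. split; [exact Ht0|exact Ht].
- rewrite Rpower_mult. replace (/ p * p) with 1 by (field; lra). apply Rpower_1; exact He.
Qed.

Lemma filterlim_Rpower_infty (p : R) : p < 0 -> filterlim (fun t => Rpower t p) (Rbar_locally p_infty) (locally 0).
Proof.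
intros Hp. apply filterlim_locally. intros [eps He].
exists (Rpower eps (/ p)). intros t Ht.
assert (Hd : 0 < Rpower eps (/ p)) by apply Rpower_pos.
change (Rabs (Rpower t p - 0) < eps). rewrite Rminus_0_r, Rabs_pos_eq by (left; apply Rpower_pos).
assert (A : Rpower (Rpower eps (/ p)) (- p) < Rpower t (- p)) by (apply Rlt_Rpower_l; lra).
rewrite Rpower_mult in A. replace (/ p * - p) with (- (1)) in A by (field; lra).
rewrite !Rpower_Ropp, Rpower_1 in A by exact He.
apply Rinv_lt_cancel; [exact He|exact A].
Qed.

Lemma at_right_0_le (r : R) : 0 < r -> at_right 0 (fun t => 0 < t <= r).
Proof.
intros Hr. exists (mkposreal r Hr). intros t Ht Ht0.
change (Rabs (t - 0) < r) in Ht. rewrite Rminus_0_r, Rabs_pos_eq in Ht by lra. lra.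
Qed.

Lemma head_integral (f : R -> C) (r M tau : R) :
  0 < r -> tau < 1 ->
  (forall t, 0 < t <= r -> ccontinuous f t) ->
  (forall t, 0 < t <= r -> Cmod (f t) <= M * Rpower t (- tau)) ->
  exists l : C, is_CInt_gen f (at_right 0) (at_point r) l /\ Cmod l <= M * (Rpower r (1 - tau) / (1 - tau)).
Proof.
intros Hr Ht Hf Hb.
destruct (CInt_dominated_gen (at_right 0) f (fun t => M * (Rpower t (1 - tau) / (1 - tau)))
   (fun t => M * Rpower t (- tau)) (fun t => 0 < t <= r) r (M * (0 / (1 - tau)))) as [l [H1 [H2 H3]]].
- apply at_right_0_le; exact Hr.
- lra.
- intros; lra.
- apply (filterlim_comp _ _ _ (fun t => Rpower t (1 - tau)) (fun y => M * (y / (1 - tau))) _ (locally 0)).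
  + apply filterlim_Rpower_0. lra.
  + apply (continuous_of_derive (fun y => M * (y / (1 - tau)))). auto_derive. lra.
- exact Hf.
- intros t Ht0. replace (M * Rpower t (- tau)) with (M * (((1 - tau) * Rpower t ((1 - tau) - 1)) * / (1 - tau))).
  2:{ replace (1 - tau - 1) with (- tau) by ring. field. lra. }
  apply (is_derive_scal (fun t => Rpower t (1 - tau) / (1 - tau))). 
  apply (is_derive_ext (fun t => / (1 - tau) * Rpower t (1 - tau))); [intros; apply Rmult_comm|].
  rewrite Rmult_comm. apply (is_derive_scal (fun t => Rpower t (1 - tau))). apply is_derive_Rpower. lra.
- intros t Ht0. apply (continuous_scal_r (V := R_NormedModule) M (fun t => Rpower t (- tau))). apply continuous_Rpower; lra.
- exact Hb.
(* The comparison was made for integrals from r down to 0, so the orientation is reversed here. *)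
- exists (- l)%C. split.
  + apply (is_RInt_gen_swap (V := C_R_NormedModule)). apply is_CInt_gen_right; [apply at_right_proper_filter|exact H1|exact H2].
  + rewrite Cmod_opp. eapply Rle_trans; [exact H3|]. right.
    replace (M * (0 / (1 - tau)) - M * (Rpower r (1 - tau) / (1 - tau))) with (- (M * (Rpower r (1 - tau) / (1 - tau)))) by (field; lra).
    rewrite Rabs_Ropp. apply Rabs_pos_eq.
    apply Rmult_le_pos; [|apply Rdiv_le_0_compat; [left; apply Rpower_pos|lra]].
    assert (A := Hb r ltac:(lra)). assert (B := Cmod_ge_0 (f r)). assert (D := Rpower_pos r (- tau)). nra.
Qed.

Lemma tail_integral (f : R -> C) (r M tau : R) :
  0 < r -> 1 < tau ->
  (forall t, r <= t -> ccontinuous f t) ->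
  (forall t, r <= t -> Cmod (f t) <= M * Rpower t (- tau)) ->
  exists l : C, is_CInt_gen f (at_point r) (Rbar_locally p_infty) l /\ Cmod l <= M * (Rpower r (1 - tau) / (tau - 1)).
Proof.
intros Hr Ht Hf Hb.
destruct (CInt_dominated_gen (Rbar_locally p_infty) f (fun t => M * (Rpower t (1 - tau) / (1 - tau)))
   (fun t => M * Rpower t (- tau)) (fun t => r <= t) r (M * (0 / (1 - tau)))) as [l [H1 [H2 H3]]].
- exists r. intros t Hrt. lra.
- lra.
- intros; lra.
- apply (filterlim_comp _ _ _ (fun t => Rpower t (1 - tau)) (fun y => M * (y / (1 - tau))) _ (locally 0)).
  + apply filterlim_Rpower_infty. lra.
  + apply (continuous_of_derive (fun y => M * (y / (1 - tau)))). auto_derive. lra.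
- exact Hf.
- intros t Ht0. replace (M * Rpower t (- tau)) with (M * (((1 - tau) * Rpower t ((1 - tau) - 1)) * / (1 - tau))).
  2:{ replace (1 - tau - 1) with (- tau) by ring. field. lra. }
  apply (is_derive_scal (fun t => Rpower t (1 - tau) / (1 - tau))). 
  apply (is_derive_ext (fun t => / (1 - tau) * Rpower t (1 - tau))); [intros; apply Rmult_comm|].
  rewrite Rmult_comm. apply (is_derive_scal (fun t => Rpower t (1 - tau))). apply is_derive_Rpower. lra.
- intros t Ht0. apply (continuous_scal_r (V := R_NormedModule) M (fun t => Rpower t (- tau))). apply continuous_Rpower; lra.
- exact Hb.
- exists l. split.
  + apply is_CInt_gen_right; [apply Rbar_locally_filter|exact H1|exact H2].
  + eapply Rle_trans; [exact H3|]. right.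
    replace (M * (0 / (1 - tau)) - M * (Rpower r (1 - tau) / (1 - tau))) with (M * (Rpower r (1 - tau) / (tau - 1))) by (field; lra).
    apply Rabs_pos_eq.
    apply Rmult_le_pos; [|apply Rdiv_le_0_compat; [left; apply Rpower_pos|lra]].
    assert (A := Hb r ltac:(lra)). assert (B := Cmod_ge_0 (f r)). assert (D := Rpower_pos r (- tau)). nra.
Qed.

Lemma exp_le_mono (x y : R) : x <= y -> exp x <= exp y.
Proof. intros [H|<-]; [left; apply exp_increasing; exact H|lra]. Qed.

Lemma exp_pow_INR (x : R) (n : nat) : exp x ^ n = exp (INR n * x).
Proof.
induction n as [|n IH]; [simpl; rewrite Rmult_0_l, exp_0; reflexivity|].
rewrite S_INR. simpl. rewrite IH, <- exp_plus. f_equal. ring.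
Qed.

Lemma pow_le_exp (n : nat) (delta : R) : 0 < delta -> exists K, 0 < K /\ forall x, 0 <= x -> x ^ n <= K * exp (delta * x).
Proof.
intros Hd. destruct (Nat.eq_dec n 0) as [->|Hn].
- exists 1. split; [lra|]. intros x Hx. simpl. assert (1 <= exp (delta * x)); [|lra].
  rewrite <- exp_0. destruct (Rle_lt_or_eq_dec 0 (delta * x)) as [H|<-]; [apply Rmult_le_pos; lra| |lra].
  left; apply exp_increasing; exact H.
- assert (Hn' : 0 < INR n) by (apply lt_0_INR; lia).
  (* The n-th power of y <= e^y at y = delta x / n. *)
  exists ((INR n / delta) ^ n). split; [apply pow_lt, Rdiv_lt_0_compat; lra|].
  intros x Hx.
  replace (exp (delta * x)) with ((exp (delta * x / INR n)) ^ n).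
  + rewrite <- Rpow_mult_distr. apply pow_incr. split; [exact Hx|].
    assert (A : delta * x / INR n <= exp (delta * x / INR n)).
    { generalize (exp_ineq1_le (delta * x / INR n)); lra. }
    apply Rmult_le_reg_l with (delta / INR n); [apply Rdiv_lt_0_compat; lra|].
    replace (delta / INR n * (INR n / delta * exp (delta * x / INR n))) with (exp (delta * x / INR n)) by (field; lra).
    eapply Rle_trans; [|exact A]. right; field; lra.
  + rewrite exp_pow_INR. f_equal. field; lra.
Qed.

(** * Powers and logarithms *)

Lemma Cpowc_pos (t : R) (s : C) : 0 < t -> Cpowc (RtoC t) s = Cexp (s * RtoC (ln t)).
Proof.
intros Ht. unfold Cpowc, Log. do 2 f_equal.
rewrite Cmod_R, Rabs_pos_eq by lra. unfold Arg.
replace (Re (RtoC t)) with t by reflexivity. replace (Im (RtoC t)) with 0 by reflexivity.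
rewrite Cmod_R, Rabs_pos_eq by lra. replace (t / t) with 1 by (field; lra). rewrite acos_1.
destruct (Rle_dec 0 0); [reflexivity|lra].
Qed.

Lemma Cpowc_pos_neq_0 (t : R) (s : C) : 0 < t -> Cpowc (RtoC t) s <> 0.
Proof. intros _. apply Cexp_neq_0. Qed.

Lemma Cmod_Cpowc_pos (t : R) (s : C) : 0 < t -> Cmod (Cpowc (RtoC t) s) = Rpower t (Re s).
Proof.
intros Ht. rewrite Cpowc_pos by exact Ht. rewrite Cmod_Cexp. unfold Rpower. f_equal. rewrite re_scal_r. reflexivity.
Qed.

Lemma Cpowc_pos_plus (t : R) (s s' : C) : 0 < t -> Cpowc (RtoC t) (s + s') = (Cpowc (RtoC t) s * Cpowc (RtoC t) s')%C.
Proof. intros Ht. rewrite !Cpowc_pos by exact Ht. rewrite <- Cexp_plus. f_equal. ring. Qed.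

Lemma Cpowc_pos_INR (t : R) (m : nat) : 0 < t -> Cpowc (RtoC t) (RtoC (INR m)) = (RtoC t ^ m)%C.
Proof.
intros Ht. rewrite Cpowc_pos by exact Ht. rewrite Cexp_INR_mult, Cexp_RtoC, exp_ln by exact Ht. reflexivity.
Qed.

Lemma is_cderive_ln (t : R) : 0 < t -> is_cderive (fun t => RtoC (ln t)) t (/ RtoC t)%C.
Proof.
intros Ht. rewrite <- RtoC_inv by lra. apply is_cderive_RtoC. auto_derive; [exact Ht|field; lra].
Qed.

Lemma is_cderive_Cpowc (t : R) (s : C) : 0 < t -> is_cderive (fun t => Cpowc (RtoC t) s) t (s * Cpowc (RtoC t) s / RtoC t)%C.
Proof.
intros Ht. apply (is_derive_ext_loc (fun t => Cexp (s * RtoC (ln t)))).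
- exists (mkposreal t Ht). intros y Hy. symmetry. apply Cpowc_pos.
  change (Rabs (y - t) < t) in Hy. apply Rabs_lt_between in Hy. lra.
- rewrite Cpowc_pos by exact Ht. eapply is_cderive_eq.
  + apply is_cderive_exp, is_cderive_mult; [apply is_cderive_const|apply is_cderive_ln, Ht].
  + cbv beta. unfold Cdiv. ring.
Qed.

Lemma continuous_Cpowc (t : R) (s : C) : 0 < t -> ccontinuous (fun t => Cpowc (RtoC t) s) t.
Proof. intros Ht. eapply is_cderive_continuous, is_cderive_Cpowc, Ht. Qed.

Lemma continuous_Cln (t : R) : 0 < t -> ccontinuous (fun t => RtoC (ln t)) t.
Proof. intros Ht. eapply is_cderive_continuous, is_cderive_ln, Ht. Qed.

Lemma continuous_CRtoC (t : R) : ccontinuous RtoC t.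
Proof. eapply is_cderive_continuous, is_cderive_id. Qed.

Lemma Rabs_ln_le_exp (t delta : R) : 0 < t -> 0 < delta -> exp (delta * Rabs (ln t)) <= Rpower t delta + Rpower t (- delta).
Proof.
intros Ht Hd. unfold Rpower. unfold Rabs. destruct (Rcase_abs (ln t)).
- replace (delta * - ln t) with (- delta * ln t) by ring. generalize (exp_pos (delta * ln t)); lra.
- generalize (exp_pos (- delta * ln t)); lra.
Qed.

Lemma ln_pow_head (r delta : R) (n : nat) : 0 < r -> 0 < delta ->
  exists K, 0 < K /\ forall t, 0 < t <= r -> Rabs (ln t) ^ n <= K * Rpower t (- delta).
Proof.
intros Hr Hd. destruct (pow_le_exp n delta Hd) as [K [HK H]].
(* From e^(delta |ln t|) <= t^delta + t^(-delta), where t^delta <= r^(2 delta) t^(-delta) on (0,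
   r]. *)
exists (K * (Rpower r (2 * delta) + 1)). split; [apply Rmult_lt_0_compat; [exact HK|generalize (Rpower_pos r (2 * delta)); lra]|].
intros t Ht. eapply Rle_trans; [apply H, Rabs_pos|]. rewrite Rmult_assoc. apply Rmult_le_compat_l; [lra|].
eapply Rle_trans; [apply Rabs_ln_le_exp; lra|].
rewrite Rmult_plus_distr_r, Rmult_1_l. apply Rplus_le_compat_r.
replace delta with (2 * delta + - delta) at 1 by ring. rewrite Rpower_plus.
apply Rmult_le_compat_r; [left; apply Rpower_pos|]. apply Rle_Rpower_l; lra.
Qed.

Lemma ln_pow_tail (r delta : R) (n : nat) : 0 < r -> 0 < delta ->
  exists K, 0 < K /\ forall t, r <= t -> Rabs (ln t) ^ n <= K * Rpower t delta.
Proof.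
intros Hr Hd. destruct (pow_le_exp n delta Hd) as [K [HK H]].
exists (K * (1 + Rpower r (- (2 * delta)))). split; [apply Rmult_lt_0_compat; [exact HK|generalize (Rpower_pos r (- (2 * delta))); lra]|].
intros t Ht. eapply Rle_trans; [apply H, Rabs_pos|]. rewrite Rmult_assoc. apply Rmult_le_compat_l; [lra|].
eapply Rle_trans; [apply Rabs_ln_le_exp; lra|].
rewrite Rmult_plus_distr_r, Rmult_1_l. apply Rplus_le_compat_l.
replace (- delta) with (- (2 * delta) + delta) at 1 by ring. rewrite Rpower_plus.
apply Rmult_le_compat_r; [left; apply Rpower_pos|].
rewrite !Rpower_Ropp. apply Rinv_le_contravar; [apply Rpower_pos|]. apply Rle_Rpower_l; lra.
Qed.

Definition log_weight (n : nat) (nu : C) (t : R) : C := (RtoC (ln t) ^ n / Cpowc (RtoC t) nu)%C.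

Lemma continuous_log_weight (n : nat) (nu : C) (t : R) : 0 < t -> ccontinuous (log_weight n nu) t.
Proof.
intros Ht. apply continuous_Cmult; [apply continuous_Cpow, continuous_Cln, Ht|].
apply continuous_Cinv; [apply continuous_Cpowc, Ht|apply Cpowc_pos_neq_0, Ht].
Qed.

Lemma Cmod_log_weight (n : nat) (nu : C) (t : R) : 0 < t ->
  Cmod (log_weight n nu t) = Rabs (ln t) ^ n * Rpower t (- Re nu).
Proof.
intros Ht. unfold log_weight. rewrite Cmod_div by (apply Cpowc_pos_neq_0, Ht).
rewrite Cmod_pow, Cmod_R, Cmod_Cpowc_pos by exact Ht. rewrite Rpower_Ropp. reflexivity.
Qed.

(** Half of the gap 1 - Re nu absorbs the logarithms. K is chosen before chi: one constant serves
    the whole sequence of Taylor remainders, whose bounds B are geometric in the index. *)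
Lemma head_log (n : nat) (nu : C) (r : R) : 0 < r -> Re nu < 1 ->
  exists K, 0 < K /\ forall (chi : R -> C) (B : R),
   (forall t, 0 < t <= r -> ccontinuous chi t) -> (forall t, 0 < t <= r -> Cmod (chi t) <= B) ->
   exists l : C, is_CInt_gen (fun t => chi t * log_weight n nu t)%C (at_right 0) (at_point r) l /\ Cmod l <= K * B.
Proof.
intros Hr Hnu. set (delta := (1 - Re nu) / 2). assert (Hd : 0 < delta) by (unfold delta; lra).
destruct (ln_pow_head r delta n Hr Hd) as [K [HK H]].
set (tau := Re nu + delta). assert (Ht : tau < 1) by (unfold tau, delta; lra).
exists (K * (Rpower r (1 - tau) / (1 - tau))). split.
{ apply Rmult_lt_0_compat; [exact HK|]. apply Rdiv_lt_0_compat; [apply Rpower_pos|lra]. }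
intros chi B Hc Hb.
destruct (head_integral (fun t => chi t * log_weight n nu t)%C r (K * B) tau Hr Ht) as [l [H1 H2]].
- intros t Ht0. apply continuous_Cmult; [apply Hc; exact Ht0|apply continuous_log_weight; lra].
- intros t Ht0. rewrite Cmod_mult, Cmod_log_weight by lra.
  rewrite (Rmult_comm K B), Rmult_assoc. apply Rmult_le_compat; [apply Cmod_ge_0| |apply Hb; exact Ht0|].
  + apply Rmult_le_pos; [apply pow_le, Rabs_pos|left; apply Rpower_pos].
  + unfold tau. replace (- (Re nu + delta)) with (- delta + - Re nu) by ring. rewrite Rpower_plus, <- Rmult_assoc.
    apply Rmult_le_compat_r; [left; apply Rpower_pos|apply H; exact Ht0].
- exists l; split; [exact H1|]. eapply Rle_trans; [exact H2|]. right; ring.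
Qed.

(** At infinity t^(-nu) alone is not integrable, so chi must bring a factor 1/t; half of Re nu pays
    for the logarithms. Again K is uniform in chi. *)
Lemma tail_log (n : nat) (nu : C) (r : R) : 0 < r -> 0 < Re nu ->
  exists K, 0 < K /\ forall (chi : R -> C) (B : R),
   (forall t, r <= t -> ccontinuous chi t) -> (forall t, r <= t -> Cmod (chi t) <= B / t) ->
   exists l : C, is_CInt_gen (fun t => chi t * log_weight n nu t)%C (at_point r) (Rbar_locally p_infty) l /\ Cmod l <= K * B.
Proof.
intros Hr Hnu. set (delta := Re nu / 2). assert (Hd : 0 < delta) by (unfold delta; lra).
destruct (ln_pow_tail r delta n Hr Hd) as [K [HK H]].
set (tau := 1 + delta). assert (Ht : 1 < tau) by (unfold tau, delta; lra).
exists (K * (Rpower r (1 - tau) / (tau - 1))). split.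
{ apply Rmult_lt_0_compat; [exact HK|]. apply Rdiv_lt_0_compat; [apply Rpower_pos|lra]. }
intros chi B Hc Hb.
destruct (tail_integral (fun t => chi t * log_weight n nu t)%C r (K * B) tau Hr Ht) as [l [H1 H2]].
- intros t Ht0. apply continuous_Cmult; [apply Hc; exact Ht0|apply continuous_log_weight; lra].
- intros t Ht0. rewrite Cmod_mult, Cmod_log_weight by lra.
  replace (Rpower t (- tau)) with (/ t * Rpower t (- delta)).
  2:{ unfold tau. replace (- (1 + delta)) with (- (1) + - delta) by ring. rewrite Rpower_plus, (Rpower_Ropp t 1), Rpower_1 by lra. reflexivity. }
  replace (K * B * (/ t * Rpower t (- delta))) with (B / t * (K * Rpower t (- delta))) by (unfold Rdiv; ring).
  apply Rmult_le_compat; [apply Cmod_ge_0| |apply Hb; exact Ht0|].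
  + apply Rmult_le_pos; [apply pow_le, Rabs_pos|left; apply Rpower_pos].
  + replace (- delta) with (delta + - Re nu) by (unfold delta; field). rewrite Rpower_plus, <- Rmult_assoc.
    apply Rmult_le_compat_r; [left; apply Rpower_pos|apply H; exact Ht0].
- exists l; split; [exact H1|]. eapply Rle_trans; [exact H2|]. right; ring.
Qed.

(** The half-line [0, oo) stays at positive distance from -e^beta: either e^beta has a nonzero
    imaginary part, or Im beta = 0 and e^beta is positive. The triangle inequality then improves a
    constant lower bound to a linear one. *)
Lemma Cexp_slit (beta : C) : Rabs (Im beta) < PI ->
  exists m, 0 < m /\ forall t, 0 <= t -> m * (1 + t) <= Cmod (Cexp beta + RtoC t).
Proof.
intros Hb. set (w := Cexp beta).
assert (L : exists m, 0 < m /\ forall t, 0 <= t -> m <= Cmod (w + RtoC t)).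
{ destruct (Req_dec (sin (Im beta)) 0) as [Hs|Hs].
  - assert (H0 : Im beta = 0).
    { apply Rabs_lt_between in Hb. destruct (Rtotal_order (Im beta) 0) as [H|[H|H]]; [exfalso|exact H|exfalso].
      - assert (A := sin_gt_0 (- Im beta) ltac:(lra) ltac:(lra)). rewrite sin_neg in A. lra.
      - assert (A := sin_gt_0 (Im beta) ltac:(lra) ltac:(lra)). lra. }
    exists (exp (Re beta)). split; [apply exp_pos|]. intros t Ht.
    eapply Rle_trans; [|apply re_le_Cmod].
    replace (Re (w + RtoC t)%C) with (exp (Re beta) + t).
    + rewrite Rabs_pos_eq; generalize (exp_pos (Re beta)); lra.
    + unfold w, Cexp. simpl. rewrite H0, cos_0. ring.
  - exists (Rabs (Im w)). split.
    + apply Rabs_pos_lt. unfold w, Cexp; simpl. apply Rmult_integral_contrapositive_currified; [generalize (exp_pos (Re beta)); lra|exact Hs].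
    + intros t Ht. assert (A := Rmax_Cmod (w + RtoC t)%C). eapply Rle_trans; [|exact A].
      eapply Rle_trans; [|apply Rmax_r]. right. f_equal. change (Im w = Im (w + RtoC t)%C). rewrite im_plus, im_RtoC. ring. }
destruct L as [m [Hm H]].
assert (W := Cmod_ge_0 w).
(* From |w + t| >= m follow 1 <= |w + t| / m and |w| <= (|w| / m) |w + t|, and t <= |w + t| + |w|;
   the sum of these bounds is 1 + t <= A |w + t|. *)
set (A := 1 / m + 1 + Cmod w / m).
assert (HA : 0 < A).
{ unfold A. assert (0 <= Cmod w / m) by (apply Rdiv_le_0_compat; lra). assert (0 < 1 / m) by (apply Rdiv_lt_0_compat; lra). lra. }
exists (/ A). split; [apply Rinv_0_lt_compat; exact HA|].
intros t Ht. specialize (H t Ht).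
apply Rmult_le_reg_l with A; [exact HA|]. rewrite <- Rmult_assoc, Rinv_r, Rmult_1_l by lra.
assert (T : t <= Cmod (w + RtoC t) + Cmod w).
{ replace t with (Cmod (RtoC t)) at 1 by (rewrite Cmod_R, Rabs_pos_eq; lra).
  replace (RtoC t) with ((w + RtoC t) + - w)%C at 1 by ring. eapply Rle_trans; [apply Cmod_triangle|]. rewrite Cmod_opp. lra. }
unfold A. set (X := Cmod (w + RtoC t)) in *.
assert (1 <= 1 / m * X).
{ apply Rmult_le_reg_l with m; [exact Hm|]. replace (m * (1 / m * X)) with X by (field; lra). lra. }
assert (Cmod w <= Cmod w / m * X).
{ replace (Cmod w / m * X) with (Cmod w * (1 / m * X)) by (unfold Rdiv; ring). rewrite <- (Rmult_1_r (Cmod w)) at 1. apply Rmult_le_compat_l; assumption. }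
lra.
Qed.

Lemma cos_Arg_sin_Arg (w : C) : w <> 0 -> Cmod w * cos (Arg w) = Re w /\ Cmod w * sin (Arg w) = Im w.
Proof.
intros Hw. apply Cmod_gt_0 in Hw.
set (x := Re w / Cmod w).
assert (H2 := Cmod2_alt w).
assert (Hx : -1 <= x <= 1).
{ assert (A := re_le_Cmod w). apply Rabs_le_between in A. unfold x. split.
  - apply Rmult_le_reg_r with (Cmod w); [exact Hw|]. unfold Rdiv. rewrite Rmult_assoc, Rinv_l by lra. lra.
  - apply Rmult_le_reg_r with (Cmod w); [exact Hw|]. unfold Rdiv. rewrite Rmult_assoc, Rinv_l by lra. lra. }
assert (Hs : Cmod w * sqrt (1 - x²) = Rabs (Im w)).
{ rewrite <- (Rabs_pos_eq (Cmod w)) by lra. rewrite <- sqrt_Rsqr_abs, <- sqrt_mult_alt by apply Rle_0_sqr.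
  rewrite <- sqrt_Rsqr_abs. f_equal. unfold Rsqr, x. field_simplify; [|lra]. simpl in H2. nra. }
unfold Arg. fold x. destruct (Rle_dec 0 (Im w)) as [Hi|Hi].
- rewrite cos_acos, sin_acos by exact Hx. split; [unfold x; field; lra|]. rewrite Hs. apply Rabs_pos_eq, Hi.
- rewrite cos_neg, sin_neg, cos_acos, sin_acos by exact Hx. split; [unfold x; field; lra|].
  rewrite Ropp_mult_distr_r_reverse, Hs. rewrite Rabs_left by lra. ring.
Qed.

Lemma Cexp_Log (w : C) : w <> 0 -> Cexp (Log w) = w.
Proof.
intros Hw. destruct (cos_Arg_sin_Arg w Hw) as [H1 H2].
assert (Hw' := proj1 (Cmod_gt_0 w) Hw).
apply C_ext; unfold Cexp, Log; simpl; rewrite exp_ln by exact Hw'; assumption.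
Qed.

Notation ones := (fun _ : R => RtoC 1).

Lemma stieltjes_log_weight (k : R -> C) (n : nat) (nu w : C) (t : R) :
  0 < t -> (w + RtoC t)%C <> 0 ->
  stieltjes_integrand k n nu w t = (k t / (w + RtoC t) * log_weight n nu t)%C.
Proof.
intros Ht Hw. unfold stieltjes_integrand, log_weight. assert (H := Cpowc_pos_neq_0 t nu Ht). field. split; assumption.
Qed.

Lemma slit_neq_0 (w : C) (m : R) : 0 < m -> (forall t, 0 <= t -> m * (1 + t) <= Cmod (w + RtoC t)) ->
  forall t, 0 <= t -> (w + RtoC t)%C <> 0.
Proof.
intros Hm H t Ht E. specialize (H t Ht). rewrite E, Cmod_0 in H. assert (0 < m * (1 + t)) by (apply Rmult_lt_0_compat; lra). lra.
Qed.

Lemma continuous_slit_inv (w : C) (t : R) : (w + RtoC t)%C <> 0 -> ccontinuous (fun t => / (w + RtoC t))%C t.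
Proof.
intros H. apply continuous_Cinv; [|exact H]. apply continuous_Cplus; [apply continuous_Cconst|apply continuous_CRtoC].
Qed.

Lemma is_CInt_gen_ext_pos (f g : R -> C) (Fa Fb : (R -> Prop) -> Prop) {FFa : Filter Fa} {FFb : Filter Fb} (l : C) :
  Fa (fun a => 0 <= a) -> Fb (fun b => 0 <= b) -> (forall t, 0 < t -> f t = g t) ->
  is_CInt_gen f Fa Fb l -> is_CInt_gen g Fa Fb l.
Proof.
intros Ha Hb H. apply (CInt_gen_ext).
apply (Filter_prod _ _ _ _ _ Ha Hb). intros a b H1 H2 t [Ht _]. apply H. simpl in Ht.
eapply Rle_lt_trans; [|exact Ht]. apply Rmin_glb; assumption.
Qed.

Lemma at_right_0_nonneg : at_right 0 (fun t => 0 <= t).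
Proof. generalize (at_right_0_le 1 Rlt_0_1). apply filter_imp. intros; lra. Qed.

Lemma p_infty_nonneg : Rbar_locally p_infty (fun t => 0 <= t).
Proof. exists 0. intros; lra. Qed.

Lemma log_stieltjes_ex (n : nat) (nu beta : C) : 0 < Re nu < 1 -> Rabs (Im beta) < PI ->
  ex_int0 p_infty (stieltjes_integrand ones n nu (Cexp beta)).
Proof.
intros Hnu Hb. destruct (Cexp_slit beta Hb) as [m [Hm H]].
set (w := Cexp beta) in *.
assert (N := slit_neq_0 w m Hm H).
destruct (head_log n nu 1 Rlt_0_1 (proj2 Hnu)) as [K1 [_ H1]].
destruct (tail_log n nu 1 Rlt_0_1 (proj1 Hnu)) as [K2 [_ H2]].
assert (Hinv : forall t, 0 <= t -> Cmod (/ (w + RtoC t)) <= / m * / (1 + t)).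
{ intros t Ht. rewrite Cmod_inv by (apply N; lra). rewrite <- Rinv_mult. apply Rinv_le_contravar; [apply Rmult_lt_0_compat; lra|apply H; exact Ht]. }
assert (Hm' : 0 < / m) by (apply Rinv_0_lt_compat; exact Hm).
destruct (H1 (fun t => / (w + RtoC t))%C (/ m)) as [l1 [L1 _]].
{ intros t Ht. apply continuous_slit_inv, N; lra. }
{ intros t Ht. eapply Rle_trans; [apply Hinv; lra|]. rewrite <- (Rmult_1_r (/ m)) at 2. apply Rmult_le_compat_l; [lra|].
  rewrite <- Rinv_1. apply Rinv_le_contravar; lra. }
destruct (H2 (fun t => / (w + RtoC t))%C (/ m)) as [l2 [L2 _]].
{ intros t Ht. apply continuous_slit_inv, N; lra. }
{ intros t Ht. eapply Rle_trans; [apply Hinv; lra|]. apply Rmult_le_compat_l; [lra|]. apply Rinv_le_contravar; lra. }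
exists (plus (G := C_R_NormedModule) l1 l2).
apply (is_CInt_gen_ext_pos (fun t => / (w + RtoC t) * log_weight n nu t)%C).
- apply at_right_proper_filter.
- apply Rbar_locally_filter.
- apply at_right_0_nonneg.
- apply p_infty_nonneg.
- intros t Ht. rewrite stieltjes_log_weight by (try apply N; lra). unfold Cdiv. ring.
- apply (CInt_gen_Chasles _ 1); assumption.
Qed.

(** * The integral of t^(-nu) ln^n t / (w + t) over the half-line *)

(** The integrand of the moments at w = 1 after t = e^x, extended to the strip |Im z| < PI; the
    denominator first vanishes at z = i PI and z = -i PI. *)
Definition phi (n : nat) (nu z : C) : C := (z ^ n * Cexp ((1 - nu) * z) / (1 + Cexp z))%C.

Definition dphi (n : nat) (nu z : C) : C :=
  ((cnat n * z ^ pred n + z ^ n * (1 - nu)) * Cexp ((1 - nu) * z) / (1 + Cexp z)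
   - z ^ n * Cexp ((1 - nu) * z) * Cexp z / ((1 + Cexp z) * (1 + Cexp z)))%C.

Lemma strip_neq_0 (z : C) : Rabs (Im z) < PI -> (1 + Cexp z)%C <> 0.
Proof.
intros Hz. destruct (Cexp_slit z Hz) as [m [Hm H]]. rewrite Cplus_comm. apply (slit_neq_0 _ m Hm H 1). lra.
Qed.

Lemma is_cderive_phi (n : nat) (nu : C) (p : R -> C) (t : R) (d : C) :
  Rabs (Im (p t)) < PI -> is_cderive p t d -> is_cderive (fun t => phi n nu (p t)) t (dphi n nu (p t) * d)%C.
Proof.
intros Hz Hp. assert (N := strip_neq_0 _ Hz). unfold phi. eapply is_cderive_eq.
- apply is_cderive_mult; [apply is_cderive_mult; [apply is_cderive_pow; exact Hp|]|].
  + apply is_cderive_exp, is_cderive_mult; [apply is_cderive_const|exact Hp].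
  + apply (is_cderive_inv (fun t => 1 + Cexp (p t))%C); [|exact N]. apply is_cderive_plus; [apply is_cderive_const|apply is_cderive_exp; exact Hp].
- cbv beta. unfold dphi. field. exact N.
Qed.

Lemma continuous_phi {T : UniformSpace} (n : nat) (nu : C) (p : T -> C) (t : T) :
  Rabs (Im (p t)) < PI -> ccontinuous p t -> ccontinuous (fun t => phi n nu (p t)) t.
Proof.
intros Hz Hp. assert (N := strip_neq_0 _ Hz). unfold phi.
apply continuous_Cmult; [apply continuous_Cmult; [apply continuous_Cpow; exact Hp|]|].
- apply continuous_Cexp, continuous_Cmult; [apply continuous_Cconst|exact Hp].
- apply continuous_Cinv; [|exact N]. apply continuous_Cplus; [apply continuous_Cconst|apply continuous_Cexp; exact Hp].
Qed.

Lemma continuous_dphi {T : UniformSpace} (n : nat) (nu : C) (p : T -> C) (t : T) :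
  Rabs (Im (p t)) < PI -> ccontinuous p t -> ccontinuous (fun t => dphi n nu (p t)) t.
Proof.
intros Hz Hp. assert (N := strip_neq_0 _ Hz). unfold dphi.
assert (E : ccontinuous (fun t => Cexp ((1 - nu) * p t))%C t) by (apply continuous_Cexp, continuous_Cmult; [apply continuous_Cconst|exact Hp]).
assert (D : ccontinuous (fun t => 1 + Cexp (p t))%C t) by (apply continuous_Cplus; [apply continuous_Cconst|apply continuous_Cexp; exact Hp]).
apply continuous_Cplus; [|apply continuous_Copp]; apply continuous_Cmult.
- apply continuous_Cmult; [|exact E]. apply continuous_Cplus.
  + apply continuous_Cmult; [apply continuous_Cconst|apply continuous_Cpow; exact Hp].
  + apply continuous_Cmult; [apply continuous_Cpow; exact Hp|apply continuous_Cconst].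
- apply continuous_Cinv; [exact D|exact N].
- apply continuous_Cmult; [apply continuous_Cmult; [apply continuous_Cpow; exact Hp|exact E]|apply continuous_Cexp; exact Hp].
- apply continuous_Cinv; [apply continuous_Cmult; exact D|]. apply Cmult_neq_0; exact N.
Qed.

Lemma C_decomp (z : C) : z = (RtoC (Re z) + RtoC (Im z) * Ci)%C.
Proof. destruct z; unfold RtoC, Ci, Cplus, Cmult; simpl; f_equal; ring. Qed.

(** For |Re z| >= 1 the modulus of e^z is at least 2 or at most 1/2, so 1 + e^z stays away from 0 on
    the closed strip. The quotient decays with rate min(Re nu, 1 - Re nu), and half of that rate is
    spent on the factor z^n. *)
Lemma phi_decay (n : nat) (nu : C) : 0 < Re nu < 1 ->
  exists K kappa, 0 < K /\ 0 < kappa /\ forall z, Rabs (Im z) <= PI -> 1 <= Rabs (Re z) ->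
    Cmod (phi n nu z) <= K * exp (- kappa * Rabs (Re z)).
Proof.
intros Hnu. set (ka := Rmin (Re nu) (1 - Re nu)).
assert (Hka : 0 < ka) by (apply Rmin_pos; lra).
assert (Hka1 : ka <= Re nu) by apply Rmin_l. assert (Hka2 : ka <= 1 - Re nu) by apply Rmin_r.
destruct (pow_le_exp n (ka / 2) ltac:(lra)) as [K [HK HP]].
exists (K * exp (ka / 2 * PI) * (exp (Rabs (Im nu) * PI) * 2)), (ka / 2).
split; [repeat apply Rmult_lt_0_compat; try apply exp_pos; lra|split; [lra|]].
intros z Hi Hr. set (x := Rabs (Re z)) in *.
assert (E2 : 2 <= exp 1) by (generalize (exp_ineq1_le 1); lra).
assert (D : exp ((1 - Re nu) * Re z) * exp (ka * x) <= 2 * Cmod (1 + Cexp z)).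
{ unfold x, Rabs. destruct (Rcase_abs (Re z)) as [H|H].
  - unfold x, Rabs in Hr. destruct (Rcase_abs (Re z)); [|lra].
    assert (A : exp (Re z) <= / 2).
    { replace (Re z) with (- - Re z) by ring. rewrite exp_Ropp. apply Rinv_le_contravar; [lra|].
      eapply Rle_trans; [exact E2|]. apply exp_le_mono; lra. }
    assert (B : / 2 <= Cmod (1 + Cexp z)).
    { assert (T := Cmod_triangle (1 + Cexp z) (- Cexp z)). replace (1 + Cexp z + - Cexp z)%C with (RtoC 1) in T by ring.
      rewrite Cmod_1, Cmod_opp, Cmod_Cexp in T. lra. }
    rewrite <- exp_plus. apply Rle_trans with (exp 0).
    + apply exp_le_mono; nra.
    + rewrite exp_0. lra.
  - unfold x, Rabs in Hr. destruct (Rcase_abs (Re z)); [lra|].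
    assert (A : 2 <= exp (Re z)).
    { eapply Rle_trans; [exact E2|]. apply exp_le_mono; lra. }
    assert (B : exp (Re z) - 1 <= Cmod (1 + Cexp z)).
    { assert (T := Cmod_triangle (1 + Cexp z) (- (1))). replace (1 + Cexp z + - (1))%C with (Cexp z) in T by ring.
      rewrite Cmod_opp, Cmod_1, Cmod_Cexp in T. lra. }
    rewrite <- exp_plus. apply Rle_trans with (exp (Re z)); [|lra].
    apply exp_le_mono; nra. }
assert (Dp : 0 < Cmod (1 + Cexp z)).
{ assert (0 < exp ((1 - Re nu) * Re z) * exp (ka * x)) by (apply Rmult_lt_0_compat; apply exp_pos). lra. }
unfold phi. rewrite Cmod_div by (apply Cmod_gt_0; exact Dp). rewrite Cmod_mult, Cmod_pow, Cmod_Cexp.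
assert (Ez : exp (Re ((1 - nu) * z)) <= exp ((1 - Re nu) * Re z) * exp (Rabs (Im nu) * PI)).
{ rewrite <- exp_plus. rewrite re_mult.
  replace (Re (1 - nu)) with (1 - Re nu) by (unfold Cminus; rewrite re_plus, re_opp, re_RtoC; ring).
  replace (Im (1 - nu)) with (- Im nu) by (unfold Cminus; rewrite im_plus, im_opp, im_RtoC; ring).
  assert (A : Im nu * Im z <= Rabs (Im nu) * PI).
  { eapply Rle_trans; [apply Rle_abs|]. rewrite Rabs_mult. apply Rmult_le_compat_l; [apply Rabs_pos|exact Hi]. }
  apply exp_le_mono; lra. }
assert (Zn : Cmod z ^ n <= K * exp (ka / 2 * PI) * exp (ka / 2 * x)).
{ eapply Rle_trans; [apply HP, Cmod_ge_0|]. rewrite Rmult_assoc. apply Rmult_le_compat_l; [lra|]. rewrite <- exp_plus.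
  assert (T : Cmod z <= x + PI).
  { replace z with (RtoC (Re z) + RtoC (Im z) * Ci)%C at 1 by (symmetry; apply C_decomp).
    eapply Rle_trans; [apply Cmod_triangle|]. rewrite Cmod_mult, Cmod_Ci, !Cmod_R. unfold x. lra. }
  apply exp_le_mono; nra. }
apply Rmult_le_reg_r with (Cmod (1 + Cexp z)); [exact Dp|].
unfold Rdiv at 1. rewrite (Rmult_assoc _ (/ _)), Rinv_l, Rmult_1_r by lra.
apply Rle_trans with (K * exp (ka / 2 * PI) * exp (ka / 2 * x) * (exp ((1 - Re nu) * Re z) * exp (Rabs (Im nu) * PI))).
{ apply Rmult_le_compat; [apply pow_le, Cmod_ge_0|left; apply exp_pos|exact Zn|exact Ez]. }
replace (exp ((1 - Re nu) * Re z)) with ((exp ((1 - Re nu) * Re z) * exp (ka * x)) * exp (- (ka * x))).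
2:{ rewrite Rmult_assoc, <- exp_plus. replace (ka * x + - (ka * x)) with 0 by ring. rewrite exp_0; ring. }
replace (exp (- (ka / 2) * x)) with (exp (ka / 2 * x) * exp (- (ka * x))).
2:{ rewrite <- exp_plus. f_equal. field. }
set (e1 := exp (ka / 2 * PI)). set (e2 := exp (ka / 2 * x)). set (e3 := exp (- (ka * x))). set (e4 := exp (Rabs (Im nu) * PI)).
set (Y := exp ((1 - Re nu) * Re z) * exp (ka * x)) in *.
assert (0 < K * e1 * e2 * e3 * e4) by (repeat apply Rmult_lt_0_compat; try apply exp_pos; exact HK).
replace (K * e1 * e2 * (Y * e3 * e4)) with (K * e1 * e2 * e3 * e4 * Y) by ring.
replace (K * e1 * (e4 * 2) * (e2 * e3) * Cmod (1 + Cexp z)) with (K * e1 * e2 * e3 * e4 * (2 * Cmod (1 + Cexp z))) by ring.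
apply Rmult_le_compat_l; lra.
Qed.

Lemma strip_scal (beta : C) (s : R) (x : R) : 0 <= s <= 1 -> Rabs (Im beta) < PI -> Rabs (Im (RtoC x - RtoC s * beta)) < PI.
Proof.
intros Hs Hb. replace (Im (RtoC x - RtoC s * beta)) with (- (s * Im beta)).
- rewrite Rabs_Ropp, Rabs_mult, (Rabs_pos_eq s) by lra. generalize (Rabs_pos (Im beta)); nra.
- unfold Cminus. rewrite im_plus, im_opp, im_scal_l, im_RtoC. ring.
Qed.

(* Moving the line of integration: the derivative in s of the integral over [x - s beta] only
   has boundary terms. *)
Lemma phi_shift (n : nat) (nu beta : C) (X B : R) : Rabs (Im beta) < PI -> 0 <= X ->
  (forall s, 0 <= s <= 1 -> Cmod (phi n nu (RtoC X - RtoC s * beta)) <= B /\ Cmod (phi n nu (RtoC (- X) - RtoC s * beta)) <= B) ->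
  Cmod (CInt (fun x => phi n nu (RtoC x - beta)) (- X) X - CInt (fun x => phi n nu (RtoC x)) (- X) X) <= Cmod beta * (2 * B).
Proof.
intros Hb HX HB.
set (p := fun s x => (RtoC x - RtoC s * beta)%C).
set (b := Rabs (Im beta)) in *. assert (Hb0 : 0 <= b) by apply Rabs_pos.
(* Two-sided derivatives at s = 0 and s = 1 require the strip for s slightly outside [0, 1]; this
   choice gives (1 + delta) b = PI - (PI - b)^2 / PI < PI. *)
set (delta := (PI - b) / PI).
assert (Hpi := PI_RGT_0).
assert (Hd : 0 < delta) by (apply Rdiv_lt_0_compat; lra).
assert (Hdb : (1 + delta) * b < PI).
{ unfold delta. replace ((1 + (PI - b) / PI) * b) with (PI - (PI - b) * (PI - b) / PI) by (field; lra).
  assert (0 < (PI - b) * (PI - b) / PI) by (apply Rdiv_lt_0_compat; [apply Rmult_lt_0_compat; lra|lra]). lra. }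
assert (Hp : forall s0 s x, 0 <= s0 <= 1 -> Rabs (s - s0) < delta -> Rabs (Im (p s x)) < PI).
{ intros s0 s x Hs0 Hs. unfold p. replace (Im (RtoC x - RtoC s * beta)) with (- (s * Im beta))
    by (unfold Cminus; rewrite im_plus, im_opp, im_scal_l, im_RtoC; ring).
  rewrite Rabs_Ropp, Rabs_mult. fold b. apply Rabs_lt_between in Hs.
  assert (Rabs s <= 1 + delta) by (apply Rabs_le; lra). nra. }
assert (dps : forall s x, is_cderive (fun s => p s x) s (- beta)%C).
{ intros s x. unfold p. eapply is_cderive_eq.
  - apply is_cderive_plus; [apply is_cderive_const|]. apply is_cderive_opp, is_cderive_mult; [apply is_cderive_id|apply is_cderive_const].
  - cbv beta. ring. }
assert (dpx : forall s x, is_cderive (p s) x (RtoC 1)).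
{ intros s x. unfold p. eapply is_cderive_eq.
  - apply is_cderive_plus; [apply is_cderive_id|apply is_cderive_const].
  - cbv beta. ring. }
assert (c2 : forall s t, continuous (T := R2_UniformSpace) (U := C_UniformSpace) (fun q => p (fst q) (snd q)) (s, t)).
{ intros s t. unfold p. apply continuous_Cplus; [apply continuous_RtoC, continuous_snd|].
  apply continuous_Copp, continuous_Cmult; [apply continuous_RtoC, continuous_fst|apply continuous_Cconst]. }
set (A := fun s => CInt (fun x => phi n nu (p s x)) (- X) X).
set (dA := fun s => (- beta * (phi n nu (p s X) - phi n nu (p s (- X)%R)))%C).
assert (D : forall s, 0 <= s <= 1 -> is_cderive A s (dA s)).
{ intros s Hs. assert (Hss : Rabs (s - s) < delta) by (rewrite Rminus_diag, Rabs_R0; exact Hd).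
  eapply is_cderive_eq.
  - apply (is_cderive_CInt_param (fun s x => phi n nu (p s x)) (fun s x => dphi n nu (p s x) * - beta)%C (- X) X s delta Hd).
    + intros s' x Hs'. apply (is_cderive_phi n nu (fun s => p s x)); [apply (Hp s); assumption|apply dps].
    + intros x. apply continuous_Cmult; [|apply continuous_Cconst].
      apply (continuous_dphi n nu (fun q => p (fst q) (snd q))); [apply (Hp s); assumption|apply c2].
    + intros s' x Hs'. apply (continuous_phi n nu (p s')); [apply (Hp s); assumption|eapply is_cderive_continuous, dpx].
  - cbv beta. apply is_CInt_unique. unfold dA.
    apply is_CInt_ext with (fun x => - beta * (dphi n nu (p s x) * 1))%C; [intros; ring|].
    apply is_CInt_Cmult. apply (is_CInt_derive (fun x => phi n nu (p s x))).
    + intros x _. apply (is_cderive_phi n nu (p s)); [apply (Hp s); assumption|apply dpx].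
    + intros x _. apply continuous_Cmult; [|apply continuous_Cconst].
      apply (continuous_dphi n nu (p s)); [apply (Hp s); assumption|eapply is_cderive_continuous, dpx]. }
assert (I : is_CInt dA 0 1 (A 1 - A 0)%C).
{ apply is_CInt_derive; rewrite Rmin_left, Rmax_right by lra; [exact D|].
  intros s Hs. assert (Hss : Rabs (s - s) < delta) by (rewrite Rminus_diag, Rabs_R0; exact Hd).
  unfold dA. apply continuous_Cmult; [apply continuous_Cconst|].
  apply continuous_Cplus; [|apply continuous_Copp]; apply (continuous_phi n nu (fun s => p s _)); try (apply (Hp s); assumption);
    eapply is_cderive_continuous, dps. }
replace (CInt (fun x => phi n nu (RtoC x - beta)) (- X) X) with (A 1).
2:{ unfold A, p. apply (RInt_ext (V := C_R_CompleteNormedModule)). intros x _. f_equal. ring. }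
replace (CInt (fun x => phi n nu (RtoC x)) (- X) X) with (A 0).
2:{ unfold A, p. apply (RInt_ext (V := C_R_CompleteNormedModule)). intros x _. f_equal. ring. }
replace (Cmod beta * (2 * B)) with ((1 - 0) * (Cmod beta * (2 * B))) by ring.
apply is_CInt_Cmod_le_const with (3 := I); [lra|].
intros s Hs. unfold dA. rewrite Cmod_mult, Cmod_opp. apply Rmult_le_compat_l; [apply Cmod_ge_0|].
eapply Rle_trans; [apply Cmod_triangle|]. rewrite Cmod_opp. destruct (HB s Hs) as [B1 B2]. unfold p. lra.
Qed.

Lemma filterlim_C_squeeze {T : Type} (F : (T -> Prop) -> Prop) {FF : Filter F} (f : T -> C) (l : C) (g : T -> R) :
  F (fun x => Cmod (f x - l) <= g x) -> filterlim g F (locally 0) -> filterlim f F (Clocally l).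
Proof.
intros H Hg. apply filterlim_C; [exact FF|]. intros eps He.
assert (A := Hg _ (locally_ball 0 (mkposreal eps He))). unfold filtermap in A.
generalize (filter_and _ _ H A). apply filter_imp. intros x [H1 H2].
change (Rabs (g x - 0) < eps) in H2. rewrite Rminus_0_r in H2. generalize (Rle_abs (g x)); lra.
Qed.

(** The boundary terms of [phi_shift] sit at real parts at distance at most |beta| from X or -X,
    where [phi_decay] makes them exponentially small. *)
Lemma phi_shift_lim (n : nat) (nu beta : C) : 0 < Re nu < 1 -> Rabs (Im beta) < PI ->
  filterlim (fun X => CInt (fun x => phi n nu (RtoC x - beta)) (- X) X - CInt (fun x => phi n nu (RtoC x)) (- X) X)%C
   (Rbar_locally p_infty) (Clocally (RtoC 0)).
Proof.
intros Hnu Hb. destruct (phi_decay n nu Hnu) as (K & ka & HK & Hka & H).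
apply (filterlim_C_squeeze _ _ _ (fun X => Cmod beta * (2 * (K * exp (- ka * (X - Cmod beta)))))).
- exists (1 + Cmod beta). intros X HX.
  match goal with |- Cmod ?z <= _ => replace z with (CInt (fun x => phi n nu (RtoC x - beta)) (- X) X - CInt (fun x => phi n nu (RtoC x)) (- X) X)%C by ring end.
  assert (Hc := Cmod_ge_0 beta).
  apply phi_shift; [exact Hb|lra|]. intros s Hs.
  assert (S : Rabs (s * Re beta) <= Cmod beta).
  { rewrite Rabs_mult, (Rabs_pos_eq s) by lra. generalize (re_le_Cmod beta), (Rabs_pos (Re beta)). nra. }
  apply Rabs_le_between in S.
  assert (E : forall y, Re (RtoC y - RtoC s * beta) = y - s * Re beta).
  { intros y. unfold Cminus. rewrite re_plus, re_opp, re_scal_l, re_RtoC. ring. }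
  assert (Z : forall y, X <= Rabs y -> Cmod (phi n nu (RtoC y - RtoC s * beta)) <= K * exp (- ka * (X - Cmod beta))).
  { intros y Hy.
    assert (L : X - Cmod beta <= Rabs (Re (RtoC y - RtoC s * beta))).
    { rewrite E. unfold Rabs in *. destruct (Rcase_abs y); destruct (Rcase_abs (y - s * Re beta)); lra. }
    eapply Rle_trans; [apply H|].
    - left. apply strip_scal; assumption.
    - lra.
    - apply Rmult_le_compat_l; [lra|]. apply exp_le_mono. nra. }
  split; apply Z; [|rewrite Rabs_Ropp]; apply Rle_abs.
- assert (G : filterlim (fun X => exp (- ka * (X - Cmod beta))) (Rbar_locally p_infty) (locally 0)).
  { apply (filterlim_comp _ _ _ (fun X => - ka * (X - Cmod beta)) exp _ (Rbar_locally m_infty)); [|apply is_lim_exp_m].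
    intros P [M HM]. exists (Cmod beta + (Rabs M + 1) / ka). intros X HX. apply HM.
    assert ((Rabs M + 1) / ka < X - Cmod beta) by lra.
    assert (ka * ((Rabs M + 1) / ka) < ka * (X - Cmod beta)) by (apply Rmult_lt_compat_l; lra).
    replace (ka * ((Rabs M + 1) / ka)) with (Rabs M + 1) in H1 by (field; lra).
    generalize (Rle_abs (- M)). rewrite Rabs_Ropp. lra. }
  apply (filterlim_comp _ _ _ (fun X => exp (- ka * (X - Cmod beta))) (fun y => Cmod beta * (2 * (K * y))) _ (locally 0)); [exact G|].
  replace 0 with (Cmod beta * (2 * (K * 0))) at 2 by ring.
  apply (continuous_of_derive (fun y => Cmod beta * (2 * (K * y)))). auto_derive. exact I.
Qed.

Lemma CInt_exp_subst (f : R -> C) (A B : R) :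
  (forall x, ccontinuous f (exp x)) -> CInt f (exp A) (exp B) = CInt (fun x => RtoC (exp x) * f (exp x))%C A B.
Proof.
intros Hf. symmetry. apply is_CInt_unique.
apply is_CInt_ext with (fun x => scal (V := C_R_NormedModule) (exp x) (f (exp x))).
- intros x _. apply scal_R_Cmult.
- apply (is_RInt_comp (V := C_R_CompleteNormedModule) f exp exp).
  + intros x _. apply Hf.
  + intros x _. split; [apply is_derive_exp|]. apply continuous_exp.
Qed.

Lemma filterlim_exp_opp : filterlim (fun X => exp (- X)) (Rbar_locally p_infty) (at_right 0).
Proof.
intros P [eps HP]. exists (- ln eps). intros X HX. apply HP; [|apply exp_pos].
change (Rabs (exp (- X) - 0) < eps). rewrite Rminus_0_r, Rabs_pos_eq by (left; apply exp_pos).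
rewrite <- (exp_ln eps) by apply cond_pos. apply exp_increasing. lra.
Qed.

Lemma continuous_stieltjes_ones (n : nat) (nu w : C) (t : R) : 0 < t -> (w + RtoC t)%C <> 0 ->
  ccontinuous (stieltjes_integrand ones n nu w) t.
Proof.
intros Ht Hw. unfold stieltjes_integrand, Cdiv.
apply continuous_Cmult; [apply continuous_Cmult; [apply continuous_Cconst|apply continuous_Cpow, continuous_Cln, Ht]|].
apply continuous_Cinv; [|apply Cmult_neq_0; [apply Cpowc_pos_neq_0, Ht|exact Hw]].
apply continuous_Cmult; [apply continuous_Cpowc, Ht|apply continuous_Cplus; [apply continuous_Cconst|apply continuous_CRtoC]].
Qed.

(** With w = e^beta everything but the logarithm depends on x - beta only. The power x^n is left
    unshifted here; it is expanded later around x - beta. *)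
Lemma stieltjes_ones_exp (n : nat) (nu beta : C) (x : R) : Rabs (Im beta) < PI ->
  (RtoC (exp x) * stieltjes_integrand ones n nu (Cexp beta) (exp x) =
   Cexp (- (nu * beta)) * (RtoC x ^ n * Cexp ((1 - nu) * (RtoC x - beta)) / (1 + Cexp (RtoC x - beta))))%C.
Proof.
intros Hb. unfold stieltjes_integrand.
rewrite Cpowc_pos, ln_exp by apply exp_pos. rewrite <- !Cexp_RtoC.
assert (N : (1 + Cexp (RtoC x - beta))%C <> 0).
{ apply strip_neq_0. unfold Cminus. rewrite im_plus, im_opp, im_RtoC, Rplus_0_l, Rabs_Ropp. exact Hb. }
assert (E1 : Cexp (RtoC x) = (Cexp beta * Cexp (RtoC x - beta))%C) by (rewrite <- Cexp_plus; f_equal; ring).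
assert (E2 : (Cexp ((1 - nu) * (RtoC x - beta)) = Cexp (RtoC x - beta) * / (Cexp (nu * RtoC x)) * Cexp (nu * beta))%C).
{ rewrite <- Cexp_opp, <- !Cexp_plus. f_equal. ring. }
rewrite E1, E2, Cexp_opp.
assert (N1 := Cexp_neq_0 beta). assert (N2 := Cexp_neq_0 (nu * beta)). assert (N3 := Cexp_neq_0 (nu * RtoC x)).
field. repeat split; auto. 
replace (Cexp beta + Cexp beta * Cexp (RtoC x - beta))%C with (Cexp beta * (1 + Cexp (RtoC x - beta)))%C by ring.
apply Cmult_neq_0; assumption.
Qed.

Lemma stieltjes_ones_lim (n : nat) (nu beta : C) : 0 < Re nu < 1 -> Rabs (Im beta) < PI ->
  filterlim (fun X => Cexp (- (nu * beta)) * CInt (fun x => RtoC x ^ n * Cexp ((1 - nu) * (RtoC x - beta)) / (1 + Cexp (RtoC x - beta))) (- X) X)%C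
   (Rbar_locally p_infty) (Clocally (int0 p_infty (stieltjes_integrand ones n nu (Cexp beta)))).
Proof.
intros Hnu Hb.
assert (E := log_stieltjes_ex n nu beta Hnu Hb).
assert (V : is_CInt_gen (stieltjes_integrand ones n nu (Cexp beta)) (at_right 0) (Rbar_locally p_infty) (int0 p_infty (stieltjes_integrand ones n nu (Cexp beta)))).
{ apply (CInt_gen_correct); exact E. }
destruct (is_CInt_gen_filterlim _ _ (Rbar_locally p_infty) _ (fun X => exp (- X)) exp _ V filterlim_exp_opp is_lim_exp_p) as [_ L].
apply filterlim_ext with (2 := L). intros X.
destruct (Cexp_slit beta Hb) as [m [Hm Hs]].
rewrite CInt_exp_subst.
2:{ intros x. apply continuous_stieltjes_ones; [apply exp_pos|]. apply (slit_neq_0 _ m Hm Hs). left; apply exp_pos. }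
apply is_CInt_unique.
apply is_CInt_ext with (fun x => Cexp (- (nu * beta)) * (RtoC x ^ n * Cexp ((1 - nu) * (RtoC x - beta)) / (1 + Cexp (RtoC x - beta))))%C.
{ intros x _. symmetry. apply stieltjes_ones_exp. exact Hb. }
apply is_CInt_Cmult, is_CInt_CInt. intros x _.
assert (N : (1 + Cexp (RtoC x - beta))%C <> 0).
{ apply strip_neq_0. unfold Cminus. rewrite im_plus, im_opp, im_RtoC, Rplus_0_l, Rabs_Ropp. exact Hb. }
assert (Cx : ccontinuous (fun x => RtoC x - beta)%C x) by (apply continuous_Cplus; [apply continuous_CRtoC|apply continuous_Cconst]).
apply continuous_Cmult; [apply continuous_Cmult; [apply continuous_Cpow, continuous_CRtoC|]|].
- apply continuous_Cexp, continuous_Cmult; [apply continuous_Cconst|exact Cx].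
- apply continuous_Cinv; [apply continuous_Cplus; [apply continuous_Cconst|apply continuous_Cexp, Cx]|exact N].
Qed.

Definition log_moment (nu : C) (n : nat) : C := int0 p_infty (stieltjes_integrand ones n nu 1).

Lemma phi_lim (n : nat) (nu beta : C) : 0 < Re nu < 1 -> Rabs (Im beta) < PI ->
  filterlim (fun X => CInt (fun x => phi n nu (RtoC x - beta)) (- X) X) (Rbar_locally p_infty)
    (Clocally (log_moment nu n)).
Proof.
intros Hnu Hb.
assert (H0 : Rabs (Im (RtoC 0)) < PI) by (simpl; rewrite Rabs_R0; apply PI_RGT_0).
assert (A := stieltjes_ones_lim n nu 0 Hnu H0). rewrite Cexp_0 in A.
assert (B := phi_shift_lim n nu beta Hnu Hb).
assert (S := filterlim_C_plus _ _ _ _ _ A B). rewrite Cplus_0_r in S.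
apply filterlim_ext with (2 := S). intros X. cbv beta.
replace (- (nu * 0))%C with (RtoC 0) by ring. rewrite Cexp_0.
replace (CInt (fun x => RtoC x ^ n * Cexp ((1 - nu) * (RtoC x - 0)) / (1 + Cexp (RtoC x - 0))) (- X) X)%C with
  (CInt (fun x => phi n nu (RtoC x)) (- X) X); [ring|].
apply (RInt_ext (V := C_R_CompleteNormedModule)). intros x _. unfold phi. replace (RtoC x - 0)%C with (RtoC x) by ring. reflexivity.
Qed.

(** Write x^n = ((x - beta) + beta)^n. Each integral over the shifted line tends to a moment that no
    longer depends on beta, so w enters only through e^(-nu beta) and powers of beta. *)
Lemma stieltjes_ones_value (n : nat) (nu beta : C) : 0 < Re nu < 1 -> Rabs (Im beta) < PI ->
  is_CInt_gen (stieltjes_integrand ones n nu (Cexp beta)) (at_right 0) (Rbar_locally p_infty)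
   (Cexp (- (nu * beta)) * csum (fun l => cnat (bin n l) * (beta ^ (n - l) * log_moment nu l)) n)%C.
Proof.
intros Hnu Hb.
assert (A := stieltjes_ones_lim n nu beta Hnu Hb).
assert (B : filterlim (fun X => Cexp (- (nu * beta)) * csum (fun l => cnat (bin n l) * (beta ^ (n - l) * CInt (fun x => phi l nu (RtoC x - beta)) (- X) X)) n)%C
   (Rbar_locally p_infty) (Clocally (Cexp (- (nu * beta)) * csum (fun l => cnat (bin n l) * (beta ^ (n - l) * log_moment nu l)) n)%C)).
{ apply filterlim_C_mult_const; [apply Rbar_locally_filter|].
  assert (G : forall j, filterlim (fun X => csum (fun l => cnat (bin n l) * (beta ^ (n - l) * CInt (fun x => phi l nu (RtoC x - beta)) (- X) X))%C j)
     (Rbar_locally p_infty) (Clocally (csum (fun l => cnat (bin n l) * (beta ^ (n - l) * log_moment nu l))%C j))).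
  { induction j as [|j IH].
    - rewrite csum_0. apply (filterlim_ext (fun X => cnat (bin n 0) * (beta ^ (n - 0) * CInt (fun x => phi 0 nu (RtoC x - beta)) (- X) X))%C); [intros X; rewrite csum_0; reflexivity|].
      apply filterlim_C_mult_const; [apply Rbar_locally_filter|]. apply filterlim_C_mult_const; [apply Rbar_locally_filter|]. apply phi_lim; assumption.
    - rewrite csum_S. apply (filterlim_ext (fun X => csum (fun l => cnat (bin n l) * (beta ^ (n - l) * CInt (fun x => phi l nu (RtoC x - beta)) (- X) X)) j +
       cnat (bin n (S j)) * (beta ^ (n - S j) * CInt (fun x => phi (S j) nu (RtoC x - beta)) (- X) X))%C); [intros X; rewrite csum_S; reflexivity|].
      apply filterlim_C_plus; [apply Rbar_locally_filter|exact IH|].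
      apply filterlim_C_mult_const; [apply Rbar_locally_filter|]. apply filterlim_C_mult_const; [apply Rbar_locally_filter|]. apply phi_lim; assumption. }
  apply G. }
assert (U := fun m => filterlim_C_unique (Rbar_locally p_infty) _ _ m A).
rewrite <- (U (Cexp (- (nu * beta)) * csum (fun l => cnat (bin n l) * (beta ^ (n - l) * log_moment nu l)) n)%C).
- apply (CInt_gen_correct); apply log_stieltjes_ex; assumption.
- apply filterlim_ext with (2 := B). intros X. cbv beta. f_equal. symmetry. apply is_CInt_unique.
  apply is_CInt_ext with (fun x => csum (fun l => cnat (bin n l) * (beta ^ (n - l) * phi l nu (RtoC x - beta)))%C n).
  + intros x _. replace (RtoC x ^ n)%C with (((RtoC x - beta) + beta) ^ n)%C by (f_equal; ring). rewrite Cbinomial.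
    unfold Cdiv. rewrite <- Cmult_assoc, (Cmult_comm (csum _ _)), <- csum_mult_l. apply csum_ext. intros l _. unfold phi, Cdiv. Cring.
  + apply is_CInt_csum. intros l. do 2 apply is_CInt_Cmult. apply is_CInt_CInt. intros x _.
    apply (continuous_phi l nu (fun x => RtoC x - beta)%C).
    * unfold Cminus. rewrite im_plus, im_opp, im_RtoC, Rplus_0_l, Rabs_Ropp. exact Hb.
    * apply continuous_Cplus; [apply continuous_CRtoC|apply continuous_Cconst].
Qed.

(** * The jump across the negative axis *)

(** Minus the imaginary part of 1 / (e^(i theta) + t). Its primitive in t is an arctangent and its
    mass over (0, oo) is theta, hence tends to PI. *)
Definition jump_kernel (theta t : R) : R := sin theta / (t ^ 2 + 2 * t * cos theta + 1).

Lemma jump_den_pos (theta t : R) : 0 < theta < PI -> 0 < t ^ 2 + 2 * t * cos theta + 1.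
Proof.
intros Ht. assert (S := sin_gt_0 theta (proj1 Ht) (proj2 Ht)).
assert (E := sin2_cos2 theta). unfold Rsqr in E.
replace (t ^ 2 + 2 * t * cos theta + 1) with ((t + cos theta) * (t + cos theta) + sin theta * sin theta).
- assert (0 <= (t + cos theta) * (t + cos theta)) by apply Rle_0_sqr. nra.
- transitivity (t ^ 2 + 2 * t * cos theta + (sin theta * sin theta + cos theta * cos theta)); [ring|rewrite E; ring].
Qed.

Lemma jump_den_ge (theta t : R) : 0 <= t -> (t - 1) ^ 2 <= t ^ 2 + 2 * t * cos theta + 1.
Proof. intros Ht. generalize (COS_bound theta). nra. Qed.

Lemma jump_kernel_pos (theta t : R) : 0 < theta < PI -> 0 <= jump_kernel theta t.
Proof.
intros H. apply Rdiv_le_0_compat; [apply sin_ge_0; lra|apply jump_den_pos, H].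
Qed.

Lemma is_derive_jump_kernel (theta t : R) : 0 < theta < PI ->
  is_derive (fun t => atan ((t + cos theta) / sin theta)) t (jump_kernel theta t).
Proof.
intros H. assert (S := sin_gt_0 theta (proj1 H) (proj2 H)). assert (E := sin2_cos2 theta). unfold Rsqr in E.
assert (D := jump_den_pos theta t H).
assert (E2 : t ^ 2 + 2 * t * cos theta + 1 = (t + cos theta) * (t + cos theta) + sin theta * sin theta).
{ transitivity (t ^ 2 + 2 * t * cos theta + (sin theta * sin theta + cos theta * cos theta)); [rewrite E; ring|ring]. }
apply (is_derive_ext (fun t => atan ((fun t => (t + cos theta) / sin theta) t))); [intros; reflexivity|].
replace (jump_kernel theta t) with (scal (V := R_NormedModule) (/ sin theta) (/ (1 + ((t + cos theta) / sin theta)²))).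
- apply (is_derive_comp (V := R_NormedModule) atan (fun t => (t + cos theta) / sin theta)).
  + apply is_derive_atan.
  + auto_derive; [exact I|]. field. lra.
- unfold scal; simpl; unfold mult; simpl. unfold jump_kernel. rewrite E2. unfold Rsqr. field. repeat split; nra.
Qed.

Lemma continuous_jump_kernel (theta t : R) : 0 < theta < PI -> continuous (jump_kernel theta) t.
Proof.
intros H. unfold jump_kernel. apply (continuous_of_derive (fun t => sin theta / (t ^ 2 + 2 * t * cos theta + 1))).
auto_derive. generalize (jump_den_pos theta t H). intros D E. simpl in D. lra.
Qed.

Lemma Cexp_Ci (theta : R) : Cexp (Ci * RtoC theta) = (RtoC (cos theta) + Ci * RtoC (sin theta))%C.
Proof.
unfold Cexp. replace (Re (Ci * RtoC theta)) with 0 by (simpl; ring). replace (Im (Ci * RtoC theta)) with theta by (simpl; ring).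
rewrite exp_0. unfold RtoC, Ci, Cplus, Cmult; simpl; f_equal; ring.
Qed.

Lemma Cexp_Ci_opp (theta : R) : Cexp (- (Ci * RtoC theta)) = (RtoC (cos theta) - Ci * RtoC (sin theta))%C.
Proof.
replace (- (Ci * RtoC theta))%C with (Ci * RtoC (- theta))%C by (rewrite RtoC_opp; ring).
rewrite Cexp_Ci, cos_neg, sin_neg, RtoC_opp. ring.
Qed.

(** For |w| = 1 the two denominators are conjugate, and their product is the denominator of
    [jump_kernel]. *)
Lemma stieltjes_jump (n : nat) (nu : C) (theta t : R) : 0 < theta < PI -> 0 < t ->
  (stieltjes_integrand ones n nu (Cexp (Ci * RtoC theta)) t + - (1) * stieltjes_integrand ones n nu (Cexp (- (Ci * RtoC theta))) t =
   - (2 * Ci) * (RtoC (jump_kernel theta t) * log_weight n nu t))%C.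
Proof.
intros H Ht. assert (D := jump_den_pos theta t H).
set (c := RtoC (cos theta)). set (s := RtoC (sin theta)).
assert (E : ((c + Ci * s + RtoC t) * (c - Ci * s + RtoC t) = RtoC (t ^ 2 + 2 * t * cos theta + 1))%C).
{ transitivity (RtoC t * RtoC t + 2 * RtoC t * c + (c * c - (Ci * Ci) * (s * s)))%C; [ring|].
  rewrite Ci_mult_Ci. unfold c, s. rewrite <- !RtoC_mult.
  replace (RtoC (cos theta * cos theta) - - RtoC 1 * RtoC (sin theta * sin theta))%C with (RtoC 1).
  - rewrite <- !RtoC_plus. f_equal. ring.
  - transitivity (RtoC (sin theta * sin theta) + RtoC (cos theta * cos theta))%C; [|ring].
    rewrite <- RtoC_plus. f_equal. symmetry. apply sin2_cos2. }
assert (N : (RtoC (t ^ 2 + 2 * t * cos theta + 1)) <> 0) by (apply RtoC_neq_0; lra).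
assert (N1 : (c + Ci * s + RtoC t)%C <> 0) by (intros Z; apply N; rewrite <- E, Z; ring).
assert (N2 : (c - Ci * s + RtoC t)%C <> 0) by (intros Z; apply N; rewrite <- E, Z; ring).
rewrite Cexp_Ci, Cexp_Ci_opp. fold c. fold s.
rewrite !stieltjes_log_weight by assumption.
unfold jump_kernel. rewrite RtoC_div by lra. fold s. rewrite <- E. field. split; assumption.
Qed.

(** The difference of the values in [stieltjes_ones_value] at beta = i theta and beta = -i theta.
    This closed form is continuous up to theta = PI, where w = -1 lies on the cut and the two
    integrals are no longer covered. *)
Definition jump (n : nat) (nu : C) (theta : R) : C :=
  csum (fun l => cnat (bin n l) * ((Cexp (- (nu * (Ci * RtoC theta))) * (Ci * RtoC theta) ^ (n - l) -
     Cexp (nu * (Ci * RtoC theta)) * (- (Ci * RtoC theta)) ^ (n - l)) * log_moment nu l))%C n.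

Lemma jump_integral (n : nat) (nu : C) (theta : R) : 0 < Re nu < 1 -> 0 < theta < PI ->
  is_CInt_gen (fun t => RtoC (jump_kernel theta t) * log_weight n nu t)%C (at_right 0) (Rbar_locally p_infty)
    (Ci / 2 * jump n nu theta)%C.
Proof.
intros Hnu H.
assert (H1 : Rabs (Im (Ci * RtoC theta)) < PI).
{ replace (Im (Ci * RtoC theta)) with theta by (simpl; ring). rewrite Rabs_pos_eq; lra. }
assert (H2 : Rabs (Im (- (Ci * RtoC theta))) < PI) by (rewrite im_opp, Rabs_Ropp; exact H1).
assert (V1 := stieltjes_ones_value n nu _ Hnu H1).
assert (V2 := stieltjes_ones_value n nu _ Hnu H2).
assert (V := is_CInt_gen_plus _ _ _ _ _ _ V1 (is_CInt_gen_Cmult _ _ (- (1))%C _ _ V2)).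
replace (- (nu * - (Ci * RtoC theta)))%C with (nu * (Ci * RtoC theta))%C in V by ring.
rewrite <- !csum_mult_l, <- csum_plus in V.
apply (is_CInt_gen_Cmult _ _ (Ci / 2)%C) in V.
apply (is_CInt_gen_ext_pos (fun t => Ci / 2 * (stieltjes_integrand ones n nu (Cexp (Ci * RtoC theta)) t + - (1) * stieltjes_integrand ones n nu (Cexp (- (Ci * RtoC theta))) t))%C).
- apply at_right_proper_filter.
- apply Rbar_locally_filter.
- apply at_right_0_nonneg.
- apply p_infty_nonneg.
- intros t Ht. rewrite stieltjes_jump by assumption.
  transitivity (- (Ci * Ci) * (RtoC (jump_kernel theta t) * log_weight n nu t))%C; [field; apply RtoC_neq_0; lra|rewrite Ci_mult_Ci; ring].
- replace (Ci / 2 * jump n nu theta)%C with (Ci / 2 * csum (fun m => Cexp (- (nu * (Ci * RtoC theta))) * (cnat (bin n m) * ((Ci * RtoC theta) ^ (n - m) * log_moment nu m)) +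
     - (1) * (Cexp (nu * (Ci * RtoC theta)) * (cnat (bin n m) * ((- (Ci * RtoC theta)) ^ (n - m) * log_moment nu m)))) n)%C.
  + rewrite csum_plus, !csum_mult_l. rewrite csum_plus, !csum_mult_l in V. exact V.
  + f_equal. unfold jump. apply csum_ext. intros m _. Cring.
Qed.

Lemma atan_le (x : R) : 0 <= x -> atan x <= x.
Proof.
intros Hx. assert (B := bounded_variation atan (fun t => / (1 + t²)) 1 0 x).
rewrite atan_0, !Rminus_0_r, (Rabs_pos_eq x) in B by lra.
rewrite Rmult_1_l in B. eapply Rle_trans; [apply Rle_abs|]. apply B. intros t _. split; [apply is_derive_atan|].
assert (0 <= t²) by apply Rle_0_sqr.
rewrite Rabs_pos_eq by (left; apply Rinv_0_lt_compat; lra). rewrite <- Rinv_1. apply Rinv_le_contravar; lra.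
Qed.

Lemma atan_quotient_ge (y s d : R) : 0 < s -> 0 < d -> d <= y -> PI / 2 - s / d <= atan (y / s).
Proof.
intros Hs Hd Hy. replace (y / s) with (/ (s / y)) by (field; lra).
rewrite atan_inv by (apply Rdiv_lt_0_compat; lra).
assert (A : atan (s / y) <= s / y) by (apply atan_le, Rdiv_le_0_compat; lra).
assert (s / y <= s / d) by (apply Rmult_le_compat_l; [lra|apply Rinv_le_contravar; lra]). lra.
Qed.

Lemma log_weight_1 (n : nat) (nu : C) : log_weight n nu 1 = (RtoC 0 ^ n)%C.
Proof.
unfold log_weight. rewrite Cpowc_pos by lra. rewrite ln_1, Cmult_0_r, Cexp_0. field.
Qed.

Lemma is_CInt_RtoC (f : R -> R) (a b l : R) : is_RInt f a b l -> is_CInt (fun t => RtoC (f t)) a b (RtoC l).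
Proof.
intros H. apply (is_RInt_fct_extend_pair (U := R_NormedModule) (V := R_NormedModule)); simpl; [exact H|].
assert (Z := is_RInt_const (V := R_NormedModule) a b 0).
refine (eq_ind _ (fun m => is_RInt (V := R_NormedModule) (fun _ => 0) a b m) Z 0 _).
apply (Rmult_0_r (b - a)).
Qed.

(** Approximate identity at t = 1, where the weight has the value 0^n. Off (1 - delta, 1 + delta)
    the kernel is at most sin theta / (t - 1)^2, so both outer parts are O(sin theta). Inside, the
    weight is within eta of its value at 1 and the kernel has mass PI + O(sin theta). *)
Lemma jump_estimate (n : nat) (nu : C) (eta : R) : 0 < Re nu < 1 -> 0 < eta ->
  exists K delta, 0 < K /\ 0 < delta /\ forall theta, 0 < theta < PI -> 1 + cos theta < delta / 2 ->
   Cmod (jump n nu theta + 2 * Ci * RtoC PI * 0 ^ n)%C <= K * sin theta + 2 * eta * PI.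
Proof.
intros Hnu Heta.
assert (Cw := proj1 (filterlim_C _ _ _) (continuous_log_weight n nu 1 Rlt_0_1) eta Heta).
destruct Cw as [[d0 Hd0] Cw]. simpl in Cw.
set (delta := Rmin (d0 / 2) (1 / 2)).
assert (Hd : 0 < delta) by (apply Rmin_pos; lra).
assert (Hd1 : delta <= d0 / 2) by apply Rmin_l. assert (Hd2 : delta <= 1 / 2) by apply Rmin_r.
destruct (head_log n nu (1 - delta) ltac:(lra) (proj2 Hnu)) as [K1 [HK1 H1]].
destruct (tail_log n nu (1 + delta) ltac:(lra) (proj1 Hnu)) as [K2 [HK2 H2]].
assert (Hdd : 0 < delta * delta) by (apply Rmult_lt_0_compat; exact Hd).
exists (2 * (K1 * / (delta * delta) + K2 * ((1 + delta) / (delta * delta)) + 4 / delta)), delta.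
split.
{ apply Rmult_lt_0_compat; [lra|]. apply Rplus_lt_0_compat; [apply Rplus_lt_0_compat|apply Rdiv_lt_0_compat; lra].
  - apply Rmult_lt_0_compat; [exact HK1|apply Rinv_0_lt_compat; lra].
  - apply Rmult_lt_0_compat; [exact HK2|apply Rdiv_lt_0_compat; lra]. }
split; [exact Hd|]. intros theta Hth Hcos.
assert (S := sin_gt_0 theta (proj1 Hth) (proj2 Hth)).
assert (Hc1 := COS_bound theta).
assert (CJ : forall t, ccontinuous (fun t => RtoC (jump_kernel theta t)) t) by (intros; apply continuous_RtoC, continuous_jump_kernel, Hth).
assert (BJ : forall t d, 0 <= t -> 0 < d -> d <= (t - 1) ^ 2 -> Cmod (RtoC (jump_kernel theta t)) <= sin theta * / d).
{ intros t d Ht Hd' Hle. rewrite Cmod_R, Rabs_pos_eq by (apply jump_kernel_pos, Hth). unfold jump_kernel, Rdiv.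
  apply Rmult_le_compat_l; [lra|]. apply Rinv_le_contravar; [exact Hd'|]. eapply Rle_trans; [exact Hle|apply jump_den_ge, Ht]. }
destruct (H1 (fun t => RtoC (jump_kernel theta t)) (sin theta * / (delta * delta))) as [h [Hh Bh]].
{ intros; apply CJ. }
{ intros t Ht. apply BJ; nra. }
destruct (H2 (fun t => RtoC (jump_kernel theta t)) (sin theta * ((1 + delta) / (delta * delta)))) as [tl [Htl Btl]].
{ intros; apply CJ. }
{ intros t Ht. replace (sin theta * ((1 + delta) / (delta * delta)) / t) with (sin theta * / (delta * delta * t / (1 + delta))) by (field; lra).
  apply BJ; [lra|apply Rdiv_lt_0_compat; [apply Rmult_lt_0_compat; lra|lra]|].
  apply Rmult_le_reg_r with (1 + delta); [lra|]. unfold Rdiv. rewrite Rmult_assoc, Rinv_l, Rmult_1_r by lra.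
  assert (delta * t <= (t - 1) * (1 + delta)) by nra. assert (delta <= t - 1) by lra. simpl. rewrite Rmult_1_r.
  replace ((t - 1) * (t - 1) * (1 + delta)) with ((t - 1) * ((t - 1) * (1 + delta))) by ring. rewrite Rmult_assoc.
  apply Rmult_le_compat; nra. }
set (P := fun t => (RtoC (jump_kernel theta t) * log_weight n nu t)%C).
assert (Hmid : is_CInt P (1 - delta) (1 + delta) (CInt P (1 - delta) (1 + delta))).
{ apply is_CInt_CInt. intros t Ht. rewrite Rmin_left, Rmax_right in Ht by lra.
  apply continuous_Cmult; [apply CJ|apply continuous_log_weight; lra]. }
set (md := CInt P (1 - delta) (1 + delta)) in *.
assert (W : (Ci / 2 * jump n nu theta = h + (md + tl))%C).
{ assert (T := CInt_gen_Chasles P (1 + delta) md tl (proj2 (CInt_gen_at_point P _ _ _) Hmid) Htl).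
  assert (T2 := CInt_gen_Chasles P (1 - delta) h _ Hh T).
  transitivity (CInt_gen P (at_right 0) (Rbar_locally p_infty)).
  - symmetry. apply (CInt_gen_value P). apply jump_integral; assumption.
  - apply (CInt_gen_value P). exact T2. }
set (A := atan ((1 + delta + cos theta) / sin theta) - atan ((1 - delta + cos theta) / sin theta)).
assert (IA : is_RInt (jump_kernel theta) (1 - delta) (1 + delta) A).
{ apply (is_RInt_derive (V := R_CompleteNormedModule) (fun t => atan ((t + cos theta) / sin theta)));
    intros; [apply is_derive_jump_kernel|apply continuous_jump_kernel]; exact Hth. }
assert (IAC : is_CInt (fun t => RtoC (jump_kernel theta t)) (1 - delta) (1 + delta) (RtoC A)).
{ apply is_CInt_RtoC; exact IA. }
assert (A1 : A <= PI).
{ unfold A. generalize (atan_bound ((1 + delta + cos theta) / sin theta)), (atan_bound ((1 - delta + cos theta) / sin theta)). lra. }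
assert (A2 : PI - 4 / delta * sin theta <= A).
(* Since 1 + cos theta < delta / 2, both ends of the interval lie at distance at least delta / 2
   from -cos theta, on opposite sides; each arctangent is then within (2 / delta) sin theta of its
   limit PI / 2 or -PI / 2. *)
{ unfold A. assert (B1 := atan_quotient_ge (1 + delta + cos theta) (sin theta) (delta / 2) S ltac:(lra) ltac:(lra)).
  assert (B2 := atan_quotient_ge (- (1 - delta + cos theta)) (sin theta) (delta / 2) S ltac:(lra) ltac:(lra)).
  replace (- (1 - delta + cos theta) / sin theta) with (- ((1 - delta + cos theta) / sin theta)) in B2 by (field; lra).
  rewrite atan_opp in B2. replace (sin theta / (delta / 2)) with (2 / delta * sin theta) in B1, B2 by (field; lra).
  replace (4 / delta * sin theta) with (2 / delta * sin theta + 2 / delta * sin theta) by (field; lra). lra. }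
assert (Bmd : Cmod (md - RtoC A * 0 ^ n) <= eta * PI).
{ assert (I2 := is_CInt_plus _ _ _ _ _ _ Hmid (is_CInt_Cmult (- RtoC 0 ^ n)%C _ _ _ _ IAC)).
  replace (md - RtoC A * 0 ^ n)%C with (md + - RtoC 0 ^ n * RtoC A)%C by ring.
  apply Rle_trans with (eta * A); [|apply Rmult_le_compat_l; lra].
  apply (is_CInt_Cmod_le _ (fun t => eta * jump_kernel theta t) (1 - delta) (1 + delta)) with (3 := I2); [lra| |apply (is_RInt_scal (V := R_NormedModule)); exact IA].
  intros t Ht. unfold P. replace (RtoC (jump_kernel theta t) * log_weight n nu t + - RtoC 0 ^ n * RtoC (jump_kernel theta t))%C with
    (RtoC (jump_kernel theta t) * (log_weight n nu t - log_weight n nu 1))%C by (rewrite log_weight_1; ring).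
  rewrite Cmod_mult, Cmod_R, Rabs_pos_eq by (apply jump_kernel_pos, Hth). rewrite Rmult_comm.
  apply Rmult_le_compat_r; [apply jump_kernel_pos, Hth|]. left. apply Cw.
  change (Rabs (t - 1) < d0). apply Rabs_lt_between. lra. }
assert (Z : Cmod (RtoC 0 ^ n) <= 1).
{ destruct n; simpl; [rewrite Cmod_1; lra|]. rewrite Cmult_0_l, Cmod_0. lra. }
replace (jump n nu theta + 2 * Ci * RtoC PI * 0 ^ n)%C with (- (2 * Ci) * ((h + tl) + ((md - RtoC A * 0 ^ n) + RtoC (A - PI) * 0 ^ n)))%C.
2:{ transitivity (- (2 * Ci) * ((h + (md + tl)) - RtoC PI * 0 ^ n))%C; [rewrite RtoC_minus; ring|]. rewrite <- W.
    transitivity (- (Ci * Ci) * jump n nu theta + 2 * Ci * RtoC PI * 0 ^ n)%C; [field; apply RtoC_neq_0; lra|rewrite Ci_mult_Ci; ring]. }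
rewrite Cmod_mult, Cmod_opp, Cmod_mult, Cmod_Ci, Cmod_R, (Rabs_pos_eq 2) by lra.
assert (T1 := Cmod_triangle (h + tl) ((md - RtoC A * 0 ^ n) + RtoC (A - PI) * 0 ^ n)).
assert (T2 := Cmod_triangle h tl).
assert (T3 := Cmod_triangle (md - RtoC A * 0 ^ n) (RtoC (A - PI) * 0 ^ n)).
rewrite (Cmod_mult (RtoC (A - PI))), Cmod_R, Rabs_left1 in T3 by lra.
assert (Cz := Cmod_ge_0 (RtoC 0 ^ n)).
assert (T4 : - (A - PI) * Cmod (RtoC 0 ^ n) <= 4 / delta * sin theta) by nra.
replace (2 * (K1 * / (delta * delta) + K2 * ((1 + delta) / (delta * delta)) + 4 / delta) * sin theta) with
 (2 * (K1 * (sin theta * / (delta * delta)) + K2 * (sin theta * ((1 + delta) / (delta * delta))) + 4 / delta * sin theta)) by ring.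
lra.
Qed.

Lemma continuous_csum {T : UniformSpace} (F : nat -> T -> C) (x : T) (n : nat) :
  (forall m, ccontinuous (F m) x) -> ccontinuous (fun t => csum (fun m => F m t) n) x.
Proof.
intros H. induction n as [|n IH].
- apply (continuous_ext (F 0%nat)); [intros; rewrite csum_0; reflexivity|apply H].
- apply (continuous_ext (fun t => csum (fun m => F m t) n + F (S n) t)%C); [intros; rewrite csum_S; reflexivity|].
  apply continuous_Cplus; [exact IH|apply H].
Qed.

(** [jump] is continuous in theta, so its value at PI is the limit from the left; there sin theta
    tends to 0, cos theta to -1, and eta is arbitrary. *)
Lemma jump_PI (n : nat) (nu : C) : 0 < Re nu < 1 -> jump n nu PI = (- (2 * Ci * RtoC PI) * 0 ^ n)%C.
Proof.
intros Hnu.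
assert (Hpi := PI_RGT_0).
assert (Cj : ccontinuous (jump n nu) PI).
{ unfold jump. apply continuous_csum. intros l.
  assert (C1 : ccontinuous (fun t => Ci * RtoC t)%C PI) by (apply continuous_Cmult; [apply continuous_Cconst|apply continuous_CRtoC]).
  apply continuous_Cmult; [apply continuous_Cconst|]. apply continuous_Cmult; [|apply continuous_Cconst].
  apply continuous_Cplus; [|apply continuous_Copp]; apply continuous_Cmult.
  - apply continuous_Cexp, continuous_Copp, continuous_Cmult; [apply continuous_Cconst|exact C1].
  - apply continuous_Cpow, C1.
  - apply continuous_Cexp, continuous_Cmult; [apply continuous_Cconst|exact C1].
  - apply continuous_Cpow, continuous_Copp, C1. }
apply Ceq_minus. apply Cmod_eq_0.
replace (jump n nu PI - - (2 * Ci * RtoC PI) * 0 ^ n)%C with (jump n nu PI + 2 * Ci * RtoC PI * 0 ^ n)%C by ring.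
apply Rle_antisym; [|apply Cmod_ge_0]. apply le_epsilon. intros eps He. rewrite Rplus_0_l.
destruct (jump_estimate n nu (eps / (8 * PI)) Hnu) as (K & delta & HK & Hd & H).
{ apply Rdiv_lt_0_compat; lra. }
assert (L1 := proj1 (filterlim_C _ _ _) Cj (eps / 4) ltac:(lra)).
assert (L2 : locally PI (fun t => 1 + cos t < delta / 2)).
{ assert (Cc := continuous_cos PI). assert (B := Cc _ (locally_ball (cos PI) (mkposreal (delta / 2) ltac:(lra)))). unfold filtermap in B.
  revert B. apply filter_imp. intros t Ht. change (Rabs (cos t - cos PI) < delta / 2) in Ht. rewrite cos_PI in Ht.
  apply Rabs_lt_between in Ht. lra. }
assert (L3 : locally PI (fun t => K * sin t < eps / 4)).
{ assert (Cc := continuous_sin PI). assert (B := Cc _ (locally_ball (sin PI) (mkposreal (eps / (4 * K)) ltac:(apply Rdiv_lt_0_compat; lra)))). unfold filtermap in B.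
  revert B. apply filter_imp. intros t Ht. change (Rabs (sin t - sin PI) < eps / (4 * K)) in Ht. rewrite sin_PI, Rminus_0_r in Ht.
  replace (eps / 4) with (K * (eps / (4 * K))) by (field; lra). apply Rmult_lt_compat_l; [lra|]. eapply Rle_lt_trans; [apply Rle_abs|exact Ht]. }
assert (L4 : locally PI (fun t => 0 < t)).
{ exists (mkposreal PI Hpi). intros t Ht. change (Rabs (t - PI) < PI) in Ht. apply Rabs_lt_between in Ht. lra. }
assert (L := filter_and _ _ L1 (filter_and _ _ L2 (filter_and _ _ L3 L4))).
assert (L' : at_left PI (fun t => t < PI /\ Cmod (jump n nu t - jump n nu PI) < eps / 4 /\ 1 + cos t < delta / 2 /\ K * sin t < eps / 4 /\ 0 < t)).
{ destruct L as [e He']. exists e. intros t Ht Hlt. split; [exact Hlt|]. apply He'. exact Ht. }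
destruct (filter_ex _ L') as [t (Ht & B1 & B2 & B3 & B4)].
assert (B := H t (conj B4 Ht) B2).
replace (jump n nu PI + 2 * Ci * RtoC PI * 0 ^ n)%C with (- (jump n nu t - jump n nu PI) + (jump n nu t + 2 * Ci * RtoC PI * 0 ^ n))%C by ring.
eapply Rle_trans; [apply Cmod_triangle|]. rewrite Cmod_opp.
replace (2 * (eps / (8 * PI)) * PI) with (eps / 4) in B by (field; lra). lra.
Qed.

(** If E - 1/E = 0 then E is 1 or -1, hence real; but its imaginary part is a positive multiple of
    sin(PI Re nu), which is positive for 0 < Re nu < 1. *)
Lemma sin_PI_nu_neq_0 (nu : C) : 0 < Re nu < 1 ->
  (Cexp (Ci * (RtoC PI * nu)) - / Cexp (Ci * (RtoC PI * nu)))%C <> 0.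
Proof.
intros Hnu. set (E := Cexp (Ci * (RtoC PI * nu))). assert (E0 : E <> 0) by apply Cexp_neq_0.
intros H. assert (H2 : ((E - 1) * (E + 1))%C = RtoC 0).
{ transitivity (E * (E - / E))%C; [field; exact E0|rewrite H; ring]. }
assert (I : Im E = 0).
{ destruct (Ceq_dec (E - 1) 0) as [Z|Z].
  - replace E with (RtoC 1 + (E - 1))%C by ring. rewrite Z. simpl. ring.
  - destruct (Ceq_dec (E + 1) 0) as [Z'|Z'].
    + replace E with (- RtoC 1 + (E + 1))%C by ring. rewrite Z'. simpl. ring.
    + exfalso. apply (Cmult_neq_0 _ _ Z Z' H2). }
unfold E, Cexp in I. simpl in I.
assert (P : 0 < sin (PI * Re nu)) by (apply sin_gt_0; generalize PI_RGT_0; nra).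
replace (0 * (PI * snd nu + 0 * fst nu) + 1 * (PI * fst nu - 0 * snd nu)) with (PI * Re nu) in I by (unfold Re; ring).
match type of I with exp ?a * _ = _ => generalize (exp_pos a) end. intros. nra.
Qed.

(** Strong induction on N. [jump_PI] and [D_l_recursion] give both families the same triangular
    system with diagonal entry 1/E - E, which does not vanish. The bound N <= n is inherited from
    the truncation at n in [D_l]. *)
Lemma log_moment_value (n N : nat) (nu : C) : 0 < Re nu < 1 -> (N <= n)%nat ->
  log_moment nu N = ((-1) ^ N * RtoC PI * D_l n N nu)%C.
Proof.
intros Hnu. set (E := Cexp (Ci * (RtoC PI * nu))).
assert (E1 := sin_PI_nu_neq_0 nu Hnu). fold E in E1.
induction N as [N IH] using (well_founded_induction lt_wf). intros HN.
assert (A := jump_PI N nu Hnu). unfold jump in A.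
assert (B := D_l_recursion n N nu E HN eq_refl E1).
rewrite <- A in B. clear A.
replace (nu * (Ci * RtoC PI))%C with (Ci * (RtoC PI * nu))%C in B by ring.
rewrite Cexp_opp in B. fold E in B.
destruct N as [|N].
- rewrite !csum_0 in B. simpl bin in B. simpl Nat.sub in B. simpl (_ ^ 0)%C in B.
  apply (f_equal (fun z => (z / (/ E - E))%C)) in B.
  assert (E2 : (/ E - E)%C <> 0) by (intros Z; apply E1; replace (E - / E)%C with (- (/ E - E))%C by ring; rewrite Z; ring).
  simpl (cnat 1) in B. simpl (_ ^ 0)%C.
  transitivity (1 * ((/ E * 1 - E * 1) * log_moment nu 0) / (/ E - E))%C; [field; split; [apply Cexp_neq_0|] |].
  { intros Z. apply E2. transitivity ((1 - E * E) * / E)%C; [field; apply Cexp_neq_0|rewrite Z; ring]. }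
  rewrite <- B. field. split; [apply Cexp_neq_0|].
  intros Z. apply E2. transitivity ((1 - E * E) * / E)%C; [field; apply Cexp_neq_0|rewrite Z; ring].
- rewrite !csum_S in B. rewrite Nat.sub_diag, bin_diag in B. simpl (_ ^ 0)%C in B.
  rewrite (csum_ext _ (fun l => cnat (bin (S N) l) * ((/ E * (Ci * RtoC PI) ^ (S N - l) - E * (- (Ci * RtoC PI)) ^ (S N - l)) * log_moment nu l))%C) in B.
  2:{ intros m Hm. rewrite (IH m) by lia. reflexivity. }
  set (Sm := csum _ N) in B.
  apply (f_equal (fun z => ((z - Sm) / (/ E - E))%C)) in B.
  assert (E2 : (/ E - E)%C <> 0) by (intros Z; apply E1; replace (E - / E)%C with (- (/ E - E))%C by ring; rewrite Z; ring).
  assert (E3 : (1 - E * E)%C <> 0) by (intros Z; apply E2; transitivity ((1 - E * E) * / E)%C; [field; apply Cexp_neq_0|rewrite Z; ring]).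
  assert (E0 : E <> 0) by apply Cexp_neq_0.
  simpl (cnat 1) in B.
  transitivity ((Sm + 1 * ((/ E * 1 - E * 1) * log_moment nu (S N)) - Sm) / (/ E - E))%C; [field; split; assumption|].
  rewrite <- B. field. split; assumption.
Qed.

Lemma stieltjes_ones_Delta (n : nat) (nu w : C) : 0 < Re nu < 1 -> w <> 0 -> Rabs (Arg w) < PI ->
  is_CInt_gen (stieltjes_integrand ones n nu w) (at_right 0) (Rbar_locally p_infty) (Delta_n n nu w).
Proof.
intros Hnu Hw Ha.
assert (V := stieltjes_ones_value n nu (Log w) Hnu Ha). rewrite Cexp_Log in V by exact Hw.
replace (Delta_n n nu w) with (Cexp (- (nu * Log w)) * csum (fun l => cnat (bin n l) * (Log w ^ (n - l) * log_moment nu l)) n)%C; [exact V|].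
unfold Delta_n, Cpowc. rewrite Cexp_opp.
transitivity (/ Cexp (nu * Log w) * (RtoC PI * csum (fun l => (-1) ^ l * RtoC (Binomial.C n l) * Log w ^ (n - l) * D_l n l nu) n))%C.
- f_equal. rewrite <- csum_mult_l. apply csum_ext. intros l Hl. rewrite (log_moment_value n l nu Hnu Hl), bin_C by exact Hl. Cring.
- unfold Cdiv. Cring.
Qed.

(** * Conditionally convergent tails *)

Global Instance upto_proper (a : Rbar) : ProperFilter (upto a).
Proof. destruct a as [b| |]; [apply at_left_proper_filter|apply Rbar_locally_filter|apply Rbar_locally_filter]. Qed.

Lemma upto_between (r : R) (a : Rbar) : Rbar_lt r a -> upto a (fun b => r < b /\ Rbar_lt b a).
Proof.
destruct a as [b| |]; simpl; intros H; [|exists r; intros x Hx; split; [exact Hx|exact I]|contradiction].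
exists (mkposreal (b - r) ltac:(lra)). intros y Hy Hyb. change (Rabs (y - b) < b - r) in Hy.
apply Rabs_lt_between in Hy. lra.
Qed.

Lemma upto_near (a : Rbar) (P : R -> Prop) : Rbar_lt 0 a -> upto a P ->
  exists b0 : R, Rbar_lt b0 a /\ forall b, b0 < b -> Rbar_lt b a -> P b.
Proof.
destruct a as [c| |]; simpl; intros H HP; [|destruct HP as [m Hm]; exists m; split; [exact I|intros; apply Hm; assumption]|contradiction].
destruct HP as [eps HP]. exists (c - eps). split; [generalize (cond_pos eps); lra|].
intros b H1 H2. apply HP; [|exact H2]. change (Rabs (b - c) < eps). apply Rabs_lt_between. lra.
Qed.

Lemma filterlim_C_mult {T : Type} (F : (T -> Prop) -> Prop) {FF : Filter F} (f g : T -> C) (l m : C) :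
  filterlim f F (Clocally l) -> filterlim g F (Clocally m) ->
  filterlim (fun x => f x * g x)%C F (Clocally (l * m)%C).
Proof.
intros Hf Hg.
apply (filterlim_comp_2 (G := Clocally l) (H := Clocally m) f g Cmult); [exact Hf|exact Hg|].
assert (E : continuous (T := prod_UniformSpace C_UniformSpace C_UniformSpace) (U := C_UniformSpace) (fun p => fst p * snd p)%C (l, m)).
{ apply (continuous_Cmult (T := prod_UniformSpace C_UniformSpace C_UniformSpace) (fun p => fst p) (fun p => snd p)).
  - apply (continuous_fst (U := C_UniformSpace) (V := C_UniformSpace)).
  - apply (continuous_snd (U := C_UniformSpace) (V := C_UniformSpace)). }
intros P HP. assert (K := E P HP). unfold filtermap in *.
destruct K as [eps K].
apply (Filter_prod _ _ _ (ball (M := C_UniformSpace) l eps) (ball (M := C_UniformSpace) m eps)).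
- apply locally_ball.
- apply locally_ball.
- intros x y Hx Hy. apply (K (x, y)). split; assumption.
Qed.

Lemma filterlim_Rpower_upto (a : Rbar) (ka : R) : Rbar_lt 0 a -> 0 <= ka ->
  exists L, filterlim (fun t => Rpower t (- ka)) (upto a) (locally L).
Proof.
destruct a as [b| |]; simpl; intros Ha Hk; [|destruct Hk as [Hk|<-]|contradiction].
- exists (Rpower b (- ka)). intros P HP. assert (K := continuous_Rpower (- ka) b Ha P HP).
  unfold filtermap in *. destruct K as [e K]. exists e. intros y Hy _. apply K, Hy.
- exists 0. apply filterlim_Rpower_infty. lra.
- exists 1. apply (filterlim_ext_loc (fun _ => 1)); [|apply filterlim_const].
  exists 0. intros x Hx. rewrite Ropp_0, Rpower_O by exact Hx. reflexivity.
Qed.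

(** Dirichlet's test by parts: f has a convergent integral, and the derivative of chi is dominated
    by that of -K t^(-ka). M depends only on f, r and a, not on chi, K or ka, so infinitely many
    multipliers share it. The case ka = 0 forces chi to be constant beyond r. *)
Lemma dirichlet (a : Rbar) (r : R) (f : R -> C) (L : C) : 0 < r -> Rbar_lt r a ->
  (forall t, 0 < t -> Rbar_lt t a -> ccontinuous f t) ->
  filterlim (fun b => CInt f r b) (upto a) (Clocally L) ->
  exists M, 0 <= M /\ forall (chi dchi : R -> C) (K ka : R), 0 <= ka -> 0 <= K ->
   (forall t, r <= t -> Rbar_lt t a -> is_cderive chi t (dchi t) /\ ccontinuous dchi t /\
      Cmod (chi t) <= K * Rpower t (- ka) /\ Cmod (dchi t) <= K * (ka * Rpower t (- ka - 1))) ->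
   exists l : C, is_CInt_gen (fun t => chi t * f t)%C (at_point r) (upto a) l /\ Cmod l <= M * (K * Rpower r (- ka)).
Proof.
intros Hr Ha Hf HL.
assert (FF := upto_proper a).
assert (Ha0 : Rbar_lt 0 a) by (apply (Rbar_lt_trans 0 r a); [exact Hr|exact Ha]).
assert (Dconv : forall v t : R, Rbar_lt v a -> t <= v -> Rbar_lt t a).
{ intros v t Hv Ht. apply (Rbar_le_lt_trans t v a); [exact Ht|exact Hv]. }
set (F := fun b => CInt f r b) in *.
assert (HF : forall u v, 0 < u -> Rbar_lt u a -> 0 < v -> Rbar_lt v a -> is_CInt f u v (CInt f u v)).
{ intros u v Hu Hua Hv Hva. apply is_CInt_CInt. intros t Ht. apply Hf.
  - apply Rlt_le_trans with (2 := proj1 Ht). apply Rmin_glb_lt; assumption.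
  - destruct (Rle_dec u v); [rewrite Rmax_right in Ht by lra; apply (Dconv v); [assumption|apply Ht]|rewrite Rmax_left in Ht by lra; apply (Dconv u); [assumption|apply Ht]]. }
assert (dF : forall t, r <= t -> Rbar_lt t a -> is_cderive F t (f t)).
{ intros t Ht Hta. apply (is_derive_RInt (V := C_R_NormedModule) f F r t); [|apply Hf; [lra|exact Hta]].
  assert (L1 : locally t (fun y => 0 < y)) by (apply (open_gt 0); lra).
  assert (L2 : locally t (fun y => Rbar_lt y a)) by (apply open_Rbar_lt; exact Hta).
  generalize (filter_and _ _ L1 L2). apply filter_imp. intros y [Hy1 Hy2]. apply HF; assumption. }
(* The primitive is bounded: near a because it has a limit there, before that by the integral of |f|
   over a compact interval. *)
assert (BF : exists M, 0 <= M /\ forall t, r <= t -> Rbar_lt t a -> Cmod (F t) <= M).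
{ assert (N := proj1 (filterlim_C _ _ _) HL 1 Rlt_0_1).
  destruct (upto_near a _ Ha0 N) as [b0 [Hb0 Hb]].
  set (b1 := Rmax r b0).
  assert (Hb1 : Rbar_lt b1 a) by (unfold b1; apply Rmax_case; assumption).
  assert (Hrb : r <= b1) by apply Rmax_l.
  assert (IB : is_RInt (fun t => Cmod (f t)) r b1 (RInt (fun t => Cmod (f t)) r b1)).
  { apply is_RInt_continuous.
    intros t Ht. rewrite Rmin_left, Rmax_right in Ht by lra. apply continuous_Cmod, Hf; [lra|apply (Dconv b1); [exact Hb1|lra]]. }
  exists (Rmax (RInt (fun t => Cmod (f t)) r b1) (Cmod L + 1)). split.
  { eapply Rle_trans; [|apply Rmax_r]. generalize (Cmod_ge_0 L); lra. }
  intros t Ht Hta. destruct (Rle_dec t b1) as [H|H].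
  - eapply Rle_trans; [|apply Rmax_l].
    assert (IT : is_RInt (fun t => Cmod (f t)) r t (RInt (fun t => Cmod (f t)) r t)).
    { apply is_RInt_continuous.
      intros x Hx. rewrite Rmin_left, Rmax_right in Hx by lra. apply continuous_Cmod, Hf; [lra|apply (Dconv b1); [exact Hb1|lra]]. }
    assert (IU : is_RInt (fun t => Cmod (f t)) t b1 (RInt (fun t => Cmod (f t)) t b1)).
    { apply is_RInt_continuous.
      intros x Hx. rewrite Rmin_left, Rmax_right in Hx by lra. apply continuous_Cmod, Hf; [lra|apply (Dconv b1); [exact Hb1|lra]]. }
    apply Rle_trans with (RInt (fun t => Cmod (f t)) r t).
    + apply (is_CInt_Cmod_le f (fun t => Cmod (f t)) r t); [exact Ht|intros; apply Rle_refl|apply HF; try assumption; lra|exact IT].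
    + assert (CH := is_RInt_Chasles (V := R_NormedModule) _ _ _ _ _ _ IT IU).
      rewrite (is_RInt_unique (V := R_CompleteNormedModule) _ _ _ _ CH).
      assert (0 <= RInt (fun t => Cmod (f t)) t b1).
      { apply RInt_ge_0; [exact H|eexists; exact IU|intros; apply Cmod_ge_0]. }
      unfold plus; simpl. lra.
  - eapply Rle_trans; [|apply Rmax_r].
    assert (B := Hb t ltac:(unfold b1 in H; generalize (Rmax_r r b0); lra) Hta).
    replace (F t) with ((F t - L) + L)%C by ring. eapply Rle_trans; [apply Cmod_triangle|]. lra. }
destruct BF as [M [HM BF]].
(* One M for the boundary term chi F, the other for the integral of chi' F. *)
exists (2 * M). split; [lra|].
intros chi dchi K ka Hka HK H.
set (D := fun t => r <= t /\ Rbar_lt t a).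
set (g := fun t => K * (ka * Rpower t (- ka - 1))).
set (G := fun t => - (K * Rpower t (- ka))).
assert (HD : upto a D) by (generalize (upto_between r a Ha); apply filter_imp; intros b [H1 H2]; split; [lra|exact H2]).
assert (Dr : D r) by (split; [lra|exact Ha]).
assert (DD : forall u v t, D u -> D v -> u <= t <= v -> D t).
{ intros u v t [Hu _] [_ Hv] Ht. split; [lra|apply (Dconv v); [exact Hv|lra]]. }
destruct (filterlim_Rpower_upto a ka Ha0 Hka) as [L0 HL0].
assert (GL : filterlim G (upto a) (locally (- (K * L0)))).
{ apply (filterlim_comp _ _ _ (fun t => Rpower t (- ka)) (fun y => - (K * y)) _ (locally L0)); [exact HL0|].
  apply (continuous_of_derive (fun y => - (K * y))). auto_derive. exact I. }
assert (dG : forall t, D t -> is_derive G t (g t)).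
{ intros t [Ht _]. unfold G, g. replace (K * (ka * Rpower t (- ka - 1))) with (- (K * (- ka * Rpower t (- ka - 1)))) by ring.
  apply (is_derive_opp (K := R_AbsRing) (V := R_NormedModule) (fun t => K * Rpower t (- ka))).
  apply (is_derive_scal (fun t => Rpower t (- ka))). apply is_derive_Rpower. lra. }
assert (cg : forall t, D t -> continuous g t).
{ intros t [Ht _]. unfold g. apply (continuous_scal_r (V := R_NormedModule) K (fun t => ka * Rpower t (- ka - 1))).
  apply (continuous_scal_r (V := R_NormedModule) ka (fun t => Rpower t (- ka - 1))). apply continuous_Rpower. lra. }
destruct (CInt_dominated_gen (upto a) dchi G g D r _ HD Dr DD GL) as [l1 [_ [Hl1 _]]]; [|exact dG|exact cg| |].
{ intros t [H1 H2]. apply (H t H1 H2). }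
{ intros t [H1 H2]. apply (H t H1 H2). }
destruct (CInt_dominated_gen (upto a) (fun t => dchi t * F t)%C (fun t => M * G t) (fun t => M * g t) D r (M * - (K * L0)) HD Dr DD) as [l2 [_ [Hl2 Bl2]]].
{ apply (filterlim_comp _ _ _ G (fun y => M * y) _ (locally (- (K * L0)))); [exact GL|].
  apply (continuous_of_derive (fun y => M * y)). auto_derive. exact I. }
{ intros t [H1 H2]. apply continuous_Cmult; [apply (H t H1 H2)|eapply is_cderive_continuous, dF; assumption]. }
{ intros t Ht. apply (is_derive_scal G). apply dG, Ht. }
{ intros t Ht. apply (continuous_scal_r (V := R_NormedModule) M g). apply cg, Ht. }
{ intros t [H1 H2]. rewrite Cmod_mult, Rmult_comm. apply Rmult_le_compat; try apply Cmod_ge_0; [apply BF; assumption|apply (H t H1 H2)]. }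
assert (Hchi : forall b, D b -> chi b = (chi r + CInt dchi r b)%C).
{ intros b [H1 H2]. assert (E : is_CInt dchi r b (chi b - chi r)%C).
  { apply is_CInt_derive; intros t Ht; rewrite Rmin_left, Rmax_right in Ht by lra; apply H; try lra; apply (Dconv b); try assumption; lra. }
  rewrite (is_CInt_unique _ _ _ _ E). ring. }
assert (IBP : forall b, D b -> is_CInt (fun t => chi t * f t)%C r b (chi b * F b - CInt (fun t => dchi t * F t)%C r b)%C).
{ intros b [H1 H2].
  assert (Hb : forall t, Rmin r b <= t <= Rmax r b -> r <= t /\ Rbar_lt t a).
  { intros t Ht. rewrite Rmin_left, Rmax_right in Ht by lra. split; [lra|apply (Dconv b); [exact H2|lra]]. }
  assert (E : is_CInt (fun t => dchi t * F t + chi t * f t)%C r b (chi b * F b - chi r * F r)%C).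
  { apply (is_CInt_derive (fun t => chi t * F t)%C); intros t Ht; destruct (Hb t Ht) as [T1 T2]; destruct (H t T1 T2) as (X1 & X2 & _).
    - apply is_cderive_mult; [exact X1|apply dF; assumption].
    - apply continuous_Cplus; apply continuous_Cmult.
      + exact X2. + eapply is_cderive_continuous, dF; assumption. + eapply is_cderive_continuous, X1. + apply Hf; [lra|exact T2]. }
  assert (Z : F r = RtoC 0) by (apply is_CInt_unique, (is_RInt_point (V := C_R_NormedModule))).
  assert (E2 : is_CInt (fun t => dchi t * F t)%C r b (CInt (fun t => dchi t * F t)%C r b)).
  { apply is_CInt_CInt. intros t Ht; destruct (Hb t Ht) as [T1 T2]; destruct (H t T1 T2) as (X1 & X2 & _).
    apply continuous_Cmult; [exact X2|eapply is_cderive_continuous, dF; assumption]. }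
  assert (E3 := is_CInt_plus _ _ _ _ _ _ E (is_CInt_Cmult (- (1))%C _ _ _ _ E2)).
  rewrite Z in E3. eapply is_CInt_ext; [|replace (chi b * F b - CInt (fun t => dchi t * F t) r b)%C with (chi b * F b - chi r * 0 + - (1) * CInt (fun t => dchi t * F t) r b)%C; [exact E3|Cring]].
  intros t _. cbv beta. ring. }
(* chi itself has a limit at a, namely chi r + l1, because its derivative is absolutely
   integrable. *)
set (l := ((chi r + l1) * L + - (1) * l2)%C).
assert (LIM : filterlim (fun b => CInt (fun t => chi t * f t)%C r b) (upto a) (Clocally l)).
{ apply (filterlim_ext_loc (fun b => (chi r + CInt dchi r b) * F b + - (1) * CInt (fun t => dchi t * F t) r b)%C).
  - revert HD. apply filter_imp. intros b Db. rewrite (is_CInt_unique _ _ _ _ (IBP b Db)), <- Hchi by exact Db.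
    Cring.
  - apply filterlim_C_plus; [apply FF| |apply filterlim_C_mult_const; [apply FF|exact Hl2]].
    apply filterlim_C_mult; [apply FF| |exact HL]. apply filterlim_C_plus; [apply FF|apply filterlim_C_const; apply FF|exact Hl1]. }
exists l. split.
- apply is_CInt_gen_right; [apply FF| |exact LIM]. revert HD. apply filter_imp. intros b Db. eexists. apply IBP, Db.
- assert (P0 : 0 < Rpower r (- ka)) by apply Rpower_pos.
  assert (dec : forall t, r <= t -> Rpower t (- ka) <= Rpower r (- ka)).
  { intros t Ht. rewrite !Rpower_Ropp. apply Rinv_le_contravar; [apply Rpower_pos|apply Rle_Rpower_l; lra]. }
  assert (HL00 : 0 <= L0 <= Rpower r (- ka)).
  { assert (HD' : upto a (fun t => 0 <= Rpower t (- ka) <= Rpower r (- ka))).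
    { revert HD. apply filter_imp. intros t [Ht _]. split; [left; apply Rpower_pos|apply dec, Ht]. }
    split.
    - apply (filterlim_le (F := upto a) (fun _ => 0) (fun t => Rpower t (- ka)) 0 L0); [revert HD'; apply filter_imp; intros; lra|apply filterlim_const|exact HL0].
    - apply (filterlim_le (F := upto a) (fun t => Rpower t (- ka)) (fun _ => Rpower r (- ka)) L0 (Rpower r (- ka))); [revert HD'; apply filter_imp; intros; lra|exact HL0|apply filterlim_const]. }
  unfold l. eapply Rle_trans; [apply Cmod_triangle|].
  replace (2 * M * (K * Rpower r (- ka))) with (M * (K * Rpower r (- ka)) + M * (K * Rpower r (- ka))) by ring.
  apply Rplus_le_compat.
  + apply (filterlim_C_le (upto a) (fun b => (chi r + CInt dchi r b) * F b)%C).
    * apply filterlim_C_mult; [apply FF| |exact HL]. apply filterlim_C_plus; [apply FF|apply filterlim_C_const; apply FF|exact Hl1].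
    * revert HD. apply filter_imp. intros b Db. rewrite <- Hchi by exact Db. destruct Db as [H1 H2].
      rewrite Cmod_mult, Rmult_comm. apply Rmult_le_compat; try apply Cmod_ge_0; [apply BF; assumption|].
      eapply Rle_trans; [apply (H b H1 H2)|]. apply Rmult_le_compat_l; [exact HK|apply dec, H1].
  + rewrite Cmod_mult, Cmod_opp, Cmod_1, Rmult_1_l. eapply Rle_trans; [exact Bl2|].
    unfold G. replace (M * - (K * L0) - M * - (K * Rpower r (- ka))) with (M * (K * (Rpower r (- ka) - L0))) by ring.
    rewrite Rabs_pos_eq.
    * apply Rmult_le_compat_l; [exact HM|]. apply Rmult_le_compat_l; lra.
    * apply Rmult_le_pos; [exact HM|]. apply Rmult_le_pos; lra.
Qed.

(** * Tail integrals from the Mellin hypothesis *)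

Lemma Rbar_lt_of_le_real (v t : R) (a : Rbar) : Rbar_lt v a -> t <= v -> Rbar_lt t a.
Proof. intros Hv Ht. apply (Rbar_le_lt_trans t v a); [exact Ht|exact Hv]. Qed.

Lemma extension_continuous (a : Rbar) (k : R -> C) (kz : C -> C) (t : R) :
  complex_extension a k kz -> 0 < t -> Rbar_lt t a -> ccontinuous k t.
Proof.
intros H Ht Ha.
assert (D : is_cderive (fun s => kz (RtoC s)) t (cderiv kz (RtoC t) * 1)%C).
{ apply (C1_at_chain kz (cderiv kz) RtoC); [|apply is_cderive_id]. apply analytic_at_C1, H; [lra|exact Ha]. }
apply (continuous_ext_loc k (fun s => kz (RtoC s)) t); [|eapply is_cderive_continuous, D].
assert (L1 : locally t (fun y => 0 < y)) by (apply (open_gt 0); lra).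
assert (L2 : locally t (fun y => Rbar_lt y a)) by (apply open_Rbar_lt; exact Ha).
generalize (filter_and _ _ L1 L2). apply filter_imp. intros y [Hy1 Hy2]. apply H; [lra|exact Hy2].
Qed.

Lemma is_CInt_continuous_upto (a : Rbar) (f : R -> C) (u v : R) :
  (forall t, 0 < t -> Rbar_lt t a -> ccontinuous f t) ->
  0 < u -> Rbar_lt u a -> 0 < v -> Rbar_lt v a -> is_CInt f u v (CInt f u v).
Proof.
intros Hf Hu Hua Hv Hva. apply is_CInt_CInt. intros t Ht. apply Hf.
- apply Rlt_le_trans with (2 := proj1 Ht). apply Rmin_glb_lt; assumption.
- apply (Rbar_lt_of_le_real (Rmax u v)); [apply Rmax_case; assumption|apply Ht].
Qed.

(** Two upper ends near a are compared through a common lower end u near 0: the integrals from r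
    differ exactly as those from u, and both of the latter are close to l. *)
Lemma is_CInt_gen_tail_lim (a : Rbar) (f : R -> C) (r : R) (l : C) :
  (forall t, 0 < t -> Rbar_lt t a -> ccontinuous f t) -> 0 < r -> Rbar_lt r a ->
  is_CInt_gen f (at_right 0) (upto a) l ->
  exists L, filterlim (fun b => CInt f r b) (upto a) (Clocally L).
Proof.
intros Hf Hr Ha H. assert (FF := upto_proper a).
apply filterlim_C_cauchy; [exact FF|]. intros eps He.
assert (LL := locally_Cmod_lt l (eps / 2) ltac:(lra)).
destruct (H _ LL) as [Q Q' HQ HQ' HH].
destruct (filter_ex (F := at_right 0) _ (filter_and _ _ HQ (at_right_0_le r Hr))) as [u [Qu Hu]].
assert (Hua : Rbar_lt u a) by (apply (Rbar_lt_of_le_real r); [exact Ha|lra]).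
exists (fun b => Q' b /\ r < b /\ Rbar_lt b a). split; [apply filter_and; [exact HQ'|apply upto_between, Ha]|].
intros b b' (Hb & Hb1 & Hb2) (Hb' & Hb1' & Hb2').
destruct (HH u b Qu Hb) as [y [Y1 Y2]]. destruct (HH u b' Qu Hb') as [y' [Y1' Y2']]. simpl in Y1, Y1'.
assert (I : is_CInt f r u (CInt f r u)) by (apply (is_CInt_continuous_upto a); try assumption; lra).
rewrite (is_CInt_unique _ _ _ _ (is_RInt_Chasles (V := C_R_NormedModule) _ _ _ _ _ _ I Y1)).
rewrite (is_CInt_unique _ _ _ _ (is_RInt_Chasles (V := C_R_NormedModule) _ _ _ _ _ _ I Y1')).
match goal with |- Cmod ?z < _ => replace z with ((y - l) + - (y' - l))%C end.
- eapply Rle_lt_trans; [apply Cmod_triangle|]. rewrite Cmod_opp. lra.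
- change ((y - l) + - (y' - l) = (CInt f r u + y) - (CInt f r u + y'))%C. Cring.
Qed.

(** Extracts one conditionally convergent tail, at a real exponent inside the strip of the Mellin
    transform; [dirichlet] carries it to all other weights. *)
Lemma mellin_tail (a : Rbar) (k : R -> C) (r : R) : class_K a k ->
  (forall t, 0 < t -> Rbar_lt t a -> ccontinuous k t) -> 0 < r -> Rbar_lt r a ->
  exists lambda : R, lambda < 1 /\ exists L,
    filterlim (fun b => CInt (fun t => k t * Cpowc (RtoC t) (- RtoC lambda))%C r b) (upto a) (Clocally L).
Proof.
intros (_ & _ & d & Hd & _ & HM) Hk Hr Ha.
assert (E : exists lambda : R, lambda < 1 /\ Rbar_lt d lambda).
{ destruct d as [d| |]; simpl in *; [exists ((d + 1) / 2); lra|contradiction|exists 0; split; [lra|exact I]]. }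
destruct E as [lambda [Hl1 Hl2]]. exists lambda; split; [exact Hl1|].
destruct (HM (RtoC lambda) Hl2 Hl1) as [l Hl].
apply (is_CInt_gen_tail_lim a _ r l); try assumption.
intros t Ht Hta. apply continuous_Cmult; [apply Hk; assumption|apply continuous_Cpowc, Ht].
Qed.

Lemma is_CInt_gen_right_lim (a : Rbar) (f : R -> C) (r : R) (l : C) :
  is_CInt_gen f (at_point r) (upto a) l -> filterlim (fun b => CInt f r b) (upto a) (Clocally l).
Proof.
intros H. assert (FF := upto_proper a).
destruct (is_CInt_gen_filterlim (at_point r) (upto a) (upto a) f (fun _ => r) (fun b => b) l H) as [_ L]; [|apply filterlim_id|exact L].
intros P HP. unfold filtermap. apply filter_forall. intros _. exact HP.
Qed.

(** The multiplier that changes t^(-lambda) into t^(-1-nu) ln^n t is ln^n t times t^(lambda-1-nu),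
    whose exponent has real part below -Re nu because lambda < 1. *)
Lemma log_tail (a : Rbar) (k : R -> C) (n : nat) (nu : C) (r : R) : class_K a k -> 0 < Re nu ->
  (forall t, 0 < t -> Rbar_lt t a -> ccontinuous k t) -> 0 < r -> Rbar_lt r a ->
  exists L, filterlim (fun b => CInt (fun t => / RtoC t * (k t * log_weight n nu t))%C r b) (upto a) (Clocally L).
Proof.
intros HK Hnu Hk Hr Ha.
destruct (mellin_tail a k r HK Hk Hr Ha) as [lam [Hlam [L HL]]].
destruct (dirichlet a r _ L Hr Ha (fun t Ht Hta => continuous_Cmult _ _ t (Hk t Ht Hta) (continuous_Cpowc t _ Ht)) HL) as [M [HM H]].
set (sg := Re nu) in *.
set (s := (RtoC lam - 1 - nu)%C).
assert (Hs : Re s = lam - 1 - sg).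
{ unfold s, Cminus. rewrite !re_plus, !re_opp, !re_RtoC. unfold sg. ring. }
destruct (ln_pow_tail r (sg / 2) n Hr ltac:(lra)) as [K1 [HK1 H1]].
destruct (ln_pow_tail r (sg / 2) (pred n) Hr ltac:(lra)) as [K2 [HK2 H2]].
(* The decay left after half of Re nu has been given to the logarithms. *)
set (ka := 1 + sg / 2 - lam). assert (Hka : 0 < ka) by (unfold ka; lra).
set (chi := fun t => (RtoC (ln t) ^ n * Cpowc (RtoC t) s)%C).
set (dchi := fun t => (cnat n * RtoC (ln t) ^ pred n * / RtoC t * Cpowc (RtoC t) s + RtoC (ln t) ^ n * (s * Cpowc (RtoC t) s / RtoC t))%C).
assert (HA : 0 <= INR n * K2 + Cmod s * K1).
{ apply Rplus_le_le_0_compat; apply Rmult_le_pos; try apply pos_INR; try apply Cmod_ge_0; lra. }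
(* [dirichlet] wants the derivative below K ka t^(-ka-1), whence the division by ka. *)
set (K := K1 + (INR n * K2 + Cmod s * K1) / ka).
assert (HKK : K1 <= K) by (unfold K; assert (0 <= (INR n * K2 + Cmod s * K1) / ka) by (apply Rdiv_le_0_compat; lra); lra).
destruct (H chi dchi K ka) as [l [Hl _]]; [lra|lra| |].
- intros t Ht Hta. assert (Ht0 : 0 < t) by lra.
  assert (Ht1 : RtoC t <> 0) by (apply RtoC_neq_0; lra).
  split; [|split; [|split]].
  + unfold chi, dchi. eapply is_cderive_eq.
    * apply is_cderive_mult; [apply is_cderive_pow, is_cderive_ln, Ht0|apply is_cderive_Cpowc, Ht0].
    * cbv beta. reflexivity.
  + unfold dchi. assert (cl := continuous_Cln t Ht0). assert (cp := continuous_Cpowc t s Ht0).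
    assert (ci : ccontinuous (fun t => / RtoC t)%C t) by (apply continuous_Cinv; [apply continuous_CRtoC|exact Ht1]).
    apply continuous_Cplus.
    * apply continuous_Cmult; [|exact cp]. apply continuous_Cmult; [|exact ci]. apply continuous_Cmult; [apply continuous_Cconst|apply continuous_Cpow, cl].
    * apply continuous_Cmult; [apply continuous_Cpow, cl|]. apply continuous_Cmult; [|exact ci]. apply continuous_Cmult; [apply continuous_Cconst|exact cp].
  + unfold chi. rewrite Cmod_mult, Cmod_pow, Cmod_R, Cmod_Cpowc_pos, Hs by exact Ht0.
    apply Rle_trans with (K1 * Rpower t (- ka)); [|apply Rmult_le_compat_r; [left; apply Rpower_pos|exact HKK]].
    replace (- ka) with (sg / 2 + (lam - 1 - sg)) by (unfold ka; field). rewrite Rpower_plus, <- Rmult_assoc.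
    apply Rmult_le_compat_r; [left; apply Rpower_pos|apply H1, Ht].
  + assert (E : Rpower t (- ka - 1) = Rpower t (sg / 2) * Rpower t (lam - 1 - sg) * / t).
    { rewrite <- Rpower_plus. replace (- ka - 1) with ((sg / 2 + (lam - 1 - sg)) + - (1)) by (unfold ka; field).
      rewrite (Rpower_plus _ (- (1))), (Rpower_Ropp t 1), Rpower_1 by exact Ht0. reflexivity. }
    apply Rle_trans with ((INR n * K2 + Cmod s * K1) * Rpower t (- ka - 1)).
    2:{ rewrite <- Rmult_assoc. apply Rmult_le_compat_r; [left; apply Rpower_pos|].
        unfold K. replace ((K1 + (INR n * K2 + Cmod s * K1) / ka) * ka) with (K1 * ka + (INR n * K2 + Cmod s * K1)) by (field; lra).
        assert (0 < K1 * ka) by (apply Rmult_lt_0_compat; lra). lra. }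
    unfold dchi. eapply Rle_trans; [apply Cmod_triangle|]. rewrite Rmult_plus_distr_r. rewrite E.
    assert (it : 0 < / t) by (apply Rinv_0_lt_compat; exact Ht0).
    assert (pt := Rpower_pos t (lam - 1 - sg)).
    assert (Q1 := H1 t Ht). assert (Q2 := H2 t Ht).
    apply Rplus_le_compat.
    * rewrite !Cmod_mult, Cmod_inv, !Cmod_pow, !Cmod_R, Cmod_Cpowc_pos, Hs, (Rabs_pos_eq t), (Rabs_pos_eq (INR n)) by (try apply pos_INR; try exact Ht1; lra).
      replace (INR n * K2 * (Rpower t (sg / 2) * Rpower t (lam - 1 - sg) * / t)) with (INR n * (K2 * Rpower t (sg / 2)) * / t * Rpower t (lam - 1 - sg)) by ring.
      apply Rmult_le_compat_r; [lra|]. apply Rmult_le_compat_r; [lra|]. apply Rmult_le_compat_l; [apply pos_INR|exact Q2].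
    * unfold Cdiv. rewrite !Cmod_mult, Cmod_inv, !Cmod_pow, !Cmod_R, Cmod_Cpowc_pos, Hs, (Rabs_pos_eq t) by (try exact Ht1; lra).
      replace (Cmod s * K1 * (Rpower t (sg / 2) * Rpower t (lam - 1 - sg) * / t)) with ((K1 * Rpower t (sg / 2)) * (Cmod s * Rpower t (lam - 1 - sg) * / t)) by ring.
      apply Rmult_le_compat_r; [|exact Q1]. apply Rmult_le_pos; [apply Rmult_le_pos; [apply Cmod_ge_0|lra]|lra].
- exists l. apply is_CInt_gen_right_lim in Hl.
  apply (filterlim_ext_loc) with (2 := Hl).
  generalize (upto_between r a Ha). apply filter_imp. intros b [Hb1 Hb2].
  apply (RInt_ext (V := C_R_CompleteNormedModule)). intros t Ht. rewrite Rmin_left, Rmax_right in Ht by lra.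
  assert (Ht0 : 0 < t) by lra. assert (Ht1 : RtoC t <> 0) by (apply RtoC_neq_0; lra).
  unfold chi, log_weight.
  assert (N1 := Cpowc_pos_neq_0 t nu Ht0). assert (N2 := Cpowc_pos_neq_0 t (RtoC lam) Ht0).
  assert (I : forall z, Cpowc (RtoC t) (- z) = (/ Cpowc (RtoC t) z)%C).
  { intros z. rewrite !Cpowc_pos by exact Ht0. rewrite <- Cexp_opp. f_equal. ring. }
  unfold s, Cminus. rewrite !Cpowc_pos_plus, !I by exact Ht0.
  replace (Cpowc (RtoC t) 1) with (RtoC t) by (symmetry; assert (Z := Cpowc_pos_INR t 1 Ht0); simpl INR in Z; rewrite Z; ring).
  Cfield. repeat split; assumption.
Qed.

(** Both families come from one tail, with weight t^(-1-nu) ln^n t, through the multipliers t^(-j)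
    and t^(-j) / (w + t). For t >= r > |w| one has |w + t| >= (1 - |w| / r) t. As M is common to all
    j, the second family is geometrically bounded. *)
Lemma tail_integrals (a : Rbar) (k : R -> C) (n : nat) (nu : C) (r : R) : class_K a k -> 0 < Re nu ->
  (forall t, 0 < t -> Rbar_lt t a -> ccontinuous k t) -> 0 < r -> Rbar_lt r a ->
  (exists tau : nat -> C, forall j, is_CInt_gen (fun t => / RtoC t ^ S j * (k t * log_weight n nu t))%C (at_point r) (upto a) (tau j)) /\
  forall w, Cmod w < r -> exists (M : R) (sigma : nat -> C), 
    forall j, is_CInt_gen (fun t => / RtoC t ^ S j * / (w + RtoC t) * (k t * log_weight n nu t))%C (at_point r) (upto a) (sigma j) /\
      Cmod (sigma j) <= M * / r ^ S j.
Proof.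
intros HK Hnu Hk Hr Ha.
destruct (log_tail a k n nu r HK Hnu Hk Hr Ha) as [L HL].
assert (Hf : forall t, 0 < t -> Rbar_lt t a -> ccontinuous (fun t => / RtoC t * (k t * log_weight n nu t))%C t).
{ intros t Ht Hta. apply continuous_Cmult; [apply continuous_Cinv; [apply continuous_CRtoC|apply RtoC_neq_0; lra]|].
  apply continuous_Cmult; [apply Hk; assumption|apply continuous_log_weight, Ht]. }
destruct (dirichlet a r _ L Hr Ha Hf HL) as [M [HM H]].
assert (FFr : Filter (at_point r)) by apply at_point_filter.
assert (FFa : Filter (upto a)) by apply upto_proper.
assert (RP : forall t (j : nat), 0 < t -> Rpower t (- INR j) = / t ^ j).
{ intros t j Ht. rewrite Rpower_Ropp, Rpower_pow by exact Ht. reflexivity. }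
assert (RP1 : forall t (j : nat), 0 < t -> Rpower t (- INR j - 1) = / t ^ S j).
{ intros t j Ht. replace (- INR j - 1) with (- INR (S j)) by (rewrite S_INR; ring). apply RP, Ht. }
assert (EX : forall (f g : R -> C) l, (forall t, r <= t -> f t = g t) -> is_CInt_gen f (at_point r) (upto a) l -> is_CInt_gen g (at_point r) (upto a) l).
{ intros f g l E. apply (CInt_gen_ext).
  apply (Filter_prod _ _ _ (fun x => x = r) (fun b => r < b /\ Rbar_lt b a)); [reflexivity|apply upto_between, Ha|].
  intros x b -> [Hb _] t [Ht _]. apply E. simpl in Ht. rewrite Rmin_left in Ht; lra. }
split.
- assert (T : forall j, exists l : C, is_CInt_gen (fun t => / RtoC t ^ S j * (k t * log_weight n nu t))%C (at_point r) (upto a) l).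
  { intros j. destruct (H (fun t => / RtoC t ^ j)%C (fun t => - (cnat j * RtoC t ^ pred j * 1 / (RtoC t ^ j * RtoC t ^ j)))%C 1 (INR j)) as [l [Hl _]].
    - apply pos_INR.
    - lra.
    - intros t Ht Hta. assert (Ht1 : RtoC t <> 0) by (apply RtoC_neq_0; lra).
      assert (Ht2 : forall i, 0 < t ^ i) by (intros; apply pow_lt; lra).
      split; [|split; [|split]].
      + apply (is_cderive_inv (fun t => RtoC t ^ j)%C); [apply is_cderive_pow, is_cderive_id|apply Cpow_nz, Ht1].
      + apply continuous_Copp, continuous_Cmult.
        * apply continuous_Cmult; [|apply continuous_Cconst]. apply continuous_Cmult; [apply continuous_Cconst|apply continuous_Cpow, continuous_CRtoC].
        * apply continuous_Cinv; [|apply Cmult_neq_0; apply Cpow_nz, Ht1]. apply continuous_Cmult; apply continuous_Cpow, continuous_CRtoC.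
      + rewrite Cmod_inv, Cmod_pow, Cmod_R, Rabs_pos_eq, RP by (try apply Cpow_nz, Ht1; lra). lra.
      + rewrite Cmod_opp, Cmod_div, !Cmod_mult, !Cmod_pow, !Cmod_R, !(Rabs_pos_eq t), (Rabs_pos_eq (INR j)), (Rabs_pos_eq 1), RP1 by (try apply pos_INR; try apply Cmult_neq_0; try apply Cpow_nz, Ht1; lra).
        right. destruct j as [|j]; [simpl; field; lra|]. simpl pred. simpl pow. field. split; [apply pow_nonzero; lra|lra].
    - exists l. apply EX with (2 := Hl). intros t Ht. assert (Ht1 : RtoC t <> 0) by (apply RtoC_neq_0; lra).
      rewrite Cpow_S. field. split; [apply Cpow_nz, Ht1|exact Ht1]. }
  exists (fun j => CInt_gen (fun t => / RtoC t ^ S j * (k t * log_weight n nu t))%C (at_point r) (upto a)).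
  intros j. apply (CInt_gen_correct); apply T.
- intros w Hw.
  set (c1 := 1 - Cmod w / r).
  assert (Hc1 : 0 < c1).
  { unfold c1. assert (Cmod w / r < 1); [|lra]. apply Rmult_lt_reg_r with r; [exact Hr|]. unfold Rdiv. rewrite Rmult_assoc, Rinv_l by lra. lra. }
  assert (Hc1' : c1 <= 1) by (unfold c1; assert (0 <= Cmod w / r) by (apply Rdiv_le_0_compat; [apply Cmod_ge_0|lra]); lra).
  assert (low : forall t, r <= t -> c1 * t <= Cmod (w + RtoC t)).
  { intros t Ht. assert (T := Cmod_triangle (w + RtoC t) (- w)). replace (w + RtoC t + - w)%C with (RtoC t) in T by ring.
    rewrite Cmod_R, Rabs_pos_eq, Cmod_opp in T by lra.
    assert (Cmod w <= Cmod w / r * t).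
    { replace (Cmod w) with (Cmod w / r * r) at 1 by (field; lra). apply Rmult_le_compat_l; [apply Rdiv_le_0_compat; [apply Cmod_ge_0|lra]|exact Ht]. }
    unfold c1. lra. }
  assert (Nw : forall t, r <= t -> (w + RtoC t)%C <> 0).
  { intros t Ht E. specialize (low t Ht). rewrite E, Cmod_0 in low. assert (0 < c1 * t) by (apply Rmult_lt_0_compat; lra). lra. }
  assert (inv1 : forall t, r <= t -> / Cmod (w + RtoC t) <= / c1 * / t).
  { intros t Ht. rewrite <- Rinv_mult. apply Rinv_le_contravar; [apply Rmult_lt_0_compat; lra|apply low, Ht]. }
  (* 1 / (w + t) counts as one more power of 1/t, so the decay exponent is j + 1. The derivative is
     at most (j / c1 + 1 / c1^2) t^(-j-2), which lies below K (j + 1) t^(-j-2). *)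
  set (K := / c1 + / c1 * / c1).
  assert (ic : 0 < / c1) by (apply Rinv_0_lt_compat; exact Hc1).
  assert (icc : 0 < / c1 * / c1) by (apply Rmult_lt_0_compat; exact ic).
  assert (T : forall j, exists l : C, is_CInt_gen (fun t => / RtoC t ^ S j * / (w + RtoC t) * (k t * log_weight n nu t))%C (at_point r) (upto a) l /\ Cmod l <= M * (K * Rpower r (- INR (S j)))).
  { intros j. destruct (H (fun t => / RtoC t ^ j * / (w + RtoC t))%C
     (fun t => - (cnat j * RtoC t ^ pred j * 1 / (RtoC t ^ j * RtoC t ^ j)) * / (w + RtoC t) + / RtoC t ^ j * - ((0 + 1) / ((w + RtoC t) * (w + RtoC t))))%C K (INR (S j))) as [l [Hl Bl]].
    - apply pos_INR.
    - unfold K; lra.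
    - intros t Ht Hta. assert (Ht1 : RtoC t <> 0) by (apply RtoC_neq_0; lra). assert (Nt := Nw t Ht). assert (I1 := inv1 t Ht).
      assert (Ht2 : forall i, 0 < / t ^ i) by (intros; apply Rinv_0_lt_compat, pow_lt; lra).
      assert (cw : ccontinuous (fun t => w + RtoC t)%C t) by (apply continuous_Cplus; [apply continuous_Cconst|apply continuous_CRtoC]).
      assert (it : 0 < / t) by (apply Rinv_0_lt_compat; lra).
      assert (iw : 0 < / Cmod (w + RtoC t)) by (apply Rinv_0_lt_compat, Cmod_gt_0, Nt).
      split; [|split; [|split]].
      + apply is_cderive_mult.
        * apply (is_cderive_inv (fun t => RtoC t ^ j)%C); [apply is_cderive_pow, is_cderive_id|apply Cpow_nz, Ht1].
        * apply (is_cderive_inv (fun t => w + RtoC t)%C); [apply is_cderive_plus; [apply is_cderive_const|apply is_cderive_id]|exact Nt].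
      + apply continuous_Cplus; apply continuous_Cmult.
        * apply continuous_Copp, continuous_Cmult.
          -- apply continuous_Cmult; [|apply continuous_Cconst]. apply continuous_Cmult; [apply continuous_Cconst|apply continuous_Cpow, continuous_CRtoC].
          -- apply continuous_Cinv; [|apply Cmult_neq_0; apply Cpow_nz, Ht1]. apply continuous_Cmult; apply continuous_Cpow, continuous_CRtoC.
        * apply continuous_Cinv; [exact cw|exact Nt].
        * apply continuous_Cinv; [apply continuous_Cpow, continuous_CRtoC|apply Cpow_nz, Ht1].
        * apply continuous_Copp, continuous_Cmult; [apply continuous_Cconst|]. apply continuous_Cinv; [apply continuous_Cmult; exact cw|apply Cmult_neq_0; exact Nt].
      + rewrite Cmod_mult, !Cmod_inv, Cmod_pow, Cmod_R, Rabs_pos_eq, RP by (try apply Cpow_nz, Ht1; try exact Nt; lra).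
        apply Rle_trans with (/ t ^ j * (/ c1 * / t)); [apply Rmult_le_compat_l; [left; apply Ht2|exact I1]|].
        simpl pow. rewrite Rinv_mult. unfold K. assert (0 < / t ^ j * / t) by (apply Rmult_lt_0_compat; [apply Ht2|exact it]). nra.
      + rewrite RP1 by lra. eapply Rle_trans; [apply Cmod_triangle|].
        rewrite !Cmod_mult, !Cmod_opp, !Cmod_div, !Cmod_inv, !Cmod_mult, !Cmod_pow, !Cmod_R, !(Rabs_pos_eq t), (Rabs_pos_eq (INR j)), (Rabs_pos_eq 1)
          by (try apply pos_INR; try apply Cmult_neq_0; try apply Cpow_nz; try exact Ht1; try exact Nt; lra).
        replace (Cmod (0 + 1)) with 1 by (rewrite Cplus_0_l, Cmod_1; reflexivity).
        apply Rle_trans with (INR j * / t ^ S j * (/ c1 * / t) + / t ^ j * ((/ c1 * / t) * (/ c1 * / t))).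
        * apply Rplus_le_compat.
          -- replace (INR j * t ^ pred j * 1 / (t ^ j * t ^ j)) with (INR j * / t ^ S j).
             2:{ destruct j as [|j]; [simpl; field; lra|]. simpl pred. simpl pow. field. split; [apply pow_nonzero; lra|lra]. }
             apply Rmult_le_compat_l; [|exact I1]. apply Rmult_le_pos; [apply pos_INR|left; apply Ht2].
          -- apply Rmult_le_compat_l; [left; apply Ht2|]. unfold Rdiv. rewrite Rmult_1_l, Rinv_mult. apply Rmult_le_compat; lra.
        * rewrite S_INR. unfold K. set (x := INR j). assert (Hx : 0 <= x) by apply pos_INR.
          replace (x * / t ^ S j * (/ c1 * / t) + / t ^ j * (/ c1 * / t * (/ c1 * / t))) with ((x * / c1 + / c1 * / c1) * / t ^ S (S j)).
          2:{ simpl pow. field. repeat split; try lra. apply pow_nonzero; lra. }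
          rewrite <- Rmult_assoc. apply Rmult_le_compat_r; [left; apply Ht2|]. nra.
    - exists l. split; [|exact Bl]. apply EX with (2 := Hl). intros t Ht. assert (Ht1 : RtoC t <> 0) by (apply RtoC_neq_0; lra).
      rewrite Cpow_S. field. repeat split; first [exact (Nw t Ht)|exact Ht1|apply Cpow_nz, Ht1]. }
  exists (M * K), (fun j => CInt_gen (fun t => / RtoC t ^ S j * / (w + RtoC t) * (k t * log_weight n nu t))%C (at_point r) (upto a)).
  intros j. destruct (T j) as [l [Hl Bl]].
  assert (E : CInt_gen (fun t => / RtoC t ^ S j * / (w + RtoC t) * (k t * log_weight n nu t))%C (at_point r) (upto a) = l).
  { apply (CInt_gen_value); exact Hl. }
  rewrite E. split; [exact Hl|]. rewrite RP in Bl by exact Hr. rewrite Rmult_assoc. exact Bl.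
Qed.

(** * Finite parts *)

(** An antiderivative of t^(s-1) ln^n t, obtained by parts in n and without a constant term. For Re
    s < 0 all its terms diverge at 0 and vanish at infinity; the first fact makes it invisible to
    finite parts, the second identifies its value at r with a tail integral. *)
Fixpoint log_prim (n : nat) (s : C) (t : R) : C :=
  match n with
  | O => (Cpowc (RtoC t) s / s)%C
  | S m => ((RtoC (ln t) ^ n * Cpowc (RtoC t) s - cnat n * log_prim m s t) / s)%C
  end.

Lemma log_prim_S (n : nat) (s : C) (t : R) :
  log_prim (S n) s t = ((RtoC (ln t) ^ S n * Cpowc (RtoC t) s - cnat (S n) * log_prim n s t) / s)%C.
Proof. reflexivity. Qed.

Lemma is_cderive_log_prim (n : nat) (s : C) (t : R) : 0 < t -> s <> 0 ->
  is_cderive (log_prim n s) t (RtoC (ln t) ^ n * Cpowc (RtoC t) s / RtoC t)%C.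
Proof.
intros Ht Hs. assert (Ht1 : RtoC t <> 0) by (apply RtoC_neq_0; lra).
induction n as [|n IH].
- unfold log_prim, Cdiv. eapply is_cderive_eq.
  + apply is_cderive_mult; [apply is_cderive_Cpowc, Ht|apply is_cderive_const].
  + cbv beta. simpl. field. split; assumption.
- apply (is_derive_ext (fun t => (RtoC (ln t) ^ S n * Cpowc (RtoC t) s + - (cnat (S n) * log_prim n s t)) * / s)%C); [intros; reflexivity|].
  eapply is_cderive_eq.
  + apply is_cderive_mult; [|apply is_cderive_const]. apply is_cderive_plus.
    * apply is_cderive_mult; [apply is_cderive_pow, is_cderive_ln, Ht|apply is_cderive_Cpowc, Ht].
    * apply is_cderive_opp, is_cderive_mult; [apply is_cderive_const|exact IH].
  + cbv beta. simpl pred. field. split; assumption.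
Qed.

Lemma fp_term_no_limit (mu : C) (m : nat) : Re mu < 0 ->
  ~ (exists l : C, filterlim (fp_term mu m) (at_right 0) (Clocally l)).
Proof.
intros Hmu [l Hl].
assert (A := proj1 (filterlim_C _ _ _) Hl 1 Rlt_0_1).
set (B := Cmod l + 1). assert (HB : 0 < B) by (unfold B; generalize (Cmod_ge_0 l); lra).
(* Below e^(-1) the logarithm has modulus at least 1 and cannot spoil the growth of eps^mu, which
   exceeds B below B^(1 / Re mu). *)
set (d := Rmin (exp (-1)) (Rpower B (/ Re mu))).
assert (Hd : 0 < d) by (apply Rmin_pos; [apply exp_pos|apply Rpower_pos]).
destruct (filter_ex _ (filter_and _ _ A (at_right_0_le d Hd))) as [e [He1 He2]].
assert (E1 : e <= exp (-1)) by (eapply Rle_trans; [apply He2|apply Rmin_l]).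
assert (E2 : e <= Rpower B (/ Re mu)) by (eapply Rle_trans; [apply He2|apply Rmin_r]).
assert (L : 1 <= Rabs (ln e)).
{ assert (ln e <= -1). { rewrite <- (ln_exp (-1)). destruct E1 as [E1| ->]; [left; apply ln_increasing; lra|lra]. }
  rewrite Rabs_left; lra. }
assert (G : B <= Cmod (fp_term mu m e)).
{ unfold fp_term. rewrite Cmod_mult, Cmod_pow, Cmod_R, Cmod_Cpowc_pos by lra.
  assert (P : B <= Rpower e (Re mu)).
  { replace B with (Rpower (Rpower B (/ Re mu)) (Re mu)).
    - replace (Re mu) with (- - Re mu) by ring. rewrite !(Rpower_Ropp _ (- Re mu)).
      rewrite Ropp_involutive. apply Rinv_le_contravar; [apply Rpower_pos|]. apply Rle_Rpower_l; lra.
    - rewrite Rpower_mult. replace (/ Re mu * Re mu) with 1 by (field; lra). apply Rpower_1, HB. }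
  assert (1 <= Rabs (ln e) ^ m) by (apply pow_R1_Rle; exact L). nra. }
assert (T : Cmod (fp_term mu m e) <= Cmod (fp_term mu m e - l) + Cmod l).
{ replace (fp_term mu m e) with ((fp_term mu m e - l) + l)%C at 1 by ring. apply Cmod_triangle. }
unfold B in G. lra.
Qed.

Lemma divergent_log_prim (n : nat) (s c : C) (D : R -> C) : Re s < 0 -> divergent_group D ->
  exists D', divergent_group D' /\ forall eps, D' eps = (c * log_prim n s eps + D eps)%C.
Proof.
intros Hs. revert c D. induction n as [|n IH]; intros c D HD.
- exists (fun eps => c / s * fp_term s 0 eps + D eps)%C. split.
  + apply divergent_cons; [apply fp_term_no_limit, Hs|exact HD].
  + intros eps. unfold fp_term, log_prim, Cdiv. simpl. ring.
- destruct (IH (- (c / s * cnat (S n)))%C D HD) as [D1 [HD1 E1]].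
  exists (fun eps => c / s * fp_term s (S n) eps + D1 eps)%C. split.
  + apply divergent_cons; [apply fp_term_no_limit, Hs|exact HD1].
  + intros eps. rewrite E1. unfold fp_term. rewrite log_prim_S. unfold Cdiv. ring.
Qed.

Lemma log_prim_infty (n : nat) (s : C) : Re s < 0 ->
  filterlim (log_prim n s) (Rbar_locally p_infty) (Clocally (RtoC 0)).
Proof.
intros Hs.
assert (T : forall m, filterlim (fun t => RtoC (ln t) ^ m * Cpowc (RtoC t) s)%C (Rbar_locally p_infty) (Clocally (RtoC 0))).
{ intros m. destruct (ln_pow_tail 1 (- Re s / 2) m Rlt_0_1 ltac:(lra)) as [K [HK H]].
  apply (filterlim_C_squeeze _ _ _ (fun t => K * Rpower t (Re s / 2))).
  - exists 1. intros t Ht. replace (RtoC (ln t) ^ m * Cpowc (RtoC t) s - 0)%C with (RtoC (ln t) ^ m * Cpowc (RtoC t) s)%C by ring.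
    rewrite Cmod_mult, Cmod_pow, Cmod_R, Cmod_Cpowc_pos by lra.
    replace (Re s / 2) with (- Re s / 2 + Re s) by field. rewrite Rpower_plus, <- Rmult_assoc.
    apply Rmult_le_compat_r; [left; apply Rpower_pos|apply H; lra].
  - apply (filterlim_comp _ _ _ (fun t => Rpower t (Re s / 2)) (fun y => K * y) _ (locally 0)); [apply filterlim_Rpower_infty; lra|].
    replace 0 with (K * 0) at 2 by ring.
    apply (continuous_of_derive (fun y => K * y)). auto_derive. exact I. }
induction n as [|n IH].
- apply (filterlim_ext (fun t => / s * (RtoC (ln t) ^ 0 * Cpowc (RtoC t) s))%C); [intros; simpl; unfold Cdiv; ring|].
  rewrite <- (Cmult_0_r (/ s)). apply filterlim_C_mult_const; [apply Rbar_locally_filter|apply T].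
- apply (filterlim_ext (fun t => / s * (RtoC (ln t) ^ S n * Cpowc (RtoC t) s + - cnat (S n) * log_prim n s t))%C); [intros; rewrite log_prim_S; unfold Cdiv; ring|].
  replace (RtoC 0) with (/ s * (0 + - cnat (S n) * 0))%C by ring.
  apply filterlim_C_mult_const; [apply Rbar_locally_filter|]. apply filterlim_C_plus; [apply Rbar_locally_filter|apply T|].
  apply filterlim_C_mult_const; [apply Rbar_locally_filter|exact IH].
Qed.

Lemma log_weight_div_pow (n i : nat) (nu : C) (t : R) : 0 < t ->
  (/ RtoC t ^ S i * log_weight n nu t = RtoC (ln t) ^ n * Cpowc (RtoC t) (- cnat i - nu) / RtoC t)%C.
Proof.
intros Ht. assert (Ht1 : RtoC t <> 0) by (apply RtoC_neq_0; lra).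
assert (I : forall z, Cpowc (RtoC t) (- z) = (/ Cpowc (RtoC t) z)%C).
{ intros z. rewrite !Cpowc_pos by exact Ht. rewrite <- Cexp_opp. f_equal. ring. }
unfold Cminus. rewrite Cpowc_pos_plus, !I, Cpowc_pos_INR by exact Ht. unfold log_weight. rewrite Cpow_S.
field. repeat split; [apply Cpowc_pos_neq_0, Ht|apply Cpow_nz, Ht1|exact Ht1].
Qed.

Lemma moment_log_weight (k : R -> C) (n j : nat) (nu : C) (t : R) : 0 < t ->
  moment_integrand k n j nu t = (/ RtoC t ^ S j * (k t * log_weight n nu t))%C.
Proof.
intros Ht. assert (Ht1 : RtoC t <> 0) by (apply RtoC_neq_0; lra).
unfold moment_integrand. rewrite !Cpowc_pos_plus, Cpowc_pos_INR by exact Ht.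
replace (Cpowc (RtoC t) 1) with (RtoC t) by (symmetry; assert (Z := Cpowc_pos_INR t 1 Ht); simpl INR in Z; rewrite Z; ring).
unfold log_weight. rewrite Cpow_S. field. repeat split; [apply Cpowc_pos_neq_0, Ht|apply Cpow_nz, Ht1|exact Ht1].
Qed.

Lemma exponent_Re (i : nat) (nu : C) : Re (- cnat i - nu) = - INR i - Re nu.
Proof. unfold Cminus. rewrite re_plus, !re_opp, re_RtoC. ring. Qed.

Lemma exponent_neg (i : nat) (nu : C) : 0 < Re nu -> Re (- cnat i - nu) < 0.
Proof. intros H. rewrite exponent_Re. generalize (pos_INR i). lra. Qed.

Lemma exponent_neq_0 (i : nat) (nu : C) : 0 < Re nu -> (- cnat i - nu)%C <> 0.
Proof. intros H E. assert (A := exponent_neg i nu H). rewrite E in A. simpl in A. lra. Qed.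

Lemma continuous_log_weight_div_pow (n i : nat) (nu : C) (t : R) : 0 < t ->
  ccontinuous (fun t => / RtoC t ^ S i * log_weight n nu t)%C t.
Proof.
intros Ht. apply continuous_Cmult; [|apply continuous_log_weight, Ht].
apply continuous_Cinv; [apply continuous_Cpow, continuous_CRtoC|apply Cpow_nz, RtoC_neq_0; lra].
Qed.

Lemma is_CInt_log_weight_div_pow (n i : nat) (nu : C) (u v : R) : 0 < Re nu -> 0 < u <= v ->
  is_CInt (fun t => / RtoC t ^ S i * log_weight n nu t)%C u v (log_prim n (- cnat i - nu) v - log_prim n (- cnat i - nu) u)%C.
Proof.
intros Hnu Hu. apply is_CInt_derive; intros t Ht; rewrite Rmin_left, Rmax_right in Ht by lra.
- rewrite log_weight_div_pow by lra. apply is_cderive_log_prim; [lra|apply exponent_neq_0, Hnu].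
- apply continuous_log_weight_div_pow; lra.
Qed.

(** The value of [log_prim] at r is the finite part of the monomial over (0, r). The two
    contributions cancel: a pure power has finite part 0 over the half-line, so monomials can be
    moved beyond r at the price of a sign. *)
Lemma log_weight_div_pow_tail (n i : nat) (nu : C) (r : R) : 0 < Re nu -> 0 < r ->
  is_CInt_gen (fun t => / RtoC t ^ S i * log_weight n nu t)%C (at_point r) (Rbar_locally p_infty)
    (- log_prim n (- cnat i - nu) r)%C.
Proof.
intros Hnu Hr. apply is_CInt_gen_right; [apply Rbar_locally_filter| |].
- exists r. intros b Hb. eexists. apply is_CInt_log_weight_div_pow; [exact Hnu|lra].
- apply (filterlim_ext_loc (fun b => log_prim n (- cnat i - nu) b + - log_prim n (- cnat i - nu) r)%C).
  + exists r. intros b Hb. symmetry. apply is_CInt_unique. apply is_CInt_log_weight_div_pow; [exact Hnu|lra].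
  + rewrite <- (Cplus_0_l (- log_prim n (- cnat i - nu) r)) at 1. apply filterlim_C_plus; [apply Rbar_locally_filter| |apply filterlim_C_const; apply Rbar_locally_filter].
    apply log_prim_infty, exponent_neg, Hnu.
Qed.

Lemma is_CInt_gen_unique (Fa Fb : (R -> Prop) -> Prop) {FFa : ProperFilter Fa} {FFb : ProperFilter Fb} (f : R -> C) (l m : C) :
  is_CInt_gen f Fa Fb l -> is_CInt_gen f Fa Fb m -> l = m.
Proof.
intros H1 H2. transitivity (CInt_gen f Fa Fb);
  [symmetry|]; apply (CInt_gen_value); assumption.
Qed.

(** [RInt_gen] is total, so it provides the sequence of values without an axiom of choice. *)
Lemma is_CInt_gen_choice (Fa Fb : (R -> Prop) -> Prop) {FFa : ProperFilter Fa} {FFb : ProperFilter Fb}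
  (F : nat -> R -> C) (P : nat -> C -> Prop) :
  (forall j, exists l : C, is_CInt_gen (F j) Fa Fb l /\ P j l) ->
  exists L : nat -> C, forall j, is_CInt_gen (F j) Fa Fb (L j) /\ P j (L j).
Proof.
intros H. exists (fun j => CInt_gen (F j) Fa Fb). intros j.
destruct (H j) as [l [H1 H2]]. rewrite (CInt_gen_value _ _ H1). split; assumption.
Qed.

(** The remainder is divided by t^(j+1), as it occurs in the j-th moment; it then stays bounded down
    to t = 0 by a constant geometric in j. *)
Definition taylor_rem (k : R -> C) (c : nat -> C) (j : nat) (t : R) : C :=
  (/ RtoC t ^ S j * (k t - csum (fun m => c m * RtoC t ^ m) j))%C.

Lemma taylor_rem_S (k : R -> C) (c : nat -> C) (j : nat) (t : R) : 0 < t ->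
  taylor_rem k c j t = (c (S j) + RtoC t * taylor_rem k c (S j) t)%C.
Proof.
intros Ht. assert (Ht1 : RtoC t <> 0) by (apply RtoC_neq_0; lra).
unfold taylor_rem. rewrite csum_S, !(Cpow_S (RtoC t)). field. split; [apply Cpow_nz, Ht1|exact Ht1].
Qed.

Lemma Cmod_taylor_rem (kz : C -> C) (k : R -> C) (c : nat -> C) (r R0 M : R) (j : nat) (t : R) :
  taylor_bound kz c r R0 M -> kz (RtoC t) = k t -> 0 < t <= r -> Cmod (taylor_rem k c j t) <= M * / R0 ^ S j.
Proof.
intros (Hr & HM & Hc & HT) E Ht. assert (Ht1 : RtoC t <> 0) by (apply RtoC_neq_0; lra).
assert (A := HT j (RtoC t)). rewrite Cmod_R, Rabs_pos_eq, E in A by lra. specialize (A (proj2 Ht)).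
unfold taylor_rem. rewrite Cmod_mult, Cmod_inv, Cmod_pow, Cmod_R, Rabs_pos_eq by (try apply Cpow_nz, Ht1; lra).
assert (P : 0 < t ^ S j) by (apply pow_lt; lra).
apply Rmult_le_reg_l with (t ^ S j); [exact P|]. rewrite <- Rmult_assoc, Rinv_r, Rmult_1_l by lra.
eapply Rle_trans; [exact A|]. unfold Rdiv. rewrite Rpow_mult_distr, pow_inv. right; ring.
Qed.

Lemma continuous_taylor_rem (k : R -> C) (c : nat -> C) (j : nat) (t : R) : 0 < t -> ccontinuous k t -> ccontinuous (taylor_rem k c j) t.
Proof.
intros Ht Hk. unfold taylor_rem. apply continuous_Cmult.
- apply continuous_Cinv; [apply continuous_Cpow, continuous_CRtoC|apply Cpow_nz, RtoC_neq_0; lra].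
- apply continuous_Cplus; [exact Hk|apply continuous_Copp]. apply (continuous_csum (fun m s => c m * RtoC s ^ m)%C).
  intros m. apply continuous_Cmult; [apply continuous_Cconst|apply continuous_Cpow, continuous_CRtoC].
Qed.

Lemma moment_split (k : R -> C) (c : nat -> C) (n j : nat) (nu : C) (t : R) : 0 < t ->
  (taylor_rem k c j t * log_weight n nu t + csum (fun m => c m * (/ RtoC t ^ S (j - m) * log_weight n nu t)) j)%C = moment_integrand k n j nu t.
Proof.
intros Ht. rewrite moment_log_weight by exact Ht. assert (Ht1 : RtoC t <> 0) by (apply RtoC_neq_0; lra).
assert (E : csum (fun m => c m * (/ RtoC t ^ S (j - m) * log_weight n nu t))%C j = (/ RtoC t ^ S j * log_weight n nu t * csum (fun m => c m * RtoC t ^ m) j)%C).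
{ rewrite <- csum_mult_l. apply csum_ext. intros m Hm.
  replace (RtoC t ^ S j)%C with (RtoC t ^ S (j - m) * RtoC t ^ m)%C by (rewrite <- Cpow_add_r; f_equal; lia).
  Cfield. split; apply Cpow_nz, Ht1. }
rewrite E. unfold taylor_rem. Cring.
Qed.

(** On (eps, r) the moment splits into the Taylor remainder, integrable at 0, and monomials
    integrated by [log_prim]. Their values at r join the convergent group with the head and the
    tail, and those at eps are exactly the divergent group. *)
Lemma fp_finite_of_tail (k : R -> C) (c : nat -> C) (n j : nat) (nu : C) (r b : R) (h l : C) :
  0 < Re nu -> 0 < r -> (forall t, 0 < t <= r -> ccontinuous k t) ->
  is_CInt_gen (fun t => taylor_rem k c j t * log_weight n nu t)%C (at_right 0) (at_point r) h ->
  is_CInt_gen (moment_integrand k n j nu) (at_point r) (at_left b) l ->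
  is_fp_finite (moment_integrand k n j nu) b
    (h + csum (fun m => c m * log_prim n (- cnat (j - m) - nu) r) j + l)%C.
Proof.
intros Hnu Hr Hk Hh Hl.
assert (ED : forall J, exists D, divergent_group D /\ forall eps, D eps = csum (fun m => - c m * log_prim n (- cnat (j - m) - nu) eps)%C J).
{ induction J as [|J [D [HD E]]].
  - destruct (divergent_log_prim n (- cnat (j - 0) - nu) (- c 0%nat)%C _ (exponent_neg _ _ Hnu) divergent_nil) as [D [HD E]].
    exists D; split; [exact HD|]. intros eps. rewrite E, csum_0. ring.
  - destruct (divergent_log_prim n (- cnat (j - S J) - nu) (- c (S J))%C D (exponent_neg _ _ Hnu) HD) as [D' [HD' E']].
    exists D'; split; [exact HD'|]. intros eps. rewrite E', E, csum_S. ring. }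
destruct (ED j) as [D [HD E]].
set (T := csum (fun m => c m * log_prim n (- cnat (j - m) - nu) r)%C j) in *.
destruct (is_CInt_gen_filterlim (at_right 0) (at_point r) (at_right 0) _ (fun e => e) (fun _ => r) h Hh (filterlim_id _ _)) as [_ Lh].
{ intros P HP. unfold filtermap. apply filter_forall. intros _. exact HP. }
exists (fun eps => CInt (fun t => taylor_rem k c j t * log_weight n nu t)%C eps r + T + l)%C, D.
split; [|split; [exact HD|]].
- generalize (at_right_0_le r Hr). apply filter_imp. intros eps He.
  assert (I1 : is_CInt (fun t => taylor_rem k c j t * log_weight n nu t)%C eps r (CInt (fun t => taylor_rem k c j t * log_weight n nu t)%C eps r)).
  { apply is_CInt_CInt. intros t Ht. rewrite Rmin_left, Rmax_right in Ht by lra.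
    apply continuous_Cmult; [apply continuous_taylor_rem; [lra|apply Hk; lra]|apply continuous_log_weight; lra]. }
  assert (I2 := is_CInt_csum (fun m t => c m * (/ RtoC t ^ S (j - m) * log_weight n nu t))%C
      (fun m => c m * (log_prim n (- cnat (j - m) - nu) r - log_prim n (- cnat (j - m) - nu) eps))%C eps r j
      (fun m => is_CInt_Cmult _ _ _ _ _ (is_CInt_log_weight_div_pow n (j - m) nu eps r Hnu He))).
  assert (I3 := is_CInt_plus _ _ _ _ _ _ I1 I2).
  assert (I4 : is_CInt (moment_integrand k n j nu) eps r (CInt (fun t => taylor_rem k c j t * log_weight n nu t)%C eps r + T + D eps)%C).
  { replace (CInt (fun t => taylor_rem k c j t * log_weight n nu t)%C eps r + T + D eps)%C with
      (CInt (fun t => taylor_rem k c j t * log_weight n nu t)%C eps r + csum (fun m => c m * (log_prim n (- cnat (j - m) - nu) r - log_prim n (- cnat (j - m) - nu) eps)) j)%C.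
    - eapply is_CInt_ext; [|exact I3]. intros t Ht. rewrite Rmin_left in Ht by lra. cbv beta. apply moment_split; lra.
    - rewrite E. unfold T. rewrite <- Cplus_assoc, <- csum_plus. f_equal. apply csum_ext. intros m _. Cring. }
  assert (I5 := CInt_gen_Chasles _ _ _ _ (proj2 (CInt_gen_at_point _ _ _ _) I4) Hl).
  replace (CInt (fun t => taylor_rem k c j t * log_weight n nu t) eps r + T + l + D eps)%C with
   (CInt (fun t => taylor_rem k c j t * log_weight n nu t) eps r + T + D eps + l)%C by Cring. exact I5.
- apply filterlim_C_plus; [apply at_right_proper_filter| |apply filterlim_C_const; apply at_right_proper_filter].
  apply filterlim_C_plus; [apply at_right_proper_filter|exact Lh|apply filterlim_C_const; apply at_right_proper_filter].
Qed.

Lemma is_fp_of_tail (a : Rbar) (k : R -> C) (c : nat -> C) (n j : nat) (nu : C) (r : R) (h l : C) :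
  0 < Re nu -> 0 < r -> Rbar_lt r a -> (forall t, 0 < t -> Rbar_lt t a -> ccontinuous k t) ->
  is_CInt_gen (fun t => taylor_rem k c j t * log_weight n nu t)%C (at_right 0) (at_point r) h ->
  is_CInt_gen (moment_integrand k n j nu) (at_point r) (upto a) l ->
  is_fp (moment_integrand k n j nu) a (h + csum (fun m => c m * log_prim n (- cnat (j - m) - nu) r) j + l)%C.
Proof.
intros Hnu Hr Ha Hk Hh Hl.
assert (Hk' : forall t, 0 < t <= r -> ccontinuous k t).
{ intros t Ht. apply Hk; [lra|]. apply (Rbar_lt_of_le_real r); [exact Ha|lra]. }
destruct a as [b| |]; [|clear Ha|contradiction].
- simpl. apply fp_finite_of_tail; assumption.
- exists (fun b => (h + csum (fun m => c m * log_prim n (- cnat (j - m) - nu) r) j + CInt (moment_integrand k n j nu) r b)%C). split.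
  + exists r. intros b Hb. apply fp_finite_of_tail; try assumption.
    assert (Cm : forall t, 0 < t -> ccontinuous (moment_integrand k n j nu) t).
    { intros t Ht. unfold moment_integrand, Cdiv. apply continuous_Cmult.
      - apply continuous_Cmult; [apply Hk; [exact Ht|exact I]|apply continuous_Cpow, continuous_Cln, Ht].
      - apply continuous_Cinv; [apply continuous_Cpowc, Ht|apply Cpowc_pos_neq_0, Ht]. }
    assert (IM : forall x, 0 < x -> is_CInt (moment_integrand k n j nu) r x (CInt (moment_integrand k n j nu) r x)).
    { intros x Hx. apply is_CInt_CInt. intros t Ht. apply Cm. apply Rlt_le_trans with (2 := proj1 Ht). apply Rmin_glb_lt; assumption. }
    apply is_CInt_gen_right; [apply at_left_proper_filter| |].
    * exists (mkposreal b ltac:(lra)). intros x Hx _. eexists. apply IM. change (Rabs (x - b) < b) in Hx. apply Rabs_lt_between in Hx. lra.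
    (* The upper end b is approached through [at_left b]; continuity of the primitive at b
       identifies that limit with the proper integral up to b. *)
    * assert (D : is_cderive (fun x => CInt (moment_integrand k n j nu) r x) b (moment_integrand k n j nu b)).
      { apply (is_derive_RInt (V := C_R_NormedModule) (moment_integrand k n j nu) (fun x => CInt (moment_integrand k n j nu) r x) r b); [|apply Cm; lra].
        assert (L1 : locally b (fun y => 0 < y)) by (apply (open_gt 0); lra).
        revert L1. apply filter_imp. exact IM. }
      intros P HP. assert (K := is_cderive_continuous _ _ _ D P HP). unfold filtermap in *.
      destruct K as [e K]. exists e. intros y Hy _. apply K, Hy.
  + apply filterlim_C_plus; [apply Rbar_locally_filter|apply filterlim_C_const; apply Rbar_locally_filter|].
    apply (is_CInt_gen_right_lim p_infty). exact Hl.
Qed.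

(** * The expansion *)

Lemma csum_geometric_kernel (w : C) (t : R) (J : nat) : RtoC t <> 0 -> (w + RtoC t)%C <> 0 ->
  (csum (fun j => (- w) ^ j * / RtoC t ^ S j) J = / (w + RtoC t) + - (- w) ^ S J * (/ RtoC t ^ S J * / (w + RtoC t)))%C.
Proof.
intros Ht Hw. induction J as [|J IH].
- rewrite csum_0. simpl. Cfield. split; assumption.
- rewrite csum_S, IH, !(Cpow_S _ (S J)). Cfield. repeat split; try assumption; apply Cpow_nz, Ht.
Qed.

(** Geometric summation with the Taylor polynomial carried along. By [taylor_rem_S] each step trades
    a factor t for -w modulo w + t, so the polynomial ends up evaluated at -w; this is the source of
    k(-w). *)
Lemma csum_taylor_rem (k : R -> C) (c : nat -> C) (w : C) (t : R) (J : nat) : 0 < t -> (w + RtoC t)%C <> 0 ->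
  csum (fun j => (- w) ^ j * taylor_rem k c j t)%C J =
  (/ (w + RtoC t) * (k t + - csum (fun m => c m * (- w) ^ m) J + - (- w) ^ S J * taylor_rem k c J t))%C.
Proof.
intros Ht Hw. assert (Ht1 : RtoC t <> 0) by (apply RtoC_neq_0; lra).
induction J as [|J IH].
- rewrite !csum_0. unfold taylor_rem. rewrite csum_0. simpl. Cfield. split; assumption.
- rewrite csum_S, IH, (csum_S (fun m => c m * (- w) ^ m)%C), (taylor_rem_S k c J t Ht), !(Cpow_S (- w) (S J)).
  Cfield. exact Hw.
Qed.

Lemma csum_convolution (x : C) (a b : nat -> C) (J : nat) :
  csum (fun j => x ^ j * csum (fun m => a m * b (j - m)%nat) j)%C J =
  csum (fun m => a m * x ^ m * csum (fun i => x ^ i * b i) (J - m))%C J.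
Proof.
induction J as [|J IH].
- rewrite !csum_0. change (0 - 0)%nat with 0%nat. rewrite ?csum_0. simpl (x ^ 0)%C. Cring.
- rewrite csum_S, IH, (csum_S (fun m => a m * x ^ m * csum (fun i => x ^ i * b i) (S J - m))%C), Nat.sub_diag, csum_0.
  rewrite (csum_ext (fun m => a m * x ^ m * csum (fun i => x ^ i * b i) (S J - m))%C
    (fun m => a m * x ^ m * csum (fun i => x ^ i * b i) (J - m) + x ^ S J * (a m * b (S J - m)%nat))%C).
  + rewrite csum_plus, csum_mult_l, csum_S, Nat.sub_diag. simpl (x ^ 0)%C. Cring.
  + intros m Hm. rewrite (Nat.sub_succ_l m J Hm), csum_S.
    replace (x ^ S J)%C with (x ^ m * x ^ S (J - m))%C by (rewrite <- Cpow_add_r; f_equal; lia). Cring.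
Qed.

Lemma sum_n_pow_le (q : R) (J : nat) : 0 <= q < 1 -> sum_n (fun m => q ^ m) J <= / (1 - q).
Proof.
intros Hq. assert (E : sum_n (fun m => q ^ m) J = (1 - q ^ S J) / (1 - q)).
{ induction J as [|J IH]; [rewrite sum_O; simpl; field; lra|]. rewrite sum_Sn, IH. unfold plus; simpl. field. lra. }
rewrite E. assert (0 <= q ^ S J) by (apply pow_le; lra). unfold Rdiv.
assert (0 < / (1 - q)) by (apply Rinv_0_lt_compat; lra). nra.
Qed.

Lemma sum_n_mult_l_R (c : R) (u : nat -> R) (J : nat) : sum_n (fun m => c * u m) J = c * sum_n u J.
Proof. apply (sum_n_mult_l (K := R_Ring)). Qed.

(** The finite parts are fixed before w, so that one power series represents the integral on the
    whole slit disc; the asymptotics at 0 rely on this. All integrals are cut at r, with Taylor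
    remainders below r and k itself above. *)
Lemma local_expansion (a : Rbar) (k : R -> C) (kz : C -> C) (n : nat) (nu : C) (c : nat -> C) (r R0 M : R) :
  class_K a k -> complex_extension a k kz -> 0 < Re nu < 1 -> taylor_bound kz c r R0 M -> Rbar_lt r a ->
  exists FP : nat -> C, (forall j, is_fp (moment_integrand k n j nu) a (FP j)) /\
   forall w : C, w <> RtoC 0 -> Rabs (Arg w) < PI -> Cmod w < r ->
    exists I : C, is_CInt_gen (stieltjes_integrand k n nu w) (at_right 0) (upto a) I /\
     filterlim (csum (fun j => (-1) ^ j * w ^ j * FP j)%C) eventually (Clocally (I - kz (- w) * Delta_n n nu w)%C).
Proof.
intros HK Hext Hnu HT Ha. assert (HT' := HT). destruct HT' as (Hr & HM & Hc & HTz).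
assert (Hr0 : 0 < r) by lra.
assert (Hk : forall t, 0 < t -> Rbar_lt t a -> ccontinuous k t) by (intros; apply (extension_continuous a k kz); assumption).
assert (Hra : forall t, t <= r -> Rbar_lt t a) by (intros t Ht; apply (Rbar_lt_of_le_real r); assumption).
assert (Hkz : forall t, 0 < t <= r -> kz (RtoC t) = k t) by (intros t Ht; apply Hext; [lra|apply Hra, Ht]).
set (lw := log_weight n nu).
destruct (head_log n nu r Hr0 (proj2 Hnu)) as [Kh [HKh Hhead]]. fold lw in Hhead.
destruct (tail_log n nu r Hr0 (proj1 Hnu)) as [Kt [HKt Htail]]. fold lw in Htail.
destruct (is_CInt_gen_choice (at_right 0) (at_point r) (fun j t => taylor_rem k c j t * lw t)%C (fun _ _ => True)) as [h Hh].
{ intros j. destruct (Hhead (taylor_rem k c j) (M * / R0 ^ S j)) as [l [Hl _]].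
  - intros t Ht. apply continuous_taylor_rem; [lra|apply Hk; [lra|apply Hra, Ht]].
  - intros t Ht. apply (Cmod_taylor_rem kz k c r); [exact HT|apply Hkz, Ht|exact Ht].
  - exists l; split; [exact Hl|exact Logic.I]. }
destruct (tail_integrals a k n nu r HK (proj1 Hnu) Hk Hr0 Ha) as [[tau Htau] Hsig]. fold lw in Htau, Hsig.
(* Integrals over (r, oo) of the monomials, equal to minus their finite parts over (0, r). *)
set (Q := fun i => (- log_prim n (- cnat i - nu) r)%C).
assert (HQ : forall i, is_CInt_gen (fun t => / RtoC t ^ S i * lw t)%C (at_point r) (Rbar_locally p_infty) (Q i)).
{ intros i. apply log_weight_div_pow_tail; [apply Hnu|exact Hr0]. }
assert (EXP : forall (f g : R -> C) Fb (FFb : Filter Fb) l, Fb (fun b => r < b) -> (forall t, r <= t -> f t = g t) -> is_CInt_gen f (at_point r) Fb l -> is_CInt_gen g (at_point r) Fb l).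
{ intros f g Fb FFb l HFb E. apply (CInt_gen_ext).
  apply (Filter_prod _ _ _ (fun x => x = r) (fun b => r < b)); [reflexivity|exact HFb|].
  intros x b -> Hb t [Ht _]. apply E. simpl in Ht. rewrite Rmin_left in Ht; lra. }
assert (EXH : forall (f g : R -> C) l, (forall t, 0 < t <= r -> f t = g t) -> is_CInt_gen f (at_right 0) (at_point r) l -> is_CInt_gen g (at_right 0) (at_point r) l).
{ intros f g l E. apply (CInt_gen_ext).
  apply (Filter_prod _ _ _ (fun x => 0 < x <= r) (fun b => b = r)); [apply at_right_0_le, Hr0|reflexivity|].
  intros x b Hx -> t Ht. simpl in Ht. rewrite Rmin_left, Rmax_right in Ht by lra. apply E. lra. }
assert (Hup : upto a (fun b => r < b)) by (generalize (upto_between r a Ha); apply filter_imp; intros b [Hb _]; exact Hb).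
exists (fun j => h j + csum (fun m => c m * log_prim n (- cnat (j - m) - nu) r) j + tau j)%C.
split.
{ intros j. apply is_fp_of_tail; try assumption; [apply Hnu|apply Hh|].
  apply (EXP (fun t => / RtoC t ^ S j * (k t * lw t))%C); [apply upto_proper|exact Hup| |apply Htau].
  intros t Ht. symmetry. apply moment_log_weight. lra. }
intros w Hw0 Harg Hw.
destruct (Cexp_slit (Log w) Harg) as [m0 [Hm0 Hslit]]. rewrite Cexp_Log in Hslit by exact Hw0.
assert (Nw : forall t, 0 <= t -> (w + RtoC t)%C <> 0) by (apply (slit_neq_0 w m0 Hm0 Hslit)).
assert (im0 : 0 < / m0) by (apply Rinv_0_lt_compat, Hm0).
assert (inv0 : forall t, 0 <= t -> Cmod (/ (w + RtoC t)) <= / m0 * / (1 + t)).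
{ intros t Ht. rewrite Cmod_inv by (apply Nw, Ht). rewrite <- Rinv_mult. apply Rinv_le_contravar; [apply Rmult_lt_0_compat; lra|apply Hslit, Ht]. }
assert (inv1 : forall t, 0 <= t -> Cmod (/ (w + RtoC t)) <= / m0).
{ intros t Ht. eapply Rle_trans; [apply inv0, Ht|]. rewrite <- (Rmult_1_r (/ m0)) at 2. apply Rmult_le_compat_l; [lra|].
  rewrite <- Rinv_1. apply Rinv_le_contravar; lra. }
assert (inv2 : forall t, r <= t -> Cmod (/ (w + RtoC t)) <= / m0 / t).
{ intros t Ht. eapply Rle_trans; [apply inv0; lra|]. apply Rmult_le_compat_l; [lra|]. apply Rinv_le_contravar; lra. }
assert (cinv : forall t, 0 <= t -> ccontinuous (fun t => / (w + RtoC t))%C t) by (intros t Ht; apply continuous_slit_inv, Nw, Ht).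
destruct (Hsig w Hw) as (Ms & sigma & Hsigma). clear Hsig.
destruct (Hhead (fun t => / (w + RtoC t))%C (/ m0)) as [V1 [HV1 _]].
{ intros t Ht. apply cinv; lra. } { intros t Ht. apply inv1; lra. }
destruct (Htail (fun t => / (w + RtoC t))%C (/ m0)) as [V2 [HV2 _]].
{ intros t Ht. apply cinv; lra. } { intros t Ht. apply inv2; lra. }
(* V1 and V2 are the parts over (0, r) and (r, oo) of the half-line integral with k replaced by
   1. *)
assert (HV : (V1 + V2)%C = Delta_n n nu w).
{ assert (D := stieltjes_ones_Delta n nu w Hnu Hw0 Harg).
  apply (is_CInt_gen_unique (at_right 0) (Rbar_locally p_infty) (fun t => / (w + RtoC t) * lw t)%C).
  - apply (CInt_gen_Chasles _ r); assumption.
  - apply (is_CInt_gen_ext_pos (stieltjes_integrand ones n nu w)) with (6 := D);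
     [apply at_right_proper_filter|apply Rbar_locally_filter|apply at_right_0_nonneg|apply p_infty_nonneg|].
    intros t Ht. rewrite stieltjes_log_weight by (try apply Nw; lra). unfold Cdiv, lw. ring. }
destruct (Hhead (fun t => k t * / (w + RtoC t))%C (2 * M * / m0)) as [I1 [HI1 _]].
{ intros t Ht. apply continuous_Cmult; [apply Hk; [lra|apply Hra, Ht]|apply cinv; lra]. }
{ intros t Ht. rewrite Cmod_mult. apply Rmult_le_compat; try apply Cmod_ge_0; [|apply inv1; lra].
  assert (A := HTz 0%nat (RtoC t)). rewrite csum_0, Cmod_R, Rabs_pos_eq, Hkz in A by lra. specialize (A (proj2 Ht)).
  assert (B := Hc 0%nat). simpl in A, B. rewrite Rmult_1_r in B.
  assert (t / R0 <= 1) by (apply Rmult_le_reg_r with R0; [lra|]; unfold Rdiv; rewrite Rmult_assoc, Rinv_l by lra; lra).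
  assert (0 <= t / R0) by (apply Rdiv_le_0_compat; lra).
  replace (k t) with ((k t - c 0%nat * 1) + c 0%nat)%C by ring. eapply Rle_trans; [apply Cmod_triangle|]. nra. }
destruct (is_CInt_gen_choice (at_right 0) (at_point r) (fun j t => taylor_rem k c j t * / (w + RtoC t) * lw t)%C
   (fun j l => Cmod l <= Kh * (M * / m0) * / R0 ^ S j)) as [rho Hrho].
{ intros j. destruct (Hhead (fun t => taylor_rem k c j t * / (w + RtoC t))%C (M * / R0 ^ S j * / m0)) as [l [Hl Bl]].
  - intros t Ht. apply continuous_Cmult; [apply continuous_taylor_rem; [lra|apply Hk; [lra|apply Hra, Ht]]|apply cinv; lra].
  - intros t Ht. rewrite Cmod_mult. apply Rmult_le_compat; try apply Cmod_ge_0; [|apply inv1; lra].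
    apply (Cmod_taylor_rem kz k c r); [exact HT|apply Hkz, Ht|exact Ht].
  - exists l; split; [exact Hl|]. eapply Rle_trans; [exact Bl|]. right; ring. }
destruct (is_CInt_gen_choice (at_point r) (Rbar_locally p_infty) (fun i t => / RtoC t ^ S i * / (w + RtoC t) * lw t)%C
   (fun i l => Cmod l <= Kt * / m0 * / r ^ S i)) as [q Hq].
{ intros i. destruct (Htail (fun t => / RtoC t ^ S i * / (w + RtoC t))%C (/ r ^ S i * / m0)) as [l [Hl Bl]].
  - intros t Ht. apply continuous_Cmult; [|apply cinv; lra].
    apply continuous_Cinv; [apply continuous_Cpow, continuous_CRtoC|apply Cpow_nz, RtoC_neq_0; lra].
  - intros t Ht. rewrite Cmod_mult, Cmod_inv, Cmod_pow, Cmod_R, Rabs_pos_eq by (try apply Cpow_nz, RtoC_neq_0; lra).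
    unfold Rdiv. rewrite Rmult_assoc. assert (0 < r ^ S i) by (apply pow_lt; lra).
    apply Rmult_le_compat; [left; apply Rinv_0_lt_compat, pow_lt; lra|apply Cmod_ge_0| |apply inv2, Ht].
    apply Rinv_le_contravar; [assumption|apply pow_incr; lra].
  - exists l; split; [exact Hl|]. eapply Rle_trans; [exact Bl|]. right; ring. }
set (x := (- w)%C).
set (P := fun J => csum (fun m => c m * x ^ m)%C J).
(* Heads: linearity turns [csum_taylor_rem] into an identity between I1, V1 and the error integrals
   [rho]. *)
assert (S1 : forall J, csum (fun j => x ^ j * h j)%C J = (I1 + - P J * V1 + - x ^ S J * rho J)%C).
{ intros J. apply (is_CInt_gen_unique (at_right 0) (at_point r) (fun t => csum (fun j => x ^ j * (taylor_rem k c j t * lw t))%C J)).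
  - apply is_CInt_gen_csum; [apply at_right_proper_filter|apply at_point_filter|].
    intros m _. apply is_CInt_gen_Cmult; [apply at_right_proper_filter|apply at_point_filter|apply Hh].
  - apply (EXH (fun t => k t * / (w + RtoC t) * lw t + - P J * (/ (w + RtoC t) * lw t) + - x ^ S J * (taylor_rem k c J t * / (w + RtoC t) * lw t))%C).
    + intros t Ht. rewrite (csum_ext _ (fun j => lw t * (x ^ j * taylor_rem k c j t))%C) by (intros; Cring).
      rewrite csum_mult_l. unfold P, x. rewrite csum_taylor_rem by (try apply Nw; lra). Cring.
    + apply is_CInt_gen_plus; [apply at_right_proper_filter|apply at_point_filter| |].
      * apply is_CInt_gen_plus; [apply at_right_proper_filter|apply at_point_filter|exact HI1|].
        apply is_CInt_gen_Cmult; [apply at_right_proper_filter|apply at_point_filter|exact HV1].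
      * apply is_CInt_gen_Cmult; [apply at_right_proper_filter|apply at_point_filter|apply Hrho]. }
assert (KER : forall t J, r <= t -> (csum (fun j => x ^ j * / RtoC t ^ S j) J + x ^ S J * (/ RtoC t ^ S J * / (w + RtoC t)))%C = (/ (w + RtoC t))%C).
{ intros t J Ht. unfold x. rewrite csum_geometric_kernel by (try apply RtoC_neq_0; try apply Nw; lra). Cring. }
assert (G2 : forall J, is_CInt_gen (fun t => / (w + RtoC t) * (k t * lw t))%C (at_point r) (upto a) (csum (fun j => x ^ j * tau j)%C J + x ^ S J * sigma J)%C).
{ intros J. apply (EXP (fun t => csum (fun j => x ^ j * (/ RtoC t ^ S j * (k t * lw t)))%C J + x ^ S J * (/ RtoC t ^ S J * / (w + RtoC t) * (k t * lw t)))%C); [apply upto_proper|exact Hup| |].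
  - intros t Ht. rewrite (csum_ext _ (fun j => (k t * lw t) * (x ^ j * / RtoC t ^ S j))%C) by (intros; Cring).
    rewrite csum_mult_l. transitivity ((csum (fun j => x ^ j * / RtoC t ^ S j) J + x ^ S J * (/ RtoC t ^ S J * / (w + RtoC t))) * (k t * lw t))%C; [Cring|rewrite (KER t J Ht); reflexivity].
  - apply is_CInt_gen_plus; [apply at_point_filter|apply upto_proper| |].
    + apply is_CInt_gen_csum; [apply at_point_filter|apply upto_proper|]. intros m _. apply is_CInt_gen_Cmult; [apply at_point_filter|apply upto_proper|apply Htau].
    + apply is_CInt_gen_Cmult; [apply at_point_filter|apply upto_proper|apply Hsigma]. }
(* The integral over (r, a). [G2] represents it for every J; the case J = 0 names it, and uniqueness
   of the integral gives all the others. *)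
set (I2 := (csum (fun j => x ^ j * tau j)%C 0 + x ^ 1 * sigma 0%nat)%C).
assert (S2 : forall J, csum (fun j => x ^ j * tau j)%C J = (I2 + - x ^ S J * sigma J)%C).
{ intros J. assert (E := is_CInt_gen_unique (at_point r) (upto a) _ _ _ (G2 0%nat) (G2 J)).
  change (csum (fun j => x ^ j * tau j) 0 + x ^ 1 * sigma 0%nat)%C with I2 in E. rewrite E. Cring. }
(* The same geometric identity on (r, oo) with k replaced by 1. After the convolution it supplies
   the missing part V2 of [Delta_n]. *)
assert (S3 : forall i, csum (fun j => x ^ j * Q j)%C i = (V2 + - x ^ S i * q i)%C).
{ intros i.
  assert (E : (csum (fun j => x ^ j * Q j) i + x ^ S i * q i)%C = V2).
  { apply (is_CInt_gen_unique (at_point r) (Rbar_locally p_infty) (fun t => / (w + RtoC t) * lw t)%C); [|exact HV2].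
    apply (EXP (fun t => csum (fun j => x ^ j * (/ RtoC t ^ S j * lw t))%C i + x ^ S i * (/ RtoC t ^ S i * / (w + RtoC t) * lw t))%C); [apply Rbar_locally_filter|exists r; intros; assumption| |].
    - intros t Ht. rewrite (csum_ext _ (fun j => lw t * (x ^ j * / RtoC t ^ S j))%C) by (intros; Cring).
      rewrite csum_mult_l. transitivity ((csum (fun j => x ^ j * / RtoC t ^ S j) i + x ^ S i * (/ RtoC t ^ S i * / (w + RtoC t))) * lw t)%C; [Cring|rewrite (KER t i Ht); reflexivity].
    - apply is_CInt_gen_plus; [apply at_point_filter|apply Rbar_locally_filter| |].
      + apply is_CInt_gen_csum; [apply at_point_filter|apply Rbar_locally_filter|]. intros m _. apply is_CInt_gen_Cmult; [apply at_point_filter|apply Rbar_locally_filter|apply HQ].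
      + apply is_CInt_gen_Cmult; [apply at_point_filter|apply Rbar_locally_filter|apply Hq]. }
  rewrite <- E. Cring. }
exists (I1 + I2)%C. split.
{ apply (is_CInt_gen_ext_pos (fun t => k t * / (w + RtoC t) * lw t)%C); [apply at_right_proper_filter|apply upto_proper|apply at_right_0_nonneg| | |].
  - revert Hup. apply filter_imp. intros b Hb. lra.
  - intros t Ht. rewrite stieltjes_log_weight by (try apply Nw; lra). unfold Cdiv, lw. ring.
  - apply (CInt_gen_Chasles _ r); [exact HI1|].
    apply (EXP (fun t => / (w + RtoC t) * (k t * lw t))%C); [apply upto_proper|exact Hup|intros; ring|exact (G2 0%nat)]. }
(* Exact error after the terms 0 to J: the Taylor error at -w times [Delta_n], the remainder
   integrals below and above r, and a convolution left by the truncated monomial sums. *)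
assert (SUM : forall J, (csum (fun j => (-1) ^ j * w ^ j * (h j + csum (fun m => c m * log_prim n (- cnat (j - m) - nu) r) j + tau j)) J - (I1 + I2 - kz (- w) * Delta_n n nu w) =
   (kz x - P J) * Delta_n n nu w + - x ^ S J * (rho J + sigma J) + x ^ S J * csum (fun m => c m * q (J - m)%nat) J)%C).
{ intros J.
  assert (E : csum (fun j => (-1) ^ j * w ^ j * (h j + csum (fun m => c m * log_prim n (- cnat (j - m) - nu) r) j + tau j))%C J =
    (csum (fun j => x ^ j * h j) J + csum (fun j => x ^ j * tau j) J + - csum (fun j => x ^ j * csum (fun m => c m * Q (j - m)%nat) j) J)%C).
  { replace (- csum (fun j => x ^ j * csum (fun m => c m * Q (j - m)%nat) j) J)%C with (csum (fun j => - (1) * (x ^ j * csum (fun m => c m * Q (j - m)%nat) j)) J)%C by (rewrite csum_mult_l; Cring).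
    rewrite <- !csum_plus. apply csum_ext. intros j _.
    replace (csum (fun m => c m * log_prim n (- cnat (j - m) - nu) r) j)%C with (- (1) * csum (fun m => c m * Q (j - m)%nat) j)%C.
    2:{ rewrite <- csum_mult_l. apply csum_ext. intros m _. unfold Q. Cring. }
    replace ((-1) ^ j * w ^ j)%C with (x ^ j)%C by (rewrite <- Cpow_mult_l; f_equal; unfold x; ring). Cring. }
  rewrite E, S1, S2, csum_convolution.
  rewrite (csum_ext (fun m => c m * x ^ m * csum (fun i => x ^ i * Q i) (J - m))%C (fun m => V2 * (c m * x ^ m) + - x ^ S J * (c m * q (J - m)%nat))%C).
  - rewrite csum_plus, !csum_mult_l, <- HV. fold (P J). fold x. Cring.
  - intros m Hm. rewrite S3. replace (x ^ S J)%C with (x ^ m * x ^ S (J - m))%C by (rewrite <- Cpow_add_r; f_equal; lia). Cring. }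
set (qq := Cmod w / r).
assert (Hqq : 0 <= qq < 1).
{ unfold qq. split; [apply Rdiv_le_0_compat; [apply Cmod_ge_0|lra]|]. apply Rmult_lt_reg_r with r; [lra|]. unfold Rdiv; rewrite Rmult_assoc, Rinv_l by lra; lra. }
assert (Hx : Cmod x = Cmod w) by apply Cmod_opp.
assert (Hr0R : 0 < r / R0 < 1).
{ split; [apply Rdiv_lt_0_compat; lra|]. apply Rmult_lt_reg_r with R0; [lra|]. unfold Rdiv; rewrite Rmult_assoc, Rinv_l by lra; lra. }
(* One summand for each error term. In the last one |c_m| <= M / R0^m meets |q_(J-m)| <= const /
   r^(J-m+1), and the sum of (r / R0)^m converges because r < R0 strictly. *)
set (Kf := M * Cmod (Delta_n n nu w) + (Kh * (M * / m0) + Ms) + M * (Kt * / m0) * / (1 - r / R0)).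
apply filterlim_C; [apply eventually_filter|]. intros eps He.
generalize (pow_filterlim_0 qq Kf Hqq eps He). apply filter_imp. intros J HJ.
rewrite SUM. eapply Rle_lt_trans; [|exact HJ].
assert (PW : 0 <= Cmod w ^ S J) by (apply pow_le, Cmod_ge_0).
assert (Pr : 0 < r ^ S J) by (apply pow_lt; lra).
assert (PR : 0 < R0 ^ S J) by (apply pow_lt; lra).
assert (Rr : / R0 ^ S J <= / r ^ S J) by (apply Rinv_le_contravar; [exact Pr|apply pow_incr; lra]).
assert (QE : qq ^ S J = Cmod w ^ S J * / r ^ S J) by (unfold qq, Rdiv; rewrite Rpow_mult_distr, pow_inv; reflexivity).
assert (HKM : 0 <= Kh * (M * / m0)) by (apply Rmult_le_pos; [lra|apply Rmult_le_pos; lra]).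
assert (HMt : 0 <= M * (Kt * / m0)) by (apply Rmult_le_pos; [lra|apply Rmult_le_pos; lra]).
unfold Kf. rewrite !Rmult_plus_distr_r.
eapply Rle_trans; [apply Cmod_triangle|]. apply Rplus_le_compat; [eapply Rle_trans; [apply Cmod_triangle|]; apply Rplus_le_compat|].
- rewrite Cmod_mult. replace (M * Cmod (Delta_n n nu w) * qq ^ S J) with (M * qq ^ S J * Cmod (Delta_n n nu w)) by ring.
  apply Rmult_le_compat_r; [apply Cmod_ge_0|].
  eapply Rle_trans; [apply (HTz J x); lra|]. rewrite Hx. apply Rmult_le_compat_l; [exact HM|].
  rewrite QE. unfold Rdiv. rewrite Rpow_mult_distr, pow_inv. apply Rmult_le_compat_l; [exact PW|exact Rr].
- rewrite Cmod_mult, Cmod_opp, Cmod_pow, Hx, QE, <- Rmult_plus_distr_r.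
  replace ((Kh * (M * / m0) + Ms) * (Cmod w ^ S J * / r ^ S J)) with (Cmod w ^ S J * ((Kh * (M * / m0)) * / r ^ S J + Ms * / r ^ S J)) by ring.
  apply Rmult_le_compat_l; [exact PW|]. eapply Rle_trans; [apply Cmod_triangle|]. apply Rplus_le_compat; [|apply Hsigma].
  eapply Rle_trans; [apply Hrho|]. apply Rmult_le_compat_l; assumption.
- rewrite Cmod_mult, Cmod_pow, Hx, QE.
  replace (M * (Kt * / m0) * / (1 - r / R0) * (Cmod w ^ S J * / r ^ S J)) with (Cmod w ^ S J * (M * (Kt * / m0) * / r ^ S J * / (1 - r / R0))) by ring.
  apply Rmult_le_compat_l; [exact PW|].
  apply Rle_trans with (sum_n (fun m => M * (Kt * / m0) * / r ^ S J * (r / R0) ^ m) J).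
  + apply csum_Cmod_le. intros m Hm. rewrite Cmod_mult.
    replace (M * (Kt * / m0) * / r ^ S J * (r / R0) ^ m) with ((M * / R0 ^ m) * (Kt * / m0 * / r ^ S (J - m))).
    * apply Rmult_le_compat; try apply Cmod_ge_0; [|apply Hq].
      assert (0 < R0 ^ m) by (apply pow_lt; lra). apply Rmult_le_reg_r with (R0 ^ m); [assumption|].
      rewrite Rmult_assoc, Rinv_l by lra. rewrite Rmult_1_r. apply Hc.
    * replace (r ^ S J) with (r ^ S (J - m) * r ^ m) by (rewrite <- pow_add; f_equal; lia).
      unfold Rdiv. rewrite Rpow_mult_distr, pow_inv. field. repeat split; try (apply pow_nonzero; lra); lra.
  + rewrite sum_n_mult_l_R. apply Rmult_le_compat_l; [|apply sum_n_pow_le; lra].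
    apply Rmult_le_pos; [exact HMt|left; apply Rinv_0_lt_compat, Pr].
Qed.

(** * From the distance to the nearest singularity to the expansion *)

Lemma singularity_distance_analytic (kz : C -> C) (z : C) :
  Rbar_lt (Cmod z) (singularity_distance kz) -> analytic_at kz z.
Proof.
intros H. apply NNPP. intros N.
assert (G := proj1 (Glb_Rbar_correct (fun r => exists z : C, r = Cmod z /\ ~ analytic_at kz z))).
assert (A := G (Cmod z) (ex_intro _ z (conj eq_refl N))).
apply (Rbar_lt_not_le _ _ H). exact A.
Qed.

Lemma Rbar_lt_between (x : R) (b : Rbar) : Rbar_lt x b -> exists y : R, x < y /\ Rbar_lt y b.
Proof.
destruct b as [b| |]; simpl; intros H; [exists ((x + b) / 2); lra|exists (x + 1); split; [lra|exact I]|contradiction].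
Qed.

Lemma singularity_distance_taylor (kz : C -> C) (a : Rbar) (w : C) :
  Rbar_lt (Cmod w) (singularity_distance kz) -> Rbar_lt (Cmod w) a ->
  exists c r R0 M, taylor_bound kz c r R0 M /\ Cmod w < r /\ Rbar_lt r a.
Proof.
intros H1 H2. destruct (Rbar_lt_between _ _ H1) as [y1 [A1 B1]]. destruct (Rbar_lt_between _ _ H2) as [y2 [A2 B2]].
set (m := Rmin y1 y2). assert (Hm : Cmod w < m) by (apply Rmin_glb_lt; assumption).
assert (M1 : m <= y1) by apply Rmin_l. assert (M2 : m <= y2) by apply Rmin_r.
assert (W := Cmod_ge_0 w).
(* Successive midpoints between |w| and m leave room for all three radii: the cut r, the circle R0
   and the disc of analyticity. *)
destruct (analytic_disc_taylor kz ((Cmod w + m) / 2) (((Cmod w + m) / 2 + m) / 2) m) as (c & M & HT); [lra|lra| |].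
- intros z Hz. apply singularity_distance_analytic.
  apply (Rbar_lt_trans _ y1); [simpl; lra|exact B1].
- exists c, ((Cmod w + m) / 2), (((Cmod w + m) / 2 + m) / 2), M. split; [exact HT|split; [lra|]].
  apply (Rbar_lt_trans _ y2); [simpl; lra|exact B2].
Qed.

Lemma is_CInt_gen_int0 (a : Rbar) (f : R -> C) (I : C) :
  is_CInt_gen f (at_right 0) (upto a) I -> ex_int0 a f /\ int0 a f = I.
Proof.
intros H. split; [exists I; exact H|].
apply (is_CInt_gen_unique (at_right 0) (upto a) f); [|exact H].
apply (CInt_gen_correct f). exists I; exact H.
Qed.

Lemma singularity_expansion (a : Rbar) (k : R -> C) (kz : C -> C) (n : nat) (nu w : C) :
  class_K a k -> complex_extension a k kz -> 0 < Re nu < 1 -> w <> RtoC 0 -> Rabs (Arg w) < PI ->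
  Rbar_lt (Cmod w) (singularity_distance kz) -> Rbar_lt (Cmod w) a ->
  ex_int0 a (stieltjes_integrand k n nu w) /\ stieltjes_expansion a k kz n nu w.
Proof.
intros HK Hext Hnu Hw Harg H1 H2.
destruct (singularity_distance_taylor kz a w H1 H2) as (c & r & R0 & M & HT & Hr & Hra).
destruct (local_expansion a k kz n nu c r R0 M HK Hext Hnu HT Hra) as [FP [HFP HE]].
destruct (HE w Hw Harg Hr) as [I [HI HS]].
destruct (is_CInt_gen_int0 _ _ _ HI) as [E1 E2]. split; [exact E1|].
exists FP, (I - kz (- w) * Delta_n n nu w)%C. split; [exact HFP|split; [exact HS|]].
rewrite E2. ring.
Qed.

(** * Leading behaviour at the origin *)

Lemma dominant_term (n : nat) (b : nat -> C) : b 0%nat <> 0 ->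
  exists X0, forall X, X0 <= Cmod X -> Cmod (b 0%nat) / 2 <= Cmod (csum (fun l => b l * X ^ (n - l)) n)%C.
Proof.
intros Hb. assert (Hb' := proj1 (Cmod_gt_0 _) Hb).
destruct n as [|n].
- exists 0. intros X _. rewrite csum_0. simpl. rewrite Cmult_1_r. lra.
- set (A := sum_n (fun l => Cmod (b (S l))) n).
  assert (HA : 0 <= A).
  { unfold A. clear. induction n as [|n IH]; [rewrite sum_O; apply Cmod_ge_0|]. rewrite sum_Sn. apply Rplus_le_le_0_compat; [exact IH|apply Cmod_ge_0]. }
  (* Beyond this threshold |b_0| |X| - A is at least |b_0|, and the common factor |X|^n is at least
     1. A bound from below by a constant suffices, since w^(-nu) provides the growth. *)
  exists (1 + A / Cmod (b 0%nat)). intros X HX.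
  assert (H0 : 0 <= A / Cmod (b 0%nat)) by (apply Rdiv_le_0_compat; lra).
  rewrite csum_shift. change (S n - 0)%nat with (S n).
  set (T := csum (fun m => b (S m) * X ^ (S n - S m))%C n).
  assert (P : 1 <= Cmod X ^ n) by (apply pow_R1_Rle; lra).
  assert (BT : Cmod T <= Cmod X ^ n * A).
  { unfold T, A. eapply Rle_trans; [apply (csum_Cmod_le _ (fun l => Cmod X ^ n * Cmod (b (S l))))|rewrite sum_n_mult_l_R; lra].
    intros m Hm. rewrite Cmod_mult, Cmod_pow, Rmult_comm. apply Rmult_le_compat_r; [apply Cmod_ge_0|].
    apply Rle_pow; [lra|lia]. }
  assert (L : Cmod (b 0%nat) <= Cmod X ^ n * (Cmod (b 0%nat) * Cmod X - A)).
  { assert (Cmod (b 0%nat) <= Cmod (b 0%nat) * Cmod X - A); [|nra].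
    assert (Cmod (b 0%nat) * (1 + A / Cmod (b 0%nat)) <= Cmod (b 0%nat) * Cmod X) by (apply Rmult_le_compat_l; lra).
    replace (Cmod (b 0%nat) * (1 + A / Cmod (b 0%nat))) with (Cmod (b 0%nat) + A) in H by (field; lra). lra. }
  assert (G : Cmod (b 0%nat * X ^ S n)%C <= Cmod (b 0%nat * X ^ S n + T)%C + Cmod T).
  { replace (b 0%nat * X ^ S n)%C with ((b 0%nat * X ^ S n + T) + - T)%C at 1 by ring.
    eapply Rle_trans; [apply Cmod_triangle|]. rewrite Cmod_opp. lra. }
  rewrite Cmod_mult, Cmod_pow in G. simpl pow in G. nra.
Qed.

(** The recursion at N = 0 has the single unknown D_0 and a nonzero right-hand side. *)
Lemma D_l_0_neq_0 (n : nat) (nu : C) : 0 < Re nu < 1 -> D_l n 0 nu <> 0.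
Proof.
intros Hnu E.
assert (B := D_l_recursion n 0 nu _ ltac:(lia) eq_refl (sin_PI_nu_neq_0 nu Hnu)).
rewrite csum_0, E in B. simpl (RtoC 0 ^ 0)%C in B.
assert (Z : (2 * Ci * RtoC PI)%C <> 0).
{ repeat apply Cmult_neq_0; [apply RtoC_neq_0; lra|apply Ci_nz|apply RtoC_neq_0; generalize PI_RGT_0; lra]. }
apply Z. transitivity (- (- (2 * Ci * RtoC PI) * 1))%C; [ring|]. rewrite <- B. ring.
Qed.

(** |w^(-nu)| is |w|^(-Re nu) up to a factor that |Arg w| < PI bounds below by e^(-|Im nu| PI), so
    the growth is uniform in the direction of w. The polynomial in Log w stays away from 0 by
    [dominant_term]. *)
Lemma Delta_n_infinite (n : nat) (nu : C) (T : R) : 0 < Re nu < 1 ->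
  exists d, 0 < d /\ forall w, w <> RtoC 0 -> Rabs (Arg w) < PI -> Cmod w < d -> T <= Cmod (Delta_n n nu w).
Proof.
intros Hnu.
set (b := fun l => ((-1) ^ l * RtoC (Binomial.C n l) * D_l n l nu)%C).
assert (Hb : b 0%nat <> 0).
{ unfold b. rewrite bin_C, bin_0 by lia. simpl. rewrite !Cmult_1_l. apply D_l_0_neq_0, Hnu. }
destruct (dominant_term n b Hb) as [X0 HX].
set (B := Cmod (b 0%nat) / 2). assert (HB : 0 < B) by (unfold B; apply Cmod_gt_0 in Hb; lra).
set (E := exp (Rabs (Im nu) * PI)). assert (HE : 0 < E) by apply exp_pos.
assert (Hpi := PI_RGT_0).
(* Chosen so that PI (T' / E) B = |T|. The bound e^(T') >= T' yields the factor T', and T' / Re nu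
   in [L0] makes Re nu ln |w| at most -T'. *)
set (T' := Rabs T * E / (PI * B)).
assert (HT' : 0 <= T') by (apply Rdiv_le_0_compat; [apply Rmult_le_pos; [apply Rabs_pos|lra]|apply Rmult_lt_0_compat; lra]).
set (L0 := Rabs X0 + T' / Re nu).
exists (exp (- L0)). split; [apply exp_pos|].
intros w Hw Harg Hd.
assert (Hw' := proj1 (Cmod_gt_0 w) Hw).
assert (HL : L0 < - ln (Cmod w)).
{ assert (ln (Cmod w) < - L0); [|lra]. rewrite <- (ln_exp (- L0)). apply ln_increasing; assumption. }
assert (HTn : 0 <= T' / Re nu) by (apply Rdiv_le_0_compat; lra).
assert (HXL : X0 <= Cmod (Log w)).
{ apply Rle_trans with (- ln (Cmod w)); [generalize (Rle_abs X0); unfold L0 in HL; lra|].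
  eapply Rle_trans; [|apply re_le_Cmod]. change (Re (Log w)) with (ln (Cmod w)). rewrite <- Rabs_Ropp. apply Rle_abs. }
specialize (HX _ HXL). fold B in HX.
assert (HD : Delta_n n nu w = (RtoC PI / Cpowc w nu * csum (fun l => b l * Log w ^ (n - l)) n)%C).
{ unfold Delta_n. f_equal. apply csum_ext. intros l _. unfold b. Cring. }
rewrite HD, Cmod_mult. unfold Cpowc. rewrite Cmod_div, Cmod_R, Cmod_Cexp, Rabs_pos_eq by (try apply Cexp_neq_0; lra).
assert (LE : Re (nu * Log w) <= - T' + Rabs (Im nu) * PI).
{ rewrite re_mult. change (Re (Log w)) with (ln (Cmod w)). change (Im (Log w)) with (Arg w).
  assert (Re nu * ln (Cmod w) <= - T').
  { replace T' with (Re nu * (T' / Re nu)) by (field; lra). generalize (Rabs_pos X0). unfold L0 in HL. nra. }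
  assert (- (Im nu * Arg w) <= Rabs (Im nu) * PI).
  { eapply Rle_trans; [apply Rle_abs|]. rewrite Rabs_Ropp, Rabs_mult. apply Rmult_le_compat_l; [apply Rabs_pos|lra]. }
  lra. }
assert (G : T' / E <= / exp (Re (nu * Log w))).
{ apply Rle_trans with (/ exp (- T' + Rabs (Im nu) * PI)).
  - rewrite exp_plus, exp_Ropp. fold E. rewrite Rinv_mult, Rinv_inv. apply Rmult_le_compat_r; [left; apply Rinv_0_lt_compat, HE|].
    generalize (exp_ineq1_le T'); lra.
  - apply Rinv_le_contravar; [apply exp_pos|apply exp_le_mono, LE]. }
apply Rle_trans with (Rabs T); [apply Rle_abs|].
replace (Rabs T) with (PI * (T' / E) * B) by (unfold T'; field; repeat split; lra).
apply Rmult_le_compat; [apply Rmult_le_pos; [lra|apply Rdiv_le_0_compat; lra]|lra| |exact HX].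
apply Rmult_le_compat_l; lra.
Qed.

(** Abel's argument: convergence at s bounds the terms, and for |w| <= s / 2 they are dominated by a
    geometric series of ratio 1/2. *)
Lemma power_series_bounded (b : nat -> C) (s : R) : 0 < s ->
  (exists l, filterlim (csum (fun j => (-1) ^ j * RtoC s ^ j * b j)%C) eventually (Clocally l)) ->
  exists B, 0 <= B /\ forall w l, Cmod w <= s / 2 ->
    filterlim (csum (fun j => (-1) ^ j * w ^ j * b j)%C) eventually (Clocally l) -> Cmod l <= 2 * B.
Proof.
intros Hs [l0 Hl0]. destruct (cvg_csum_bounded _ _ Hl0) as [B [HB H]].
exists B. split; [exact HB|]. intros w l Hw Hl.
apply (filterlim_C_le eventually _ l (2 * B) Hl). apply filter_forall. intros J.
eapply Rle_trans; [apply (csum_Cmod_le _ (fun m => B * (/ 2) ^ m))|apply sum_n_half_le, HB].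
intros m _. specialize (H m). rewrite !Cmod_mult, !Cmod_pow in *.
replace (Cmod (-1)) with 1 in * by (rewrite Cmod_R, Rabs_left; lra).
rewrite pow1, Rmult_1_l in *. rewrite Cmod_R, Rabs_pos_eq in H by lra.
apply Rle_trans with ((s * / 2) ^ m * Cmod (b m)).
- apply Rmult_le_compat_r; [apply Cmod_ge_0|]. apply pow_incr. split; [apply Cmod_ge_0|exact Hw].
- rewrite Rpow_mult_distr. replace (s ^ m * (/ 2) ^ m * Cmod (b m)) with (s ^ m * Cmod (b m) * (/ 2) ^ m) by ring.
  apply Rmult_le_compat_r; [apply pow_le; lra|exact H].
Qed.

Lemma stieltjes_leading_term (a : Rbar) (k : R -> C) (kz : C -> C) (n : nat) (nu : C) :
  Rbar_lt 0 a -> class_K a k -> complex_extension a k kz -> 0 < Re nu < 1 ->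
  is_equiv (K := C_AbsRing) (V := C_NormedModule)
    (within (fun w : C => w <> RtoC 0 /\ Rabs (Arg w) < PI) (Clocally (RtoC 0)))
    (fun w : C => int0 a (stieltjes_integrand k n nu w))
    (fun w : C => (k 0%R * Delta_n n nu w)%C).
Proof.
intros Ha HK Hext Hnu.
assert (Hk0 : k 0 <> 0) by apply HK. assert (Hk0' := proj1 (Cmod_gt_0 _) Hk0).
destruct (Hext 0 (Rle_refl 0) Ha) as [E0 A0].
destruct (analytic_at_taylor kz (RtoC 0) A0) as (c & r1 & R0 & M & HT).
destruct (Rbar_lt_between 0 a Ha) as [a1 [Ha1 Ha2]].
destruct HT as (Hr1 & HM & Hc & HT).
set (r := Rmin r1 a1). assert (Hr : 0 < r) by (apply Rmin_pos; lra).
assert (Hra1 : r <= r1) by apply Rmin_l. assert (Hra2 : r <= a1) by apply Rmin_r.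
assert (Hra : Rbar_lt r a) by (apply (Rbar_le_lt_trans r a1 a); [exact Hra2|exact Ha2]).
assert (HTk : taylor_bound kz c r R0 M).
{ split; [lra|split; [exact HM|split; [exact Hc|]]]. intros j z Hz.
  assert (Z := HT j z ltac:(lra)). rewrite Cplus_0_l in Z. exact Z. }
destruct (local_expansion a k kz n nu c r R0 M HK Hext Hnu HTk Hra) as [FP [_ HE]].
(* The positive real point w = r / 2 lies in the slit disc, so the expansion itself supplies
   convergence there. *)
destruct (power_series_bounded FP (r / 2)) as [B [HB HBw]]; [lra| |].
{ destruct (HE (RtoC (r / 2))) as [I [_ HI]].
  - apply RtoC_neq_0; lra.
  - assert (E : Arg (RtoC (r / 2)) = 0).
    { unfold Arg. simpl. rewrite Cmod_R, Rabs_pos_eq by lra. replace (r / 2 / (r / 2)) with 1 by (field; lra).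
      rewrite acos_1. destruct (Rle_dec 0 0); [reflexivity|lra]. }
    rewrite E, Rabs_R0. apply PI_RGT_0.
  - rewrite Cmod_R, Rabs_pos_eq; lra.
  - eexists; exact HI. }
destruct HTk as (_ & _ & _ & HTz).
assert (K0 : k 0 = c 0%nat).
{ apply Ceq_minus, Cmod_eq_0. apply Rle_antisym; [|apply Cmod_ge_0].
  assert (Z := HTz 0%nat (RtoC 0) ltac:(rewrite Cmod_0; lra)). rewrite csum_0, E0, Cmod_0 in Z. simpl in Z.
  replace (c 0%nat * 1)%C with (c 0%nat) in Z by ring. replace (M * (0 / R0 * 1)) with 0 in Z by (field; lra). exact Z. }
intros [eps He]. simpl.
(* With this threshold the bounded series, at most 2 B, is below half of eps |k(0) Delta_n|. *)
destruct (Delta_n_infinite n nu (4 * B / (eps * Cmod (k 0))) Hnu) as [d [Hd HD]].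
assert (HeK : 0 < eps * Cmod (k 0)) by (apply Rmult_lt_0_compat; assumption).
(* r / 4 is half the point r / 2 where convergence was used; the last entry makes |k(-w) - k(0)| at
   most eps |k(0)| / 2 by the Taylor bound of order 0, with M + 1 avoiding a division by zero. *)
set (d1 := Rmin (Rmin d (r / 4)) (eps * Cmod (k 0) * R0 / (2 * (M + 1)))).
assert (Hd1 : 0 < d1).
{ apply Rmin_pos; [apply Rmin_pos; lra|]. apply Rdiv_lt_0_compat; [apply Rmult_lt_0_compat; lra|lra]. }
unfold within. generalize (locally_Cmod_lt (RtoC 0) d1 Hd1). apply filter_imp.
intros w Hw [Hw0 Harg]. replace (w - 0)%C with w in Hw by Cring.
assert (W1 : Cmod w < d) by (eapply Rlt_le_trans; [exact Hw|]; eapply Rle_trans; [apply Rmin_l|apply Rmin_l]).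
assert (W2 : Cmod w < r / 4) by (eapply Rlt_le_trans; [exact Hw|]; eapply Rle_trans; [apply Rmin_l|apply Rmin_r]).
assert (W3 : Cmod w < eps * Cmod (k 0) * R0 / (2 * (M + 1))) by (eapply Rlt_le_trans; [exact Hw|apply Rmin_r]).
destruct (HE w Hw0 Harg ltac:(lra)) as [I [HI HS]].
destruct (is_CInt_gen_int0 _ _ _ HI) as [_ EI]. rewrite EI.
assert (BS := HBw w _ ltac:(lra) HS). specialize (HD w Hw0 Harg W1).
set (De := Delta_n n nu w) in *.
change (Cmod (k 0%R * De - I)%C <= eps * Cmod (k 0%R * De)%C).
replace (k 0%R * De - I)%C with ((k 0%R - kz (- w)) * De + - (I - kz (- w) * De))%C by ring.
eapply Rle_trans; [apply Cmod_triangle|]. rewrite Cmod_opp, !Cmod_mult.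
assert (T1 : Cmod (k 0%R - kz (- w))%C <= eps * Cmod (k 0) / 2).
{ assert (Z := HTz 0%nat (- w)%C ltac:(rewrite Cmod_opp; lra)). rewrite csum_0 in Z. simpl in Z.
  replace (c 0%nat * 1)%C with (k 0%R) in Z by (rewrite K0; ring). rewrite Cmod_opp, Rmult_1_r in Z.
  replace (k 0%R - kz (- w))%C with (- (kz (- w) - k 0%R))%C by ring. rewrite Cmod_opp.
  eapply Rle_trans; [exact Z|].
  apply Rle_trans with ((M + 1) * (Cmod w / R0)).
  - apply Rmult_le_compat_r; [apply Rdiv_le_0_compat; [apply Cmod_ge_0|lra]|lra].
  - apply Rmult_le_reg_r with (R0 / (M + 1)); [apply Rdiv_lt_0_compat; lra|].
    replace ((M + 1) * (Cmod w / R0) * (R0 / (M + 1))) with (Cmod w) by (field; lra).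
    left. eapply Rlt_le_trans; [exact W3|]. right; field; lra. }
assert (T2 : 2 * B <= eps * Cmod (k 0) / 2 * Cmod De).
{ apply Rle_trans with (eps * Cmod (k 0) / 2 * (4 * B / (eps * Cmod (k 0)))); [right; field; lra|].
  apply Rmult_le_compat_l; lra. }
assert (D0 := Cmod_ge_0 De).
assert (Cmod (k 0%R - kz (- w))%C * Cmod De <= eps * Cmod (k 0) / 2 * Cmod De) by (apply Rmult_le_compat_r; assumption).
lra.
Qed.

Theorem theorem7p1 (a : Rbar) (k : R -> C) (kz : C -> C) (n : nat) (nu : C) :
  Rbar_lt 0 a ->
  class_K a k ->
  complex_extension a k kz ->
  0 < Re nu < 1 ->
  (is_finite a ->
   forall w : C, w <> RtoC 0 -> Rabs (Arg w) < PI ->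
     Rbar_lt (Cmod w) (Rbar_min (singularity_distance kz) a) ->
     ex_int0 a (stieltjes_integrand k n nu w) /\
     stieltjes_expansion a k kz n nu w)
  /\
  (a = p_infty ->
   forall w : C, w <> RtoC 0 -> Rabs (Arg w) < PI ->
     Rbar_lt (Cmod w) (singularity_distance kz) ->
     ex_int0 a (stieltjes_integrand k n nu w) ->
     stieltjes_expansion a k kz n nu w)
  /\
  ((a = p_infty ->
    forall w : C, w <> RtoC 0 -> Rabs (Arg w) < PI ->
      Rbar_lt (Cmod w) (singularity_distance kz) ->
      ex_int0 a (stieltjes_integrand k n nu w)) ->
   is_equiv (K := C_AbsRing) (V := C_NormedModule)
     (within (fun w : C => w <> RtoC 0 /\ Rabs (Arg w) < PI)
        (@locally C_UniformSpace (RtoC 0)))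
     (fun w : C => int0 a (stieltjes_integrand k n nu w))
     (fun w : C => (k 0%R * Delta_n n nu w)%C)).
Proof.
intros Ha HK Hext Hnu. split; [|split].
- intros _ w Hw Harg Hmin.
  apply singularity_expansion; try assumption.
  + apply (Rbar_lt_le_trans _ _ _ Hmin), Rbar_min_l.
  + apply (Rbar_lt_le_trans _ _ _ Hmin), Rbar_min_r.
- intros Hinf w Hw Harg Hsing _.
  apply singularity_expansion; try assumption. rewrite Hinf. exact I.
- intros _. apply (stieltjes_leading_term a k kz); assumption.
Qed.
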